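(* Let $\phi\in L^{2}(\mathbb{R}^{2n})$ be such that the system $\{T^{t}_{(k,l)}\phi : k,l\in\mathbb{Z}^{n}\}$ forms a Riesz sequence. Then there exists $\tilde{\phi}\in V^{t}(\phi)$ such that $\{T^{t}_{(k,l)}\tilde{\phi} : k,l\in\mathbb{Z}^{n}\}$ is an orthonormal system for $V^{t}(\phi)$, with $V^{t}(\phi)=V^{t}(\tilde{\phi})$. More explicitly, $\tilde{\phi}$ is given by $$Z_{W}\tilde{\phi}(\xi,\xi',\eta)=\frac{1}{\sqrt{[\phi,\phi](\xi,\xi')}}\,Z_{W}\phi(\xi,\xi',\eta).$$
   Context: Notation: $\mathbb{T}^{n}$ is identified with $[0,1)^{n}$ with Lebesgue measure. Identities between functions of $(\xi,\xi',\eta)\in\mathbb{T}^{n}\times\mathbb{T}^{n}\times\mathbb{R}^{n}$ hold almost everywhere. Twisted translation: for $\phi\in L^{2}(\mathbb{R}^{2n})$ and $(k,l)\in\mathbb{Z}^{n}\times\mathbb{Z}^{n}$, $T^{t}_{(k,l)}\phi(x,y)=e^{\pi i(x\cdot l-y\cdot k)}\phi(x-k,y-l)$ for $(x,y)\in\mathbb{R}^{n}\times\mathbb{R}^{n}$. The principal twisted shift-invariant space is $V^{t}(\phi)=\overline{\operatorname{span}}\{T^{t}_{(k,l)}\phi : k,l\in\mathbb{Z}^{n}\}$. Weyl kernel: for $\phi\in L^{1}\cap L^{2}(\mathbb{R}^{2n})$, $K_{\phi}(\xi,\eta)=\int_{\mathbb{R}^{n}}\phi(x,\eta-\xi)e^{\pi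 i x\cdot(\xi+\eta)}\,dx$, $\xi,\eta\in\mathbb{R}^{n}$ (the integral kernel of the Weyl transform of $\phi$). The map $\phi\mapsto K_{\phi}$ is isometric for the $L^{2}(\mathbb{R}^{2n})$ norm and is extended by density to all of $L^{2}(\mathbb{R}^{2n})$. Weyl-Zak transform: $Z_{W}:L^{2}(\mathbb{R}^{2n})\to L^{2}(\mathbb{T}^{n}\times\mathbb{T}^{n}\times\mathbb{R}^{n})$, $Z_{W}\phi(\xi,\xi',\eta)=\sum_{m\in\mathbb{Z}^{n}}K_{\phi}(m+\xi,\eta)e^{-2\pi i m\cdot\xi'}$; it is an isometric isomorphism onto. Bracket: for $\phi,\psi\in L^{2}(\mathbb{R}^{2n})$, $[\phi,\psi](\xi,\xi')=\int_{\mathbb{R}^{n}}Z_{W}\phi(\xi,\xi',\eta)\overline{Z_{W}\psi(\xi,\xi',\eta)}\,d\eta$ for a.e. $(\xi,\xi')\in\mathbb{T}^{n}\times\mathbb{T}^{n}$. A countable family $\{f_{j}\}$ is a Riesz basis for a Hilbert space $\mathcal{H}$ if it is the image of an orthonormal basis of $\mathcal{H}$ under a bounded invertible operator on $\mathcal{H}$. It is a Riesz sequence if it is a Riesz basis for its closed linear span. *)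

(* Defs.v *)
From HB Require Import structures.
From mathcomp Require Import all_boot all_order all_algebra finmap.
From mathcomp Require Import all_classical all_reals all_analysis.
From mathcomp Require Import complex.

Set Implicit Arguments.
Unset Strict Implicit.
Unset Printing Implicit Defensive.
Import Order.TTheory GRing.Theory Num.Theory.
Import numFieldNormedType.Exports.

Local Open Scope classical_set_scope.
Local Open Scope ring_scope.
Local Open Scope complex_scope.

(* [product_measure1] has no usable sigma-finite instance: the one inferred by
   the library is that of a product of subprobabilities. *)
Section product.
Context {d1 d2 : measure_display} {T1 : measurableType d1}
  {T2 : measurableType d2} {R : realType}.
Variable m1 : {sigma_finite_measure set T1 -> \bar R}.
Variable m2 : {sigma_finite_measure set T2 -> \bar R}.

Definition prodm : set (T1 * T2) -> \bar R := (m1 \x m2)%E.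

HB.instance Definition _ := Measure.on prodm.

Lemma prodm_sigma_finite : sigma_finite setT prodm.
Proof.
have /sigma_finiteP[F [TF ndF Foo]] := sigma_finiteT m1.
have /sigma_finiteP[G [TG ndG Goo]] := sigma_finiteT m2.
exists (fun i => F i `*` G i).
  apply/seteqP; split => [[x y] _|//].
  have [i _ Fix] : (\bigcup_i F i) x by rewrite -TF.
  have [j _ Gjy] : (\bigcup_i G i) y by rewrite -TG.
  exists (maxn i j) => //; split.
    by move: x Fix; exact/subsetPset/ndF/leq_maxl.
  by move: y Gjy; exact/subsetPset/ndG/leq_maxr.
move=> i; have [mF Fi] := Foo i; have [mG Gi] := Goo i.
split; first exact: measurableX.
by rewrite /prodm product_measure1E// lte_mul_pinfty// ge0_fin_numE.
Qed.

HB.instance Definition _ := Measure_isSigmaFinite.Build _ _ _ prodm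
  prodm_sigma_finite.

End product.

Definition Rn (R : realType) (n : nat) : Type := n.-tuple (measurableTypeR R).
HB.instance Definition _ (R : realType) (n : nat) := Measurable.on (Rn R n).

Definition Zn (n : nat) : Type := n.-tuple int.
HB.instance Definition _ (n : nat) := Choice.on (Zn n).

Section vectors.
Context {R : realType} {n : nat}.
Implicit Types x y : Rn R n.

Definition rcoord x (i : 'I_n) : R := tnth x i.
Definition vadd x y : Rn R n := [tuple rcoord x i + rcoord y i | i < n].
Definition vsub x y : Rn R n := [tuple rcoord x i - rcoord y i | i < n].
Definition dot x y : R := \sum_(i < n) rcoord x i * rcoord y i.
Definition intv (m : Zn n) : Rn R n := [tuple (tnth m i)%:~R | i < n].

End vectors.

Section lebesgue_step.
Context {R : realType} {n : nat}.
Variable mu : {sigma_finite_measure set (Rn R n) -> \bar R}.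

Definition cons_Rn (p : measurableTypeR R * Rn R n) : Rn R n.+1 :=
  [tuple of p.1 :: p.2].

Lemma measurable_cons_Rn : measurable_fun [set: _] cons_Rn.
Proof. exact: measurable_cons measurable_fst measurable_snd. Qed.

Definition lebesgue_step : set (Rn R n.+1) -> \bar R :=
  pushforward (prodm lebesgue_measure mu) cons_Rn.

Let mstep : {measure set (Rn R n.+1) -> \bar R} :=
  @measure_function_pushforward__canonical__measure_function_Measure
    _ _ _ _ _ (prodm lebesgue_measure mu) _ measurable_cons_Rn.

HB.instance Definition _ := Measure.copy lebesgue_step mstep.

Lemma lebesgue_step_sigma_finite : sigma_finite setT lebesgue_step.
Proof.
have [F TF Foo] := sigma_finiteT (prodm lebesgue_measure mu).
pose uncons (t : Rn R n.+1) : measurableTypeR R * Rn R n :=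
  (thead t, [tuple of behead t]).
have unconsK : cancel uncons cons_Rn.
  by case/tupleP => x t; apply/val_inj => /=.
have consK : cancel cons_Rn uncons.
  move=> [x t]; rewrite /uncons /cons_Rn /= theadE.
  by congr pair; apply: val_inj.
have muncons : measurable_fun setT uncons.
  by apply: measurable_fun_pair; [exact: measurable_tnth|exact: measurable_behead].
exists (fun i => uncons @^-1` F i); first by rewrite -preimage_bigcup -TF.
move=> i; have [mF Fi] := Foo i; split.
  by rewrite -[X in measurable X]setTI; exact: muncons.
rewrite /lebesgue_step /pushforward -comp_preimage.
by rewrite (_ : uncons \o cons_Rn = id)//; apply/funext => p; exact: consK.
Qed.

HB.instance Definition _ := Measure_isSigmaFinite.Build _ _ _ lebesgue_step
  lebesgue_step_sigma_finite.
End lebesgue_step.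

Fixpoint leb {R : realType} (n : nat) :
    {sigma_finite_measure set (Rn R n) -> \bar R} :=
  match n with
  | 0 => \d_([tuple] : Rn R 0)
  | n'.+1 => lebesgue_step (leb n')
  end.

Definition leb2 {R : realType} (n : nat) :
    {sigma_finite_measure set (Rn R n * Rn R n)%type -> \bar R} :=
  prodm (leb n) (leb n).

Section torus.
Context {R : realType}.
Variable n : nat.

Definition cube : set (Rn R n) := [set x | forall i, 0 <= rcoord x i < 1].

Lemma measurable_cube : measurable cube.
Proof.
rewrite (_ : cube = \bigcap_(i in [set: 'I_n])
    ((fun x : Rn R n => rcoord x i) @^-1` `[0, 1[%classic)).
  apply: fin_bigcap_measurable; first exact: finite_finset.
  move=> i _; rewrite -[X in measurable X]setTI.
  exact: (measurable_tnth i).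
apply/seteqP; split=> [x cx i _|x cx i]; first by rewrite /= in_itv/= cx.
by have := cx i I; rewrite /= in_itv.
Qed.

(* Lebesgue measure of the torus [0,1)^n, viewed as a measure on R^n carried
   by the cube. *)
Definition torus : set (Rn R n) -> \bar R := mrestr (leb n) measurable_cube.

HB.instance Definition _ := Measure.on torus.

Lemma torus_sigma_finite : sigma_finite setT torus.
Proof.
have [F TF Foo] := sigma_finiteT (@leb R n).
exists F => // i; have [mF Fi] := Foo i; split => //.
apply: (@le_lt_trans _ _ (leb n (F i))) => //.
apply: le_measure; rewrite ?inE//.
by apply: measurableI => //; exact: measurable_cube.
Qed.

HB.instance Definition _ := Measure_isSigmaFinite.Build _ _ _ torus
  torus_sigma_finite.

Definition torus3 :
    {sigma_finite_measure set (Rn R n * Rn R n * Rn R n)%type -> \bar R} :=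
  prodm (prodm torus torus) (leb n).

End torus.
Arguments cube {R} n.
Arguments torus {R} n.
Arguments torus3 {R} n.

Section complex_functions.
Context {d : measure_display} {T : measurableType d} {R : realType}.
Variable mu : {measure set T -> \bar R}.
Implicit Types f g : T -> R[i].

Definition modulus (z : R[i]) : R := ComplexField.Normc.normc z.

Definition cmeasurable f :=
  measurable_fun setT (fun x => complex.Re (f x)) /\
  measurable_fun setT (fun x => complex.Im (f x)).

Definition cintegral f : R[i] :=
  Rintegral mu setT (fun x => complex.Re (f x)) +i*
  Rintegral mu setT (fun x => complex.Im (f x)).

Definition cnorm (p : \bar R) f : \bar R :=
  Lnorm mu p (fun x => (modulus (f x))%:E).

(* Elements of L^p are represented by genuine functions; a function and any
   other measurable function a.e. equal to it represent the same element. *)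
Definition Lp (p : \bar R) : set (T -> R[i]) :=
  [set f | cmeasurable f /\ (cnorm p f < +oo)%E].

Definition L2 := Lp 2%:E.
Definition L2norm f := cnorm 2%:E f.
Definition inner f g : R[i] := cintegral (fun x => f x * (g x)^*).

Section families.
Context {J : choiceType}.
Implicit Types (e : J -> T -> R[i]) (V : set (T -> R[i])).

Definition lincomb (F : {fset J}) (c : J -> R[i]) e : T -> R[i] :=
  fun x => \sum_(j <- F) c j * e j x.

Definition closed_span e : set (T -> R[i]) :=
  [set f | L2 f /\ forall eps : R, 0 < eps ->
    exists F c, (L2norm (fun x => (f x - lincomb F c e x)%R) < eps%:E)%E].

Definition orthonormal_in V e :=
  (forall j, V (e j)) /\ forall i j, inner (e i) (e j) = (i == j)%:R.

Definition orthonormal_basis V e := orthonormal_in V e /\ closed_span e = V.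

(* Operators act on representatives, hence are linear up to a.e. equality;
   linearity and boundedness make them compatible with a.e. equality. *)
Definition bounded_operator V (U : (T -> R[i]) -> (T -> R[i])) :=
  [/\ forall f, V f -> V (U f),
      forall (a : R[i]) f g, V f -> V g ->
        U (fun x => a * f x + g x) = (fun x => a * U f x + U g x) %[ae mu]
    & exists M : R, forall f, V f -> (L2norm (U f) <= M%:E * L2norm f)%E].

Definition bounded_invertible V (U : (T -> R[i]) -> (T -> R[i])) :=
  bounded_operator V U /\
  exists W, bounded_operator V W /\
    forall f, V f -> W (U f) = f %[ae mu] /\ U (W f) = f %[ae mu].

Definition riesz_basis V e :=
  exists u U, [/\ orthonormal_basis V u, bounded_invertible V U
    & forall j, e j = U (u j) %[ae mu]].

Definition riesz_sequence e := riesz_basis (closed_span e) e.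

End families.
End complex_functions.

Section twisted.
Context {R : realType} {n : nat}.
Implicit Types (phi psi K : Rn R n * Rn R n -> R[i])
  (Z : Rn R n * Rn R n * Rn R n -> R[i]).

Definition expi (t : R) : R[i] := cos t +i* sin t.

Definition twisted_translation (kl : Zn n * Zn n) phi : Rn R n * Rn R n -> R[i] :=
  fun p =>
    let k := intv kl.1 in let l := intv kl.2 in
    expi (pi * (dot p.1 l - dot p.2 k)) * phi (vsub p.1 k, vsub p.2 l).

Definition twisted_space phi : set (Rn R n * Rn R n -> R[i]) :=
  closed_span (leb2 n) (twisted_translation ^~ phi).

Definition weyl_kernel_int phi : Rn R n * Rn R n -> R[i] :=
  fun p => cintegral (leb n)
    (fun x => phi (x, vsub p.2 p.1) * expi (pi * dot x (vadd p.1 p.2))).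

(* The integral formula makes sense on L^1 /\ L^2 only; it is extended by
   density to L^2, and [K] is then determined by [phi] up to a.e. equality. *)
Definition is_weyl_kernel phi K :=
  L2 (leb2 n) K /\
  exists phi_ : nat -> Rn R n * Rn R n -> R[i],
    [/\ forall j, Lp (leb2 n) 1%:E (phi_ j) /\ L2 (leb2 n) (phi_ j),
        L2norm (leb2 n) (fun p => phi_ j p - phi p) @[j --> \oo] --> 0%E
      & L2norm (leb2 n) (fun p => weyl_kernel_int (phi_ j) p - K p)
          @[j --> \oo] --> 0%E].

(* An arbitrary choice of representative; [xget] returns the default value 0
   only if there is none. *)
Definition weyl_kernel phi : Rn R n * Rn R n -> R[i] :=
  xget (fun=> 0) [set K | is_weyl_kernel phi K].

Definition zak_partial_sum K (F : {fset Zn n}) : Rn R n * Rn R n * Rn R n -> R[i] :=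
  fun p => \sum_(m <- F)
    K (vadd (intv m) p.1.1, p.2) * expi (- (2 * pi * dot (intv m) p.1.2)).

(* For a general L^2 kernel, the series over Z^n is not a pointwise sum: it
   converges unconditionally in L^2(T^n x T^n x R^n). *)
Definition is_zak_sum K Z :=
  L2 (torus3 n) Z /\
  forall eps : R, 0 < eps -> exists F0 : {fset Zn n},
    forall F : {fset Zn n}, (F0 `<=` F)%fset ->
      (L2norm (torus3 n) (fun p => (zak_partial_sum K F p - Z p)%R) < eps%:E)%E.

Definition weyl_zak phi : Rn R n * Rn R n * Rn R n -> R[i] :=
  xget (fun=> 0) [set Z | is_zak_sum (weyl_kernel phi) Z].

Definition bracket phi psi : Rn R n * Rn R n -> R[i] :=
  fun q => cintegral (leb n)
    (fun eta => weyl_zak phi (q, eta) * (weyl_zak psi (q, eta))^*).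

End twisted.

(* Main.v *)
(* The Weyl-Zak transform is an isometry which turns the twisted translation by
   (k, l) into the multiplication by exp(i pi k.l) times the character (k, l) of
   the torus in (xi, xi'). Hence the squared norm of a linear combination of the
   translates of phi is the integral over the torus of |p|^2 w, where p is a
   trigonometric polynomial and w = [phi, phi]. The Riesz inequalities, extended
   from trigonometric polynomials to L^2 of the torus by density, force w to be
   bounded above and below by positive constants almost everywhere. Approximating
   w^(-1/2) by trigonometric polynomials yields an element phit of the closed span
   of the translates of phi whose transform is w^(-1/2) times that of phi. Then
   [phit, phit] = 1, which makes the translates of phit orthonormal, and
   approximating w^(1/2) puts phi back in the closed span of those of phit.
   The isometry is Plancherel's theorem for the Weyl kernel, obtained from
   Parseval's identity by periodization, followed by Fubini's theorem on the
   series over Z^n. *)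
Require Import Defs.
From HB Require Import structures.
From mathcomp Require Import all_boot all_order all_algebra finmap.
From mathcomp Require Import all_classical all_reals all_analysis measurable_realfun.
From mathcomp Require Import complex.
From mathcomp Require Import ring lra.

Set Implicit Arguments.
Unset Strict Implicit.
Unset Printing Implicit Defensive.
Import Order.TTheory GRing.Theory Num.Theory.
Import numFieldNormedType.Exports.

Local Open Scope classical_set_scope.
Local Open Scope ring_scope.
Local Open Scope complex_scope.


(** * L^2 spaces of complex functions *)

(** Kernels and Zak series are determined only almost everywhere. Isometry, linearity and covariance
    are therefore proved for relations between representatives, which survive sums, translations and
    limits, and reach the chosen [weyl_zak] by uniqueness almost everywhere. The density of
    trigonometric polynomials is obtained by measure theory: polynomials in a real trigonometric
    polynomial approximate the indicators of its sublevel sets, and the coordinates of a point of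
    the cube are recovered from cosines and sines, so these sets generate all Borel sets of the
    cube. The bounds on w come from multiplying the transform of phi by the indicator of a set where
    w would be too small or too large. A product with a general L^2 multiplier is not known
    beforehand to be square integrable, so the upper inequality is extended by Fatou's lemma along
    an almost everywhere convergent sequence, and the lower one uses the upper one to control its
    error. *)

Ltac cring := apply/eqP; rewrite eq_complex /=; apply/andP; split; apply/eqP; ring.

Section sqn.
Context {R : realType}.
Implicit Types (z w : R[i]).

Definition sqn z : R := complex.Re z ^+ 2 + complex.Im z ^+ 2.

Lemma modulusE z : modulus z = Num.sqrt (sqn z).
Proof. by case: z. Qed.

Lemma sqn_ge0 z : 0 <= sqn z.
Proof. by rewrite addr_ge0 ?sqr_ge0. Qed.

Lemma sqn0 : sqn 0 = 0.
Proof. by rewrite /sqn /= expr0n addr0. Qed.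

Lemma sqn1 : sqn 1 = 1.
Proof. by rewrite /sqn /= expr0n addr0 expr1n. Qed.

Lemma sqnM z w : sqn (z * w) = sqn z * sqn w.
Proof. by case: z w => [a b] [c d]; rewrite /sqn /=; ring. Qed.

Lemma sqnN z : sqn (- z) = sqn z.
Proof. by case: z => a b; rewrite /sqn /=; ring. Qed.

Lemma sqn_conj z : sqn (z^*)%R = sqn z.
Proof. by case: z => a b; rewrite /sqn /=; ring. Qed.

Lemma sqn_real (x : R) : sqn x%:C = x ^+ 2.
Proof. by rewrite /sqn /=; ring. Qed.

Lemma sqn_eq0 z : sqn z = 0 -> z = 0.
Proof.
case: z => a b; rewrite /sqn /= => /eqP; rewrite paddr_eq0 ?sqr_ge0// !sqrf_eq0.
by case/andP => /eqP -> /eqP ->.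
Qed.

Lemma Re_conj z : complex.Re (z^*)%R = complex.Re z.
Proof. by case: z. Qed.

Lemma Re_mul_conjC z w : complex.Re (z * w^*) = complex.Re (w * z^*).
Proof. by case: z w => [a b] [c d] /=; ring. Qed.

Lemma mulc_conj z : z * z^* = (sqn z)%:C.
Proof. by case: z => a b; rewrite /sqn; cring. Qed.

Lemma sqnD z w : sqn (z + w) = sqn z + sqn w + 2 * complex.Re (z * w^*).
Proof. by case: z w => [a b] [c d]; rewrite /sqn /=; ring. Qed.

(** Young's inequality: the right side minus the left side is [t^-1 * sqn (t z - w)]. *)
Lemma Re_mul_conj_le (t : R) z w : 0 < t ->
  2 * complex.Re (z * w^*) <= t * sqn z + t^-1 * sqn w.
Proof.
move=> t0; have tV : t * t^-1 = 1 by rewrite mulfV// gt_eqF.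
have tV0 : 0 < t^-1 by rewrite invr_gt0.
case: z w => [a b] [c d]; rewrite /sqn /=.
have -> : t * (a ^+ 2 + b ^+ 2) + t^-1 * (c ^+ 2 + d ^+ 2) =
    2 * (a * c - b * - d) + t^-1 * ((t * a - c) ^+ 2 + (t * b - d) ^+ 2).
  transitivity (t * (t * t^-1) * (a ^+ 2 + b ^+ 2) + t^-1 * (c ^+ 2 + d ^+ 2)
     + 2 * (1 - t * t^-1) * (a * c + b * d)); first by rewrite tV; ring.
  by ring.
by rewrite lerDl mulr_ge0 ?addr_ge0 ?sqr_ge0// ltW.
Qed.

Lemma sqnD_le (t : R) z w : 0 < t ->
  sqn (z + w) <= (1 + t) * sqn z + (1 + t^-1) * sqn w.
Proof. by move=> t0; rewrite sqnD; have := Re_mul_conj_le z w t0; lra. Qed.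

Lemma sqr_Re_le z : complex.Re z ^+ 2 <= sqn z.
Proof. by rewrite lerDl sqr_ge0. Qed.

Lemma sqr_Im_le z : complex.Im z ^+ 2 <= sqn z.
Proof. by rewrite lerDr sqr_ge0. Qed.

Lemma sqn_expi (t : R) : sqn (expi t) = 1.
Proof. by rewrite /sqn /= cos2Dsin2. Qed.

Lemma expiD (s t : R) : expi (s + t) = expi s * expi t.
Proof. by rewrite /expi cosD sinD; cring. Qed.

Lemma expi0 : expi (0 : R) = 1.
Proof. by rewrite /expi cos0 sin0. Qed.

Lemma expiN (t : R) : expi (- t) = ((expi t)^*)%R.
Proof. by rewrite /expi cosN sinN. Qed.

End sqn.

Section cmeasurable.
Context {d} {T : measurableType d} {R : realType}.
Implicit Types f g : T -> R[i].

Lemma cmeasurable_cst (c : R[i]) : cmeasurable (fun _ : T => c).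
Proof. by split; exact: measurable_cst. Qed.

Lemma cmeasurableD f g : cmeasurable f -> cmeasurable g ->
  cmeasurable (fun x => f x + g x).
Proof.
move=> [f1 f2] [g1 g2]; split.
  by rewrite (_ : (fun _ => _) = (fun x => complex.Re (f x) + complex.Re (g x)));
    [exact: measurable_funD|apply/funext => x; rewrite raddfD].
by rewrite (_ : (fun _ => _) = (fun x => complex.Im (f x) + complex.Im (g x)));
  [exact: measurable_funD|apply/funext => x; rewrite raddfD].
Qed.

Lemma cmeasurableM f g : cmeasurable f -> cmeasurable g ->
  cmeasurable (fun x => f x * g x).
Proof.
move=> [f1 f2] [g1 g2]; split.
  rewrite (_ : (fun _ => _) = (fun x => complex.Re (f x) * complex.Re (g x) -
     complex.Im (f x) * complex.Im (g x))).
    by apply: measurable_funB; exact: measurable_funM.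
  by apply/funext => x; case: (f x) (g x) => ? ? [? ?].
rewrite (_ : (fun _ => _) = (fun x => complex.Re (f x) * complex.Im (g x) +
     complex.Im (f x) * complex.Re (g x))).
  by apply: measurable_funD; exact: measurable_funM.
by apply/funext => x; case: (f x) (g x) => ? ? [? ?].
Qed.

Lemma cmeasurableN f : cmeasurable f -> cmeasurable (fun x => - f x).
Proof.
move=> mf; rewrite (_ : (fun _ => _) = (fun x => (-1) * f x)); last first.
  by apply/funext => x; rewrite mulN1r.
exact: (cmeasurableM (cmeasurable_cst _)).
Qed.

Lemma cmeasurableB f g : cmeasurable f -> cmeasurable g ->
  cmeasurable (fun x => f x - g x).
Proof. by move=> mf mg; exact: (cmeasurableD mf (cmeasurableN mg)). Qed.

Lemma cmeasurable_conj f : cmeasurable f -> cmeasurable (fun x => (f x)^*).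
Proof.
move=> [f1 f2]; split.
  by rewrite (_ : (fun _ => _) = (fun x => complex.Re (f x)))//;
    apply/funext => x; case: (f x).
rewrite (_ : (fun _ => _) = (fun x => - complex.Im (f x))).
  exact: measurable_funN.
by apply/funext => x; case: (f x).
Qed.

Lemma cmeasurable_sum (I : Type) (s : seq I) (F : I -> T -> R[i]) :
  (forall i, cmeasurable (F i)) -> cmeasurable (fun x => \sum_(i <- s) F i x).
Proof.
move=> mF; elim: s => [|i s ih].
  by under eq_fun do rewrite big_nil; exact: cmeasurable_cst.
by under eq_fun do rewrite big_cons; exact: cmeasurableD.
Qed.

Lemma cmeasurable_comp {d'} {T' : measurableType d'} (h : T' -> T) f :
  measurable_fun setT h -> cmeasurable f -> cmeasurable (fun x => f (h x)).
Proof.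
by move=> mh [f1 f2]; split; [exact: (measurableT_comp f1)|exact: (measurableT_comp f2)].
Qed.

Lemma cmeasurable_real (h : T -> R) : measurable_fun setT h ->
  cmeasurable (fun x => (h x)%:C).
Proof. by move=> mh; split => //; exact: measurable_cst. Qed.

Lemma cmeasurable_expi (h : T -> R) : measurable_fun setT h ->
  cmeasurable (fun x => expi (h x)).
Proof.
move=> mh; split => /=.
  by apply: (measurableT_comp _ mh); apply: continuous_measurable_fun; exact: continuous_cos.
by apply: (measurableT_comp _ mh); apply: continuous_measurable_fun; exact: continuous_sin.
Qed.

Lemma measurable_sqn f : cmeasurable f -> measurable_fun setT (fun x => sqn (f x)).
Proof. by move=> [f1 f2]; apply: measurable_funD; exact: measurable_funX. Qed.

Lemma emeasurable_sqn f : cmeasurable f ->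
  measurable_fun setT (fun x => (sqn (f x))%:E).
Proof. by move=> mf; apply/measurable_EFinP; exact: measurable_sqn. Qed.

Lemma lincombE (J : choiceType) (F : {fset J}) c (e : J -> T -> R[i]) :
  lincomb F c e = fun x => \sum_(j <- F) c j * e j x.
Proof. by []. Qed.

Lemma cmeasurable_lincomb (J : choiceType) (F : {fset J}) c (e : J -> T -> R[i]) :
  (forall j, cmeasurable (e j)) -> cmeasurable (lincomb F c e).
Proof.
move=> me; apply: (@cmeasurable_sum _ _ (fun j x => c j * e j x)) => j.
by apply: cmeasurableM => //; exact: cmeasurable_cst.
Qed.

End cmeasurable.

Section N2.
Context {d} {T : measurableType d} {R : realType}.
Variable mu : {measure set T -> \bar R}.
Implicit Types f g : T -> R[i].

(* Norms are estimated through their squares: [N2D_le], with its free constants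
   1 + t and 1 + 1/t, replaces Minkowski's inequality. *)
Definition N2 f : \bar R := (\int[mu]_x (sqn (f x))%:E)%E.

Lemma N2_ge0 f : (0 <= N2 f)%E.
Proof. by apply: integral_ge0 => x _; rewrite lee_fin sqn_ge0. Qed.

Lemma L2normE f : L2norm mu f = poweR (N2 f) 2^-1.
Proof.
rewrite /L2norm /cnorm unlock; congr poweR; apply: eq_integral => x _ /=.
rewrite modulusE ger0_norm ?sqrtr_ge0// powR_mulrn ?sqrtr_ge0//.
by rewrite sqr_sqrtr ?sqn_ge0.
Qed.

Lemma L2norm_lt f (eps : R) : 0 < eps ->
  ((L2norm mu f < eps%:E) = (N2 f < (eps ^+ 2)%:E))%E.
Proof.
move=> e0; rewrite L2normE; move: (N2_ge0 f).
move: (N2 f) => [r| |]//; last by move=> _; rewrite poweRyr.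
rewrite lee_fin => r0 /=; rewrite !lte_fin powR12_sqrt//.
by rewrite -{1}(@ger0_norm _ eps) ?(ltW e0)// -sqrtr_sqr ltr_sqrt// exprn_gt0.
Qed.

Lemma L2P f : L2 mu f <-> cmeasurable f /\ (N2 f < +oo)%E.
Proof.
rewrite /L2 /Lp /=; change (cnorm mu 2%:E f) with (L2norm mu f).
rewrite L2normE; move: (N2_ge0 f).
move: (N2 f) => [r| |]// r0; split => -[mf lf]; split => //.
- exact: ltry.
- exact: ltry.
- by move: lf; rewrite poweRyr.
Qed.

Lemma L2_fin f : L2 mu f -> N2 f \is a fin_num.
Proof. by move=> /L2P[_ h]; rewrite ge0_fin_numE// N2_ge0. Qed.

Lemma L2_cmeasurable f : L2 mu f -> cmeasurable f.
Proof. by case. Qed.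

Lemma eq_N2 f g : (forall x, sqn (f x) = sqn (g x)) -> N2 f = N2 g.
Proof. by move=> fg; apply: eq_integral => x _; rewrite fg. Qed.

Lemma N2_le f g : cmeasurable f -> cmeasurable g ->
  (forall x, sqn (f x) <= sqn (g x)) -> (N2 f <= N2 g)%E.
Proof.
move=> mf mg fg; apply: ge0_le_integral => //.
- by move=> x _; rewrite lee_fin sqn_ge0.
- exact: emeasurable_sqn.
- exact: emeasurable_sqn.
- by move=> x _; rewrite lee_fin.
Qed.

Lemma N2_0 : N2 (fun=> 0) = 0%E.
Proof. by rewrite /N2; under eq_integral do rewrite sqn0; rewrite integral0. Qed.

Lemma N2Z (c : R[i]) f : cmeasurable f ->
  N2 (fun x => c * f x) = ((sqn c)%:E * N2 f)%E.
Proof.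
move=> mf; rewrite /N2; under eq_integral do rewrite sqnM EFinM.
rewrite ge0_integralZl//; [exact: emeasurable_sqn| |by rewrite lee_fin sqn_ge0].
by move=> x _; rewrite lee_fin sqn_ge0.
Qed.

Lemma N2N f : N2 (fun x => - f x) = N2 f.
Proof. by apply: eq_N2 => x; rewrite sqnN. Qed.

Lemma N2_sub f g : N2 (fun x => f x - g x) = N2 (fun x => g x - f x).
Proof. by apply: eq_N2 => x; rewrite -sqnN opprB. Qed.

Lemma N2D_le (t : R) f g : 0 < t -> cmeasurable f -> cmeasurable g ->
  (N2 (fun x => f x + g x)%R <= (1 + t)%:E * N2 f + (1 + t^-1)%:E * N2 g)%E.
Proof.
move=> t0 mf mg.
have t1 : 0 <= 1 + t by rewrite addr_ge0// ltW.
have t2 : 0 <= 1 + t^-1 by rewrite addr_ge0// ltW// invr_gt0.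
rewrite /N2 -ge0_integralZl//; last 2 first.
- exact: emeasurable_sqn.
- by move=> x _; rewrite lee_fin sqn_ge0.
rewrite -ge0_integralZl//; last 2 first.
- exact: emeasurable_sqn.
- by move=> x _; rewrite lee_fin sqn_ge0.
have m1 (c : R) h : cmeasurable h ->
    measurable_fun setT (fun x : T => (c%:E * (sqn (h x))%:E)%E).
  by move=> mh; apply: measurable_funeM; exact: emeasurable_sqn.
rewrite -ge0_integralD//; last 4 first.
- by move=> x _; rewrite -EFinM lee_fin mulr_ge0 ?sqn_ge0.
- exact: m1.
- by move=> x _; rewrite -EFinM lee_fin mulr_ge0 ?sqn_ge0.
- exact: m1.
apply: ge0_le_integral => //.
- by move=> x _; rewrite lee_fin sqn_ge0.
- exact/emeasurable_sqn/cmeasurableD.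
- by apply: emeasurable_funD; exact: m1.
- by move=> x _; rewrite -!EFinM -EFinD lee_fin sqnD_le.
Qed.

Lemma N2D_le2 f g : cmeasurable f -> cmeasurable g ->
  (N2 (fun x => f x + g x)%R <= 2%:E * N2 f + 2%:E * N2 g)%E.
Proof. by move=> mf mg; have := N2D_le ltr01 mf mg; rewrite invr1. Qed.

(** For squared norms the triangle inequality costs a factor 2 on each term, so two errors of
    [eps / 4] combine into [eps]. This is the origin of the quarters in the approximation
    arguments. *)
Lemma N2_tri_eps (eps : R) f g h : cmeasurable f -> cmeasurable g -> cmeasurable h ->
  (N2 (fun x => f x - g x)%R <= (eps / 4)%:E)%E ->
  (N2 (fun x => g x - h x)%R <= (eps / 4)%:E)%E ->
  (N2 (fun x => f x - h x)%R <= eps%:E)%E.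
Proof.
move=> mf mg mh h1 h2; rewrite (@eq_N2 _ (fun x => (f x - g x) + (g x - h x))); last first.
  by move=> x; rewrite subrKA.
apply: (le_trans (N2D_le2 _ _)); [exact: cmeasurableB|exact: cmeasurableB|].
apply: (@le_trans _ _ (2%:E * (eps / 4)%:E + 2%:E * (eps / 4)%:E)%E).
  by apply: leeD; exact: lee_wpmul2l.
by rewrite -!EFinM -EFinD lee_fin; lra.
Qed.

Lemma N2_cauchy (u : nat -> T -> R[i]) f :
  (forall k, cmeasurable (u k)) -> cmeasurable f ->
  (forall eps : R, 0 < eps -> exists N : nat, forall k, (N <= k)%N ->
    (N2 (fun x => u k x - f x)%R <= eps%:E)%E) ->
  forall eps : R, 0 < eps -> exists N : nat, forall j k, (N <= j)%N -> (N <= k)%N ->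
    (N2 (fun x => u j x - u k x)%R <= eps%:E)%E.
Proof.
move=> mu_ mf H eps eps0; have [N NP] := H _ (divr_gt0 eps0 (ltr0Sn R 3)).
by exists N => j k Nj Nk; apply: (@N2_tri_eps _ _ f) => //; [|rewrite N2_sub]; exact: NP.
Qed.

(** The denominator [1 + sqn a] brings the scaled error of [f] below [eps / 4] and stays nonzero
    when [a = 0]. *)
Lemma N2_linear_small (a : R[i]) f g F G (eps : R) :
  cmeasurable f -> cmeasurable g -> cmeasurable F -> cmeasurable G -> 0 < eps ->
  (N2 (fun x => f x - F x)%R <= (eps / (4 * (1 + sqn a)))%:E)%E ->
  (N2 (fun x => g x - G x)%R <= (eps / 4)%:E)%E ->
  (N2 (fun x => a * f x + g x - (a * F x + G x))%R <= eps%:E)%E.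
Proof.
move=> mf mg mF mG eps0 h1 h2.
have a0 : 0 <= sqn a by exact: sqn_ge0.
rewrite (_ : (fun x => _) = fun x => a * (f x - F x) + (g x - G x)); last first.
  by apply/funext => x; ring.
apply: le_trans (N2D_le2 _ _) _; first by apply: cmeasurableM;
  [exact: cmeasurable_cst|exact: cmeasurableB].
  exact: cmeasurableB.
rewrite N2Z; last exact: cmeasurableB.
apply: (@le_trans _ _ (2%:E * ((sqn a)%:E * (eps / (4 * (1 + sqn a)))%:E) + 2%:E * (eps / 4)%:E)%E).
  apply: leeD; apply: lee_wpmul2l => //.
  by apply: lee_wpmul2l => //; rewrite lee_fin.
rewrite -!EFinM -EFinD lee_fin.
have -> : sqn a * (eps / (4 * (1 + sqn a))) = (eps / 4) * (sqn a / (1 + sqn a)).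
  by field; lra.
have : sqn a / (1 + sqn a) <= 1 by rewrite ler_pdivrMr; lra.
have : 0 <= sqn a / (1 + sqn a) by rewrite divr_ge0//; lra.
by nra.
Qed.

Lemma ae_N2 f g : cmeasurable f -> cmeasurable g -> f = g %[ae mu] -> N2 f = N2 g.
Proof.
move=> mf mg fg; apply: ge0_ae_eq_integral => //.
- exact: emeasurable_sqn.
- exact: emeasurable_sqn.
- by move=> x _; rewrite lee_fin sqn_ge0.
- by move=> x _; rewrite lee_fin sqn_ge0.
- by apply: filterS fg => x /[apply] ->.
Qed.

Lemma N2_eq0 f : cmeasurable f -> N2 f = 0%E -> f = (fun=> 0) %[ae mu].
Proof.
move=> mf f0.
have /ae_eq_integral_abs : measurable_fun setT (fun x => (sqn (f x))%:E).
  exact: emeasurable_sqn.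
move=> /(_ mu measurableT)[+ _].
under eq_integral => x _ do rewrite gee0_abs ?lee_fin ?sqn_ge0//.
move=> /(_ f0); apply: filterS => x /[apply] -[]; exact: sqn_eq0.
Qed.

Lemma N2B_eq0 f g : cmeasurable f -> cmeasurable g ->
  N2 (fun x => f x - g x) = 0%E <-> f = g %[ae mu].
Proof.
move=> mf mg; split => [/(N2_eq0 (cmeasurableB mf mg))|fg].
  by apply: filterS => x /[apply] /eqP; rewrite subr_eq0 => /eqP.
rewrite -N2_0; apply: ae_N2; [exact: cmeasurableB|exact: cmeasurable_cst|].
by apply: filterS fg => x /[apply] ->; rewrite subrr.
Qed.

Lemma ae_eq_N2_small f g : cmeasurable f -> cmeasurable g ->
  (forall eps : R, 0 < eps -> (N2 (fun x => f x - g x)%R <= eps%:E)%E) -> f = g %[ae mu].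
Proof.
move=> mf mg H; apply/N2B_eq0 => //; apply/eqP; rewrite eq_le N2_ge0 andbT.
by apply/lee_addgt0Pr => eps eps0; rewrite add0e; exact: H.
Qed.

Lemma L2_0 : L2 mu (fun=> 0).
Proof. by apply/L2P; split; [exact: cmeasurable_cst|rewrite N2_0 ltry]. Qed.

Lemma L2D f g : L2 mu f -> L2 mu g -> L2 mu (fun x => f x + g x).
Proof.
move=> Lf Lg; have [[mf _] [mg _]] := (Lf, Lg).
apply/L2P; split; first exact: cmeasurableD.
apply: (le_lt_trans (N2D_le2 mf mg)).
by rewrite lte_add_pinfty// lte_mul_pinfty// -?ge0_fin_numE ?N2_ge0// L2_fin.
Qed.

Lemma L2Z (c : R[i]) f : L2 mu f -> L2 mu (fun x => c * f x).
Proof.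
move=> Lf; have [mf _] := Lf; apply/L2P; split.
  exact: (cmeasurableM (cmeasurable_cst c)).
rewrite N2Z// lte_mul_pinfty ?lee_fin ?sqn_ge0//.
by rewrite -ge0_fin_numE ?N2_ge0// L2_fin.
Qed.

Lemma L2N f : L2 mu f -> L2 mu (fun x => - f x).
Proof.
move=> [mf Nf]; apply/L2P; split; first exact: cmeasurableN.
by rewrite N2N; have /L2P[] : L2 mu f by [].
Qed.

Lemma L2B f g : L2 mu f -> L2 mu g -> L2 mu (fun x => f x - g x).
Proof. by move=> Lf Lg; exact: (L2D Lf (L2N Lg)). Qed.

Lemma L2_le f g : cmeasurable f -> L2 mu g ->
  (forall x, sqn (f x) <= sqn (g x)) -> L2 mu f.
Proof.
move=> mf Lg fg; apply/L2P; split => //.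
apply: (@le_lt_trans _ _ (N2 g)); first by apply: N2_le => //; case: Lg.
by have /L2P[] := Lg.
Qed.

Lemma L2_ae f g : cmeasurable f -> L2 mu g -> f = g %[ae mu] -> L2 mu f.
Proof.
move=> mf Lg fg; apply/L2P; split=> //; rewrite (ae_N2 mf _ fg).
  by have /L2P[] := Lg.
by case: Lg.
Qed.

Lemma L2_sum (I : Type) (s : seq I) (F : I -> T -> R[i]) :
  (forall i, L2 mu (F i)) -> L2 mu (fun x => \sum_(i <- s) F i x).
Proof.
move=> LF; elim: s => [|i s ih].
  by under eq_fun do rewrite big_nil; exact: L2_0.
by under eq_fun do rewrite big_cons; exact: L2D.
Qed.

Lemma L2_lincomb (J : choiceType) (F : {fset J}) c (e : J -> T -> R[i]) :
  (forall j, L2 mu (e j)) -> L2 mu (lincomb F c e).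
Proof.
by move=> Le; apply: (@L2_sum _ _ (fun j x => c j * e j x)) => j; exact: L2Z.
Qed.

Definition N2r f : R := fine (N2 f).

Lemma N2rE f : L2 mu f -> N2 f = (N2r f)%:E.
Proof. by move=> Lf; rewrite /N2r fineK// L2_fin. Qed.

Lemma N2r_ge0 f : 0 <= N2r f.
Proof. by rewrite fine_ge0// N2_ge0. Qed.

End N2.

Section ccvg.
Context {R : realType}.
Implicit Types (u : nat -> R[i]) (l : R[i]).

Definition ccvg u l :=
  (complex.Re (u k) @[k --> \oo] --> complex.Re l) /\
  (complex.Im (u k) @[k --> \oo] --> complex.Im l).

Lemma ccvg_sqn u l : ccvg u l -> sqn (u k) @[k --> \oo] --> sqn l.
Proof. by move=> [u1 u2]; rewrite /sqn; apply: cvgD; exact: cvgM. Qed.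

Lemma ccvgB u v l m : ccvg u l -> ccvg v m -> ccvg (fun k => u k - v k) (l - m).
Proof.
move=> [u1 u2] [v1 v2]; split.
  by rewrite raddfB /=; under eq_fun do rewrite raddfB /=; exact: cvgB.
by rewrite raddfB /=; under eq_fun do rewrite raddfB /=; exact: cvgB.
Qed.

Lemma ccvg_cst l : ccvg (fun=> l) l.
Proof. by split; exact: cvg_cst. Qed.

Lemma ccvgM u v l m : ccvg u l -> ccvg v m -> ccvg (fun k => u k * v k) (l * m).
Proof.
have E (z w : R[i]) : z * w =
   (complex.Re z * complex.Re w - complex.Im z * complex.Im w) +i*
   (complex.Re z * complex.Im w + complex.Im z * complex.Re w).
  by case: z w => ? ? [? ?].
move=> [u1 u2] [v1 v2]; split; rewrite E; under eq_fun do rewrite E /=.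
  by apply: cvgB; exact: cvgM.
by apply: cvgD; exact: cvgM.
Qed.

Lemma cvg_geometric_increments (u : nat -> R) (C : R) :
  (forall k, `|u k.+1 - u k| <= C * (2^-1) ^+ k) -> cvgn u.
Proof.
move=> uC.
have C0 : 0 <= C by have := uC 0%N; rewrite expr0 mulr1; apply: le_trans.
have : cvgn (series (telescope u)).
  apply: normed_cvg; apply: (@series_le_cvg _ _ (geometric C 2^-1)).
  - by move=> k /=.
  - by move=> k; rewrite /geometric mulr_ge0// exprn_ge0// invr_ge0.
  - by move=> k /=; exact: uC.
  - by apply: is_cvg_geometric_series; rewrite ger0_norm ?invr_ge0// invf_lt1// ltr1n.
move=> /(is_cvgD (is_cvg_cst (u 0%N))).
rewrite (_ : _ + _ = u)//; apply/funext => n.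
by rewrite [RHS]eq_sum_telescope.
Qed.

End ccvg.

(** * Completeness of L^2 *)

Section completeness.
Context {d} {T : measurableType d} {R : realType}.
Variable mu : {measure set T -> \bar R}.
Implicit Types f g : T -> R[i].

(** Fatou's lemma in the form used for every limit below: the lower limit ignores the indices before
    [K], so the bound is asked from [K] on. *)
Lemma N2_fatou (g_ : nat -> T -> R[i]) g (c : \bar R) (K : nat) :
  (forall k, cmeasurable (g_ k)) -> cmeasurable g ->
  (\forall x \ae mu, ccvg (g_ ^~ x) (g x)) ->
  (forall k, (K <= k)%N -> (N2 mu (g_ k) <= c)%E) -> (N2 mu g <= c)%E.
Proof.
move=> mg_ mg cvg Nc.
have F := @fatou _ _ _ mu _ measurableT (fun k x => (sqn (g_ k x))%:E)
  (fun k => emeasurable_sqn (mg_ k)) (fun k x _ => sqn_ge0 (g_ k x)).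
apply: (@le_trans _ _ (limn_einf (fun k => N2 mu (g_ k)))); last first.
  rewrite limn_einf_lim; have /cvg_lim -> // := @cvg_einfs_sup _ (fun k => N2 mu (g_ k)).
  apply: ge_ereal_sup => _ [n _ <-]; apply: le_trans (Nc (maxn n K) (leq_maxr _ _)).
  by apply: ereal_inf_lbound; exists (maxn n K) => //=; exact: leq_maxl.
apply: le_trans F; apply: ae_ge0_le_integral => //.
- by move=> x _; rewrite lee_fin sqn_ge0.
- exact: emeasurable_sqn.
- move=> x _; rewrite limn_einf_lim; apply: lime_ge; first exact: is_cvg_einfs.
  apply: nearW => n; apply: le_ereal_inf_tmp => _ [k _ <-].
  by rewrite lee_fin sqn_ge0.
- rewrite (_ : (fun _ => _) = (fun x => limn (einfs (fun k => (sqn (g_ k x))%:E)))).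
    apply: (@emeasurable_fun_cvg _ _ _ _ (fun n x => einfs (fun k => (sqn (g_ k x))%:E) n)).
      by move=> n; apply: measurable_fun_einfs => k; exact: emeasurable_sqn.
    by move=> x _; exact: is_cvg_einfs.
  by apply/funext => x; rewrite limn_einf_lim.
- apply: filterS cvg => x cx _.
  have /cvg_limn_einf_sup[-> _] // : (sqn (g_ k x))%:E @[k --> \oo] --> (sqn (g x))%:E.
  by apply: cvg_EFin; [exact: nearW|exact: ccvg_sqn cx].
Qed.

(** The Riesz-Fischer theorem. The almost everywhere convergent subsequence is part of the
    conclusion because [closed_span_ae_approx] needs pointwise limits. *)
Lemma L2_complete (f_ : nat -> T -> R[i]) :
  (forall j, L2 mu (f_ j)) ->
  (forall eps : R, 0 < eps -> exists N, forall j k, (N <= j)%N -> (N <= k)%N ->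
    (N2 mu (fun x => f_ j x - f_ k x)%R <= eps%:E)%E) ->
  exists f, [/\ L2 mu f,
    forall eps : R, 0 < eps -> exists N, forall j, (N <= j)%N ->
      (N2 mu (fun x => f_ j x - f x)%R <= eps%:E)%E
    & exists s : nat -> nat, (forall k, (k <= s k)%N) /\
       \forall x \ae mu, ccvg (fun k => f_ (s k) x) (f x)].
Proof.
move=> Lf fC.
have mf j : cmeasurable (f_ j) by case: (Lf j).
(* Squared increments below 16^-k leave room for the weights 4^k: the weighted sum [h] has integral
   at most the sum of the 4^-k, and wherever [h] is finite the increments are of order 2^-k, hence
   summable. *)
have e0 k : 0 < (16^-1) ^+ k :> R by rewrite exprn_gt0// invr_gt0.
have [N NP] := choice (fun k => fC _ (e0 k)).
pose s := fix s k := if k is k'.+1 then maxn (s k').+1 (N k) else N 0%N.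
have sN k : (N k <= s k)%N by case: k => //= k; exact: leq_maxr.
have sS k : (s k < s k.+1)%N by rewrite /= leq_maxl.
have sk k : (k <= s k)%N by elim: k => // k ih; exact: leq_ltn_trans (sS k).
pose D k x := f_ (s k.+1) x - f_ (s k) x.
have mD k : cmeasurable (D k) by exact: cmeasurableB.
have ND k : (N2 mu (D k) <= ((16^-1) ^+ k)%:E)%E.
  by apply: NP; [exact: leq_trans (ltnW (sS k))|].
pose h x : \bar R := (\sum_(0 <= k <oo) ((4 ^+ k) * sqn (D k x))%:E)%E.
have h0 k x : (0 <= (4 ^+ k * sqn (D k x))%:E)%E.
  by rewrite lee_fin mulr_ge0 ?sqn_ge0 ?exprn_ge0.
have mh k : measurable_fun setT (fun x => (4 ^+ k * sqn (D k x))%:E).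
  apply/measurable_EFinP; apply: measurable_funM => //; exact: measurable_sqn.
have hint : (\int[mu]_x h x < +oo)%E.
  rewrite integral_nneseries//.
  have g1 : `|4^-1 : R| < 1 by rewrite ger0_norm ?invr_ge0// invf_lt1// ltr1n.
  apply: (@le_lt_trans _ _ (\sum_(0 <= k <oo) ((4^-1) ^+ k)%:E)%E).
    apply: lee_nneseries => [k _ _|k _]; first exact: integral_ge0.
    rewrite (_ : \int[mu]_x _ = (4 ^+ k)%:E * N2 mu (D k))%E; last first.
      rewrite -ge0_integralZl//; first exact: emeasurable_sqn.
      by move=> x _; rewrite lee_fin sqn_ge0.
    apply: (@le_trans _ _ ((4 ^+ k)%:E * ((16^-1) ^+ k)%:E)%E).
      by apply: lee_wpmul2l => //; rewrite lee_fin exprn_ge0.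
    rewrite -EFinM lee_fin -exprMn (_ : 4 * 16^-1 = 4^-1 :> R)//.
    by field.
  have := @cvg_geometric_series R 1 4^-1 g1.
  move=> gc.
  have /cvg_lim H : EFin \o series (geometric 1 4^-1) @ \oo --> (1 / (1 - 4^-1) : R)%:E.
    by apply: cvg_EFin; [exact: nearW|exact: gc].
  rewrite (_ : (fun _ => _) = EFin \o series (geometric 1 4^-1)); last first.
    apply/funext => n /=; rewrite /series /= sumEFin; congr EFin.
    by apply: eq_bigr => i _; rewrite mul1r.
  by rewrite H// ltry.
have mhT : measurable_fun setT h by apply: ge0_emeasurable_sum => // *.
pose E := [set x | (h x < +oo)%E].
have mE : measurable E.
  by rewrite -[E]setTI; exact: emeasurable_fun_infty_o.
have aeE : \forall x \ae mu, E x.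
  have hi : mu.-integrable setT h.
    apply/integrableP; split => //; apply: le_lt_trans hint.
    under eq_integral => x _ do rewrite gee0_abs ?nneseries_ge0//.
    exact: lexx.
  have := integrable_ae measurableT hi.
  apply: filterS => x /(_ I) hx; rewrite /E /=.
  by rewrite -ge0_fin_numE// nneseries_ge0.
have cvgE x : E x -> exists l : R[i], ccvg (fun k => f_ (s k) x) l.
  move=> Ex.
  have hf : h x \is a fin_num by rewrite ge0_fin_numE// nneseries_ge0.
  pose C := fine (h x).
  have C0 : 0 <= C by rewrite fine_ge0// nneseries_ge0.
  (* The factor [1 + C] stands for the square root of [C], since C <= (1 + C)^2. *)
  have DC k : sqn (D k x) <= ((1 + C) * 2^-1 ^+ k) ^+ 2.
    have : ((4 ^+ k * sqn (D k x))%:E <= h x)%E.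
      rewrite /h (@nneseriesD1 _ _ k)//= ?leeDl//.
      by apply: nneseries_ge0 => *.
    rewrite -(fineK hf) lee_fin -/C => DC.
    have k4 : 0 < 4 ^+ k :> R by rewrite exprn_gt0.
    rewrite exprMn -exprM mulnC exprM (_ : 2^-1 ^+ 2 = 4^-1 :> R); last by field.
    rewrite exprVn ler_pdivlMr// mulrC; apply: (le_trans DC).
    by have := sqr_ge0 C; rewrite -/C; nra.
  have C2 k : 0 <= (1 + C) * 2^-1 ^+ k.
    by rewrite mulr_ge0 ?addr_ge0// exprn_ge0// invr_ge0.
  have c1 : cvgn (fun k => complex.Re (f_ (s k) x)).
    apply: (@cvg_geometric_increments _ _ (1 + C)) => k.
    rewrite -raddfB -[leRHS]ger0_norm// -ler_sqr ?nnegrE// !real_normK ?num_real//.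
    exact: le_trans (sqr_Re_le _) (DC k).
  have c2 : cvgn (fun k => complex.Im (f_ (s k) x)).
    apply: (@cvg_geometric_increments _ _ (1 + C)) => k.
    rewrite -raddfB -[leRHS]ger0_norm// -ler_sqr ?nnegrE// !real_normK ?num_real//.
    exact: le_trans (sqr_Im_le _) (DC k).
  by exists (limn (fun k => complex.Re (f_ (s k) x)) +i* limn (fun k => complex.Im (f_ (s k) x))).
(* Multiplying by the indicator of [E] makes the sequence converge at every point, to 0 off [E], so
   that the limit is measurable as an everywhere limit. *)
have /choice[f fP] : forall x, exists l : R[i],
    ccvg (fun k => f_ (s k) x * (\1_E x)%:C) l.
  move=> x; have [Ex|nEx] := pselect (E x).
    have [l cl] := cvgE _ Ex; exists l; rewrite indicE mem_set//.
    by under eq_fun do rewrite mulr1.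
  exists 0; rewrite indicE memNset//.
  under eq_fun do rewrite mulr0; exact: ccvg_cst.
have mfE k : cmeasurable (fun x => f_ (s k) x * (\1_E x)%:C).
  by apply: cmeasurableM => //; apply: cmeasurable_real; exact: measurable_indic.
have mff : cmeasurable f.
  split.
    apply: (@measurable_fun_cvg _ _ _ _ (fun k x => complex.Re (f_ (s k) x * (\1_E x)%:C))).
      by move=> k; case: (mfE k).
    by move=> x _; case: (fP x).
  apply: (@measurable_fun_cvg _ _ _ _ (fun k x => complex.Im (f_ (s k) x * (\1_E x)%:C))).
    by move=> k; case: (mfE k).
  by move=> x _; case: (fP x).
have aef : \forall x \ae mu, ccvg (fun k => f_ (s k) x) (f x).
  apply: filterS aeE => x Ex; have := fP x; rewrite indicE mem_set//.
  by under eq_fun do rewrite mulr1.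
(* For fixed [j], the Cauchy bound on [f_ j - f_ (s k)] passes to the limit in [k] by Fatou. *)
have fN eps : 0 < eps -> exists N, forall j, (N <= j)%N ->
    (N2 mu (fun x => f_ j x - f x)%R <= eps%:E)%E.
  move=> eps0; have [M MP] := fC _ eps0; exists M => j Mj.
  apply: (@N2_fatou (fun k x => f_ j x - f_ (s k) x) _ _ M).
  - by move=> k; exact: cmeasurableB.
  - exact: cmeasurableB.
  - by apply: filterS aef => x cx; apply: ccvgB => //; exact: ccvg_cst.
  - by move=> k Mk; apply: MP => //; exact: leq_trans (sk k).
exists f; split => //; last by exists s.
have [M MP] := fN _ ltr01; apply/L2P; split => //.
rewrite (@eq_N2 _ _ _ _ _ (fun x => f_ M x - (f_ M x - f x))); last first.
  by move=> x; rewrite opprB addrC subrK.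
have /L2P[] : L2 mu (fun x => f_ M x - (f_ M x - f x)); last by [].
apply: L2B => //; apply/L2P; split; first exact: cmeasurableB.
by apply: (le_lt_trans (MP M (leqnn M))); exact: ltry.
Qed.

End completeness.

(** * Complex integrals, inner products and orthonormal families *)

Section cintegral.
Context {d} {T : measurableType d} {R : realType}.
Variable mu : {measure set T -> \bar R}.
Implicit Types f g : T -> R[i].

Definition cintegrable f :=
  mu.-integrable setT (fun x => (complex.Re (f x))%:E) /\
  mu.-integrable setT (fun x => (complex.Im (f x))%:E).

Lemma cintegrableD f g : cintegrable f -> cintegrable g ->
  cintegrable (fun x => f x + g x).
Proof.
move=> [f1 f2] [g1 g2]; split.
  by under eq_fun do rewrite raddfD /= EFinD; exact: integrableD.
by under eq_fun do rewrite raddfD /= EFinD; exact: integrableD.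
Qed.

Lemma cReM (z w : R[i]) : complex.Re (z * w) =
  complex.Re z * complex.Re w - complex.Im z * complex.Im w.
Proof. by case: z w => ? ? [? ?]. Qed.

Lemma cImM (z w : R[i]) : complex.Im (z * w) =
  complex.Re z * complex.Im w + complex.Im z * complex.Re w.
Proof. by case: z w => ? ? [? ?]. Qed.

Lemma cintegrableZ (c : R[i]) f : cintegrable f -> cintegrable (fun x => c * f x).
Proof.
move=> [f1 f2]; split.
  under eq_fun do rewrite cReM EFinB !EFinM.
  by apply: integrableB => //; exact: integrableZl.
under eq_fun do rewrite cImM EFinD !EFinM.
by apply: integrableD => //; exact: integrableZl.
Qed.

Lemma cintegrable_sum (I : Type) (s : seq I) (F : I -> T -> R[i]) :
  (forall i, cintegrable (F i)) -> cintegrable (fun x => \sum_(i <- s) F i x).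
Proof.
move=> iF; elim: s => [|i s ih].
  under eq_fun do rewrite big_nil; split => /=; exact: integrable0.
by under eq_fun do rewrite big_cons; exact: cintegrableD.
Qed.

Lemma cintegralD f g : cintegrable f -> cintegrable g ->
  cintegral mu (fun x => f x + g x) = cintegral mu f + cintegral mu g.
Proof.
move=> [f1 f2] [g1 g2]; rewrite /cintegral /=.
under eq_Rintegral do rewrite raddfD /=.
under [X in _ +i* X]eq_Rintegral do rewrite raddfD /=.
by rewrite !RintegralD.
Qed.

Lemma cintegralZ (c : R[i]) f : cintegrable f ->
  cintegral mu (fun x => c * f x) = c * cintegral mu f.
Proof.
move=> [f1 f2]; rewrite /cintegral /=.
under eq_Rintegral do rewrite cReM /=.
under [X in _ +i* X]eq_Rintegral do rewrite cImM /=.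
have i1 k : mu.-integrable setT (EFin \o (fun x => k * complex.Re (f x))).
  by rewrite (_ : _ \o _ = fun x => (k%:E * (complex.Re (f x))%:E)%E)//; exact: integrableZl.
have i2 k : mu.-integrable setT (EFin \o (fun x => k * complex.Im (f x))).
  by rewrite (_ : _ \o _ = fun x => (k%:E * (complex.Im (f x))%:E)%E)//; exact: integrableZl.
rewrite RintegralB// RintegralD// !RintegralZl//.
by case: c.
Qed.

Lemma cintegral_sum (I : Type) (s : seq I) (F : I -> T -> R[i]) :
  (forall i, cintegrable (F i)) ->
  cintegral mu (fun x => \sum_(i <- s) F i x) = \sum_(i <- s) cintegral mu (F i).
Proof.
move=> iF; elim: s => [|i s ih].
  rewrite big_nil /cintegral; under eq_Rintegral do rewrite big_nil /=.
  under [X in _ +i* X]eq_Rintegral do rewrite big_nil /=.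
  by rewrite /Rintegral integral0.
rewrite big_cons -ih -cintegralD//; last exact: cintegrable_sum.
by congr cintegral; apply/funext => x; rewrite big_cons.
Qed.

(** Valid for every [f]: negation exchanges the positive and negative parts, and [fine] sends both
    infinities to 0, so the identity also holds when these parts have infinite integrals. *)
Lemma cintegral_conj f : cintegral mu (fun x => (f x)^*) = (cintegral mu f)^*.
Proof.
rewrite /cintegral /=; congr (_ +i* _).
  by apply: eq_Rintegral => x _; case: (f x).
rewrite /Rintegral (_ : (fun x => _) = (fun x => - (complex.Im (f x))%:E)%E).
  rewrite integralE [in RHS]integralE (funeposN (fun x => (complex.Im (f x))%:E)).
  rewrite (funenegN (fun x => (complex.Im (f x))%:E)).
  by case: (integral _ _ _) (integral _ _ _) => [a| |] [b| |] //=;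
    rewrite ?opprB// ?oppr0.
by apply/funext => x; case: (f x).
Qed.

Lemma eq_cintegral f g : f =1 g -> cintegral mu f = cintegral mu g.
Proof. by move=> /funext ->. Qed.

Lemma cintegrable_cmeasurable f : cintegrable f -> cmeasurable f.
Proof. by move=> [/measurable_int/measurable_EFinP m1 /measurable_int/measurable_EFinP m2]. Qed.

Lemma cintegrable_bounded f (h : T -> R) : cmeasurable f ->
  mu.-integrable setT (fun x => (h x)%:E) -> (forall x, sqn (f x) <= h x ^+ 2) ->
  cintegrable f.
Proof.
move=> [m1 m2] ih fh.
have le x (u : R) : u ^+ 2 <= sqn (f x) -> `|u| <= `|h x|.
  move=> us; rewrite -ler_sqr ?nnegrE// !real_normK ?num_real//; exact: le_trans (fh x).
split; apply: (le_integrable measurableT _ _ ih); try exact/measurable_EFinP;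
  move=> x _ /=; rewrite lee_fin; apply: le; [exact: sqr_Re_le|exact: sqr_Im_le].
Qed.

Lemma measurable_modulus f :
  cmeasurable f -> measurable_fun setT (fun x => modulus (f x)).
Proof.
move=> mf; rewrite (_ : (fun x => _) = Num.sqrt \o (fun x => sqn (f x))).
  apply: measurableT_comp; last exact: measurable_sqn.
  exact: (continuous_measurable_fun (@sqrt_continuous R)).
by apply/funext => x; rewrite modulusE.
Qed.

Lemma sqr_modulus (z : R[i]) : modulus z ^+ 2 = sqn z.
Proof. by rewrite modulusE sqr_sqrtr ?sqn_ge0. Qed.

Lemma modulus_ge0 (z : R[i]) : 0 <= modulus z.
Proof. by rewrite modulusE sqrtr_ge0. Qed.

Lemma integrable_modulus f : cintegrable f -> mu.-integrable setT (fun x => (modulus (f x))%:E).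
Proof.
move=> cf; have [i1 i2] := cf; have mf := cintegrable_cmeasurable cf.
have i3 : mu.-integrable setT
    (fun x => (`|(complex.Re (f x))%:E| + `|(complex.Im (f x))%:E|)%E).
  by apply: integrableD => //; exact: integrable_abse.
apply: (le_integrable measurableT _ _ i3); first exact/measurable_EFinP/measurable_modulus.
move=> x _ /=; rewrite lee_fin -ler_sqr ?nnegrE// !real_normK ?num_real// sqr_modulus.
rewrite sqrrD !real_normK ?num_real// /sqn.
have : 0 <= `|complex.Re (f x)| * `|complex.Im (f x)| by exact: mulr_ge0.
by lra.
Qed.

Lemma Lp1_cintegrable f : Lp mu 1%:E f <-> cintegrable f.
Proof.
have N1 : cnorm mu 1%:E f = (\int[mu]_x `|(modulus (f x))%:E|)%E by rewrite /cnorm Lnorm1.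
split=> [[mf]|cf].
  rewrite N1 => Nf; apply: (@cintegrable_bounded _ (fun x => modulus (f x))) => //.
    by apply/integrableP; split=> //; exact/measurable_EFinP/measurable_modulus.
  by move=> x; rewrite sqr_modulus.
split; first exact: cintegrable_cmeasurable.
by rewrite N1; have /integrableP[] := integrable_modulus cf.
Qed.

Lemma cintegrable_mul_le1 f g : cintegrable f -> cmeasurable g -> (forall x, sqn (g x) <= 1) ->
  cintegrable (fun x => f x * g x).
Proof.
move=> cf mg g1; apply: (cintegrable_bounded _ (integrable_modulus cf)).
  by apply: cmeasurableM => //; exact: cintegrable_cmeasurable.
by move=> x; rewrite sqnM sqr_modulus ler_piMr// sqn_ge0.
Qed.

Lemma integrable_sqn f : L2 mu f -> mu.-integrable setT (fun x => (sqn (f x))%:E).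
Proof.
move=> /L2P[mf Nf]; apply/integrableP; split; first exact: emeasurable_sqn.
by under eq_integral => x _ do rewrite gee0_abs ?lee_fin ?sqn_ge0//.
Qed.

Lemma L2_cintegrable f g : L2 mu f -> L2 mu g -> cintegrable (fun x => f x * (g x)^*).
Proof.
move=> Lf Lg; have [[mf _] [mg _]] := (Lf, Lg).
apply: (@cintegrable_bounded _ (fun x => sqn (f x) + sqn (g x))).
- by apply: cmeasurableM => //; exact: cmeasurable_conj.
- under eq_fun do rewrite EFinD; by apply: integrableD => //; exact: integrable_sqn.
- by move=> x; rewrite sqnM sqn_conj; have := sqn_ge0 (f x); have := sqn_ge0 (g x); nra.
Qed.

(** On a set of finite measure L^2 is contained in L^1: |f| <= |f|^2 + 1 there, because s <= (s +
    1)^2 for s = |f|^2. *)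
Lemma L2_supp_cintegrable f (B : set T) : measurable B -> (mu B < +oo)%E -> L2 mu f ->
  (forall x, ~ B x -> f x = 0) -> cintegrable f.
Proof.
move=> mB muB Lf fB; have [mf _] := Lf.
apply: (@cintegrable_bounded _ (fun x => sqn (f x) + \1_B x)) => //.
  under eq_fun do rewrite EFinD; apply: integrableD => //; first exact: integrable_sqn.
  apply/integrableP; split; first exact/measurable_EFinP/measurable_indic.
  under eq_integral do rewrite gee0_abs ?lee_fin//.
  by rewrite integral_indic// setIT.
move=> x; have := sqn_ge0 (f x); rewrite indicE; have [xB|xB] := boolP (x \in B).
  by rewrite /=; nra.
by rewrite fB ?sqn0 ?sqr_ge0//; move: xB; rewrite notin_setE.
Qed.

End cintegral.

Section inner.
Context {d} {T : measurableType d} {R : realType}.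
Variable mu : {measure set T -> \bar R}.
Implicit Types f g h : T -> R[i].

Lemma innerZl (a : R[i]) f h : L2 mu f -> L2 mu h ->
  inner mu (fun x => a * f x) h = a * inner mu f h.
Proof.
move=> Lf Lh; rewrite /inner -cintegralZ; last exact: L2_cintegrable.
by apply: eq_cintegral => x; rewrite mulrA.
Qed.

Lemma inner_conj f g : inner mu g f = (inner mu f g)^*.
Proof.
rewrite /inner -cintegral_conj; apply: eq_cintegral => x.
by rewrite rmorphM /= conjcK mulrC.
Qed.

Lemma Re_innerZr (a : R[i]) f g : L2 mu f -> L2 mu g ->
  complex.Re (inner mu f (fun x => a * g x)) = complex.Re (conjc a * inner mu f g).
Proof.
move=> Lf Lg; rewrite inner_conj innerZl// (inner_conj f g).
by case: a (inner mu f g) => [? ?] [? ?] /=; ring.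
Qed.

Lemma inner_suml (I : Type) (s : seq I) (F : I -> T -> R[i]) h :
  (forall i, L2 mu (F i)) -> L2 mu h ->
  inner mu (fun x => \sum_(i <- s) F i x) h = \sum_(i <- s) inner mu (F i) h.
Proof.
move=> LF Lh; rewrite /inner -cintegral_sum; last by move=> i; exact: L2_cintegrable.
by apply: eq_cintegral => x; rewrite mulr_suml.
Qed.

Lemma innerff f : inner mu f f = (N2r mu f)%:C.
Proof.
rewrite /inner /cintegral /N2r /N2 /Rintegral.
under eq_integral do rewrite mulc_conj /=.
by under [X in _ +i* fine X]eq_integral do rewrite mulc_conj /=; rewrite integral0.
Qed.

Lemma N2rD f g : L2 mu f -> L2 mu g ->
  N2r mu (fun x => f x + g x) = N2r mu f + N2r mu g + 2 * complex.Re (inner mu f g).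
Proof.
move=> Lf Lg; have [i1 _] := L2_cintegrable Lf Lg.
apply/EFin_inj; rewrite -N2rE; last exact: L2D.
have i2 := integrable_sqn Lf; have i3 := integrable_sqn Lg.
rewrite /N2; under eq_integral => x _ do
  rewrite sqnD (EFinD (_ + _)) (EFinD (sqn _)) EFinM.
rewrite integralD//; last 2 first.
- exact: integrableD.
- exact: integrableZl.
rewrite integralD// integralZl// -[X in (X + _ + _)%E]/(N2 mu f).
rewrite -[X in (_ + X + _)%E]/(N2 mu g) !N2rE// /inner /= /Rintegral.
rewrite (EFinD (_ + _)) (EFinD (N2r mu f)) EFinM (fineK (integrable_fin_num measurableT i1)).
by [].
Qed.

End inner.

(** Polarization between two measure spaces. The coefficients [(1, b)] determine the real part of
    the inner product times [b], after a conjugation, and the values 1 and -i of [b] separate its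
    real and imaginary parts. *)
Lemma inner_polar {d d'} {T : measurableType d} {T' : measurableType d'} {R : realType}
    (mu : {measure set T -> \bar R}) (mu' : {measure set T' -> \bar R})
    (f g : T -> R[i]) (F G : T' -> R[i]) :
  L2 mu f -> L2 mu g -> L2 mu' F -> L2 mu' G ->
  (forall a b : R[i], N2 mu (fun x => a * f x + b * g x) =
                      N2 mu' (fun x => a * F x + b * G x)) ->
  inner mu f g = inner mu' F G.
Proof.
move=> Lf Lg LF LG H.
have H' (a b : R[i]) : N2r mu (fun x => a * f x + b * g x) =
   N2r mu' (fun x => a * F x + b * G x) by rewrite /N2r H.
have E1 : N2r mu f = N2r mu' F.
  have := H' 1 0; congr (_ = _); congr N2r; apply/funext => x;
  by rewrite mul1r mul0r addr0.
have E2 b : N2r mu (fun x => b * g x) = N2r mu' (fun x => b * G x).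
  have := H' 0 b; congr (_ = _); congr N2r; apply/funext => x;
  by rewrite mul0r add0r.
have E3 b : N2r mu (fun x => f x + b * g x) = N2r mu' (fun x => F x + b * G x).
  have := H' 1 b; congr (_ = _); congr N2r; apply/funext => x;
  by rewrite mul1r.
have E4 b : complex.Re (inner mu f (fun x => b * g x)) =
            complex.Re (inner mu' F (fun x => b * G x)).
  have := E3 b; rewrite (N2rD Lf (L2Z _ Lg)) (N2rD LF (L2Z _ LG)).
  by rewrite E1 E2; lra.
have E5 (b : R[i]) : complex.Re (b * inner mu f g) = complex.Re (b * inner mu' F G).
  by have := E4 (conjc b); rewrite !Re_innerZr// conjcK.
move: (E5 1) (E5 (- 'i)).
move: (inner mu f g) (inner mu' F G) => [? ?] [? ?] /= h1 h2.
by congr (_ +i* _); lra.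
Qed.

Section orthonormal.
Context {d} {T : measurableType d} {R : realType}.
Variable mu : {measure set T -> \bar R}.
Implicit Types f g h : T -> R[i].
Context {J : choiceType}.
Variable e : J -> T -> R[i].
Hypothesis Le : forall j, L2 mu (e j).
Hypothesis eO : forall i j, inner mu (e i) (e j) = (i == j)%:R.

Let LS s (c : J -> R[i]) : L2 mu (fun x => \sum_(j <- s) c j * e j x).
Proof. by apply: (@L2_sum _ _ _ _ _ _ (fun j x => c j * e j x)) => j; exact: L2Z. Qed.

Lemma inner_sum_orthonormal (s : seq J) (c : J -> R[i]) f : L2 mu f ->
  inner mu (fun x => \sum_(j <- s) c j * e j x) f =
  \sum_(j <- s) c j * (inner mu f (e j))^*.
Proof.
move=> Lf; rewrite (@inner_suml _ _ _ _ _ _ (fun j x => c j * e j x))//; last first.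
  by move=> j; exact: L2Z.
by apply: eq_bigr => j _; rewrite innerZl// inner_conj.
Qed.

Lemma N2r_sum_orthonormal (s : seq J) (c : J -> R[i]) : uniq s ->
  N2r mu (fun x => \sum_(j <- s) c j * e j x) = \sum_(j <- s) sqn (c j).
Proof.
elim: s => [|i s ih] /=.
  by move=> _; rewrite big_nil /N2r; under eq_fun do rewrite big_nil; rewrite N2_0.
case/andP => iNs us; under eq_fun do rewrite big_cons.
rewrite N2rD//; last exact: L2Z.
rewrite ih// big_cons {1}/N2r N2Z; last by case: (Le i).
have Ni : N2r mu (e i) = 1.
  by have := eO i i; rewrite innerff eqxx => -[].
rewrite N2rE// Ni mule1 inner_conj inner_sum_orthonormal; last exact: L2Z.
rewrite Re_conj [X in complex.Re X](_ : _ = 0) ?mulr0 ?addr0//.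
rewrite big_seq big1// => j js.
rewrite innerZl// eO; case: eqVneq js => [<- iS|_ _]; first by rewrite iS in iNs.
by rewrite mulr0 rmorph0 mulr0.
Qed.

(** Completion of the square. When [c] consists of the Fourier coefficients the last sum vanishes
    and Bessel's inequality follows; for any other [c] its nonnegativity says that no combination
    approximates better, which is the other half of Parseval's identity. *)
Lemma N2r_sub_orthonormal (s : seq J) (c : J -> R[i]) f : uniq s -> L2 mu f ->
  N2r mu (fun x => f x - \sum_(j <- s) c j * e j x) =
  N2r mu f - \sum_(j <- s) sqn (inner mu f (e j)) +
  \sum_(j <- s) sqn (inner mu f (e j) - c j).
Proof.
move=> us Lf; rewrite N2rD//; last exact/L2N/LS.
have -> : N2r mu (fun x => - \sum_(j <- s) c j * e j x) = \sum_(j <- s) sqn (c j).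
  by rewrite /N2r N2N -/(N2r _ _) N2r_sum_orthonormal.
have -> : inner mu f (fun x => - \sum_(j <- s) c j * e j x) =
    - (\sum_(j <- s) c j * (inner mu f (e j))^*)^*.
  rewrite inner_conj (_ : (fun _ => _) = fun x => (-1) * \sum_(j <- s) c j * e j x).
    by rewrite innerZl// inner_sum_orthonormal// mulN1r rmorphN.
  by apply/funext => x; rewrite mulN1r.
rewrite -!addrA; congr (_ + _); rewrite raddfN /= mulrN rmorph_sum raddf_sum.
rewrite mulr_sumr -!sumrN -!big_split; apply: eq_bigr => j _ /=.
rewrite sqnD sqnN Re_conj rmorphN /= mulrN raddfN /= [in RHS]Re_mul_conjC.
by ring.
Qed.

Lemma N2_lincomb (F : {fset J}) c :
  N2 mu (lincomb F c e) = (\sum_(j <- F) sqn (c j))%:E.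
Proof. by rewrite N2rE; [rewrite N2r_sum_orthonormal|exact: LS]. Qed.

End orthonormal.

(** * Sums over index sets, closed spans and Parseval's identity *)

Section esum.
Context {R : realType} {J : choiceType}.
Implicit Types a : J -> \bar R.

Lemma fset_le_esum (F : {fset J}) a : (forall j, 0 <= a j)%E ->
  (\sum_(j <- F) a j <= \esum_(j in setT) a j)%E.
Proof.
move=> a0; apply: ereal_sup_ubound; exists [set` F]; first by split.
by rewrite fsbig_finite//= set_fsetK.
Qed.

Lemma esum_le_fset a (c : \bar R) :
  (forall F : {fset J}, \sum_(j <- F) a j <= c)%E -> (\esum_(j in setT) a j <= c)%E.
Proof.
move=> ac; apply: ge_ereal_sup => _ [A [fA _] <-].
by rewrite fsbig_finite.
Qed.

Lemma esum_approx a : (forall j, 0 <= a j)%E -> (\esum_(j in setT) a j < +oo)%E ->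
  forall eps : R, 0 < eps -> exists F : {fset J},
    (\esum_(j in setT) a j <= \sum_(j <- F) a j + eps%:E)%E.
Proof.
move=> a0 aoo eps e0.
have fin : \esum_(j in setT) a j \is a fin_num.
  by rewrite ge0_fin_numE// esum_ge0.
have [_ [A [fA _] <-] H] := @ub_ereal_sup_adherent _ _ eps e0 fin.
exists (fset_set A); rewrite -fsbig_finite//.
by rewrite -leeBlDr// ltW.
Qed.

End esum.

Section closed_span.
Context {d} {T : measurableType d} {R : realType}.
Variable mu : {measure set T -> \bar R}.
Context {J : choiceType}.
Variable e : J -> T -> R[i].
Implicit Types f g p : T -> R[i].

(** Equality of functions at every point, so that products and powers of elements of the span can be
    computed pointwise. *)
Definition inspan p := exists F c, p = lincomb F c e.

Lemma inspan0 : inspan (fun=> 0).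
Proof.
exists fset0, (fun=> 0); apply/funext => x; rewrite lincombE big_seq_fset0 //.
Qed.

Lemma inspan_linear (a : R[i]) p q : inspan p -> inspan q ->
  inspan (fun x => a * p x + q x).
Proof.
move=> [F [c ->]] [G [c' ->]].
exists (F `|` G)%fset, (fun j => a * (if j \in F then c j else 0) +
  (if j \in G then c' j else 0)).
apply/funext => x; rewrite !lincombE.
under [RHS]eq_bigr do rewrite mulrDl.
rewrite big_split /= mulr_sumr; congr (_ + _).
  rewrite -(big_fset_incl _ (fsubsetUl F G)); last first.
    by move=> j _ jF; rewrite ifN// mulr0 mul0r.
  by rewrite big_seq [RHS]big_seq; apply: eq_bigr => j ->; rewrite mulrA.
rewrite -(big_fset_incl _ (fsubsetUr F G)); last first.
  by move=> j _ jF; rewrite ifN// mul0r.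
by rewrite big_seq [RHS]big_seq; apply: eq_bigr => j ->.
Qed.

Lemma inspan_gen j : inspan (e j).
Proof.
exists [fset j]%fset, (fun=> 1); apply/funext => x.
by rewrite lincombE big_seq_fset1 mul1r.
Qed.

Lemma inspanZ (a : R[i]) p : inspan p -> inspan (fun x => a * p x).
Proof.
move=> sp; have := inspan_linear a sp inspan0.
by congr inspan; apply/funext => x; rewrite addr0.
Qed.

Lemma inspanD p q : inspan p -> inspan q -> inspan (fun x => p x + q x).
Proof.
move=> sp sq; have := inspan_linear 1 sp sq.
by congr inspan; apply/funext => x; rewrite mul1r.
Qed.

Lemma inspan_sum (I : Type) (s : seq I) (F : I -> T -> R[i]) :
  (forall i, inspan (F i)) -> inspan (fun x => \sum_(i <- s) F i x).
Proof.
move=> iF; elim: s => [|i s ih].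
  by under eq_fun do rewrite big_nil; exact: inspan0.
by under eq_fun do rewrite big_cons; exact: inspanD.
Qed.

Lemma inspan_L2 p : (forall j, L2 mu (e j)) -> inspan p -> L2 mu p.
Proof. by move=> Le [F [c ->]]; exact: L2_lincomb. Qed.

Lemma closed_spanP f : closed_span mu e f <-> L2 mu f /\ forall eps : R, 0 < eps ->
  exists p, inspan p /\ (N2 mu (fun x => f x - p x)%R <= eps%:E)%E.
Proof.
split=> -[Lf H]; split=> // eps e0.
  have [|F [c]] := H (Num.sqrt eps); first by rewrite sqrtr_gt0.
  rewrite L2norm_lt ?sqrtr_gt0// sqr_sqrtr; last exact: ltW.
  by move=> fF; exists (lincomb F c e); split; [exists F, c|exact: ltW].
have e2 : 0 < eps ^+ 2 by rewrite exprn_gt0.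
have [|_ [[F [c ->]] H2]] := H (eps ^+ 2 / 2); first by rewrite divr_gt0.
exists F, c; rewrite L2norm_lt//; apply: (le_lt_trans H2).
by rewrite lte_fin; lra.
Qed.

Lemma closed_span_L2 f : closed_span mu e f -> L2 mu f.
Proof. by case. Qed.

Lemma inspan_closed_span p : (forall j, L2 mu (e j)) -> inspan p -> closed_span mu e p.
Proof.
move=> Le sp; apply/closed_spanP; split; first exact: inspan_L2.
move=> eps e0; exists p; split=> //.
by under eq_fun do rewrite subrr; rewrite N2_0 lee_fin ltW.
Qed.

Hypothesis Le : forall j, L2 mu (e j).

Lemma closed_span_linear (a : R[i]) f g : closed_span mu e f -> closed_span mu e g ->
  closed_span mu e (fun x => a * f x + g x).
Proof.
move=> /closed_spanP[Lf Hf] /closed_spanP[Lg Hg]; apply/closed_spanP; split.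
  by apply: L2D => //; exact: L2Z.
move=> eps e0.
have sa : 0 <= sqn a := sqn_ge0 a.
have [|p [sp fp]] := Hf (eps / (4 * (1 + sqn a))).
  by rewrite divr_gt0// mulr_gt0//; lra.
have [|q [sq gq]] := Hg (eps / 4); first by rewrite divr_gt0.
have [[mf _] [mg _]] := (Lf, Lg).
have [[mp _] [mq _]] := (inspan_L2 Le sp, inspan_L2 Le sq).
exists (fun x => a * p x + q x); split; first exact: inspan_linear.
exact: N2_linear_small.
Qed.

Lemma closed_span_closed f : L2 mu f ->
  (forall eps : R, 0 < eps -> exists g, closed_span mu e g /\
    (N2 mu (fun x => f x - g x)%R <= eps%:E)%E) -> closed_span mu e f.
Proof.
move=> Lf H; apply/closed_spanP; split=> // eps e0.
have e4 : 0 < eps / 4 by rewrite divr_gt0.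
have [g [/closed_spanP[Lg Hg] fg]] := H _ e4.
have [p [sp gp]] := Hg _ e4.
have [[mf _] [mg _]] := (Lf, Lg); have [mp _] := inspan_L2 Le sp.
by exists p; split => //; exact: (N2_tri_eps mf mg mp).
Qed.

Lemma closed_span_ae f g : cmeasurable g -> closed_span mu e f -> g = f %[ae mu] ->
  closed_span mu e g.
Proof.
move=> mg Hf gf; have [Lf _] := Hf; have Lg := L2_ae mg Lf gf.
apply: closed_span_closed => // eps e0; exists f; split => //.
have [mf _] := Lf.
by rewrite (N2B_eq0 _ mg mf).2// lee_fin ltW.
Qed.

Lemma closed_span_sum (I : Type) (s : seq I) (F : I -> T -> R[i]) :
  (forall i, closed_span mu e (F i)) ->
  closed_span mu e (fun x => \sum_(i <- s) F i x).
Proof.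
move=> iF; elim: s => [|i s ih].
  under eq_fun do rewrite big_nil.
  by apply: inspan_closed_span => //; exact: inspan0.
under eq_fun do rewrite big_cons.
have := closed_span_linear 1 (iF i) ih.
by congr closed_span; apply/funext => x; rewrite mul1r.
Qed.

Lemma closed_spanZ (a : R[i]) f : closed_span mu e f ->
  closed_span mu e (fun x => a * f x).
Proof.
move=> cf; have := closed_span_linear a cf (inspan_closed_span Le inspan0).
by congr closed_span; apply/funext => x; rewrite addr0.
Qed.

End closed_span.

Lemma closed_span_sub d (T : measurableType d) (R : realType)
    (mu : {measure set T -> \bar R}) (J J' : choiceType)
    (e : J -> T -> R[i]) (e' : J' -> T -> R[i]) :
  (forall j, L2 mu (e j)) -> (forall j, closed_span mu e (e' j)) ->
  closed_span mu e' `<=` closed_span mu e.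
Proof.
move=> Le H f cf; have [Lf _] := cf.
apply: (closed_span_closed Le Lf) => eps e0.
have /closed_spanP[_ /(_ _ e0)[p [[F [c ->]] fp]]] := cf.
exists (lincomb F c e'); split => //.
by apply: (@closed_span_sum _ _ _ _ _ _ Le _ _ (fun j x => c j * e' j x)) => j; exact: closed_spanZ.
Qed.

Section parseval.
Context {d} {T : measurableType d} {R : realType}.
Variable mu : {measure set T -> \bar R}.
Context {J : choiceType}.
Variable e : J -> T -> R[i].
Hypothesis Le : forall j, L2 mu (e j).
Hypothesis eO : forall i j, inner mu (e i) (e j) = (i == j)%:R.

Lemma parseval f : closed_span mu e f ->
  (\esum_(j in setT) (sqn (inner mu f (e j)))%:E)%E = N2 mu f.
Proof.
move=> cf; have [Lf _] := cf; apply/eqP; rewrite eq_le; apply/andP; split.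
  apply: esum_le_fset => F; rewrite N2rE// sumEFin lee_fin.
  have := N2r_sub_orthonormal Le eO (inner mu f \o e) (fset_uniq F) Lf.
  rewrite [X in _ = _ + X]big1/=; last by move=> j _; rewrite subrr sqn0.
  rewrite addr0 -subr_ge0 => <-; exact: N2r_ge0.
apply/lee_addgt0Pr => eps e0.
have /closed_spanP[_ /(_ _ e0)[p [[F [c ->]] fp]]] := cf.
apply: (@le_trans _ _ (\sum_(j <- F) (sqn (inner mu f (e j)))%:E + eps%:E)%E); last first.
  by rewrite leeD2r// fset_le_esum// => j; rewrite lee_fin sqn_ge0.
rewrite N2rE// sumEFin -EFinD lee_fin.
have := N2r_sub_orthonormal Le eO c (fset_uniq F) Lf.
have : 0 <= \sum_(j <- F) sqn (inner mu f (e j) - c j).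
  by apply: sumr_ge0 => j _; exact: sqn_ge0.
move: fp; rewrite N2rE; last first.
  by apply: L2B => //; exact: L2_lincomb.
rewrite lee_fin lincombE => ? ? ?; lra.
Qed.

End parseval.

Lemma cvge0P (R : realType) (u : nat -> \bar R) : (forall k, 0 <= u k)%E ->
  u @ \oo --> 0%E <-> forall eps : R, 0 < eps ->
    exists K, forall k, (K <= k)%N -> (u k <= eps%:E)%E.
Proof.
move=> u0; split.
  move=> /fine_cvgP[ufin /cvgrPdist_le uc] eps e0.
  have [K _ KP] := ufin; have [M _ MP] := uc _ e0.
  exists (maxn K M) => k kM; have := KP k; have := MP k => /=.
  rewrite sub0r normrN => /(_ (leq_trans (leq_maxr _ _) kM)) h1.
  move=> /(_ (leq_trans (leq_maxl _ _) kM)) h2.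
  rewrite -(fineK h2) lee_fin; apply: le_trans h1; exact: ler_norm.
move=> H; apply/fine_cvgP; split.
  have [K KP] := H 1 ltr01; exists K => // k /= /KP uk.
  by rewrite ge0_fin_numE// (le_lt_trans uk)// ltry.
apply/cvgrPdist_le => eps e0; have [K KP] := H _ e0.
exists K => // k /= /KP uk; rewrite sub0r normrN ger0_norm ?fine_ge0//.
by rewrite -lee_fin fineK// ge0_fin_numE// (le_lt_trans uk)// ltry.
Qed.

Lemma N2_dominated d (T : measurableType d) (R : realType)
    (mu : {measure set T -> \bar R}) (g_ : nat -> T -> R[i]) (g : T -> R[i])
    (h : T -> R) :
  (forall k, cmeasurable (g_ k)) -> cmeasurable g ->
  (\forall x \ae mu, ccvg (g_ ^~ x) (g x)) ->
  mu.-integrable setT (EFin \o h) -> (forall k x, sqn (g_ k x - g x) <= h x) ->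
  forall eps : R, 0 < eps -> exists K, forall k, (K <= k)%N ->
    (N2 mu (fun x => g_ k x - g x)%R <= eps%:E)%E.
Proof.
move=> mg_ mg gcvg hint gh.
apply/cvge0P; first by move=> k; exact: N2_ge0.
have [||||_ + _] := @dominated_convergence _ _ _ mu _ measurableT
  (fun k x => (sqn (g_ k x - g x))%:E) (fun=> 0%E) (EFin \o h) _ _ _ hint.
- by move=> k; exact/emeasurable_sqn/cmeasurableB.
- exact: measurable_cst.
- apply: filterS gcvg => x cx _; apply: cvg_EFin; first exact: nearW.
  rewrite (_ : 0%R = sqn (g x - g x)); last by rewrite subrr sqn0.
  by apply: ccvg_sqn; apply: ccvgB => //; exact: ccvg_cst.
- by apply: aeW => x k _ /=; rewrite lee_fin ger0_norm ?sqn_ge0.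
rewrite [X in X @ _ --> _ -> _](_ : _ = fun k => N2 mu (fun x => g_ k x - g x)%R)//.
apply/funext => k; apply: eq_integral => x _.
by rewrite sube0 gee0_abs// lee_fin sqn_ge0.
Qed.

(** * Density of the span of a bounded multiplicative family *)

Section step_polynomials.
Context {R : realType}.
Implicit Types (t u : R) (N m : nat).

Lemma bernoulli_ge u m : 0 <= u -> 1 + m%:R * u <= (1 + u) ^+ m.
Proof.
move=> u0; elim: m => [|m ih]; first by rewrite mul0r addr0 expr0.
rewrite exprS; apply: (@le_trans _ _ ((1 + u) * (1 + m%:R * u))).
  have : 0 <= m%:R * u * u by rewrite !mulr_ge0.
  by rewrite -natr1; lra.
by rewrite ler_wpM2l// addr_ge0.
Qed.

Lemma bernoulli_le u m : 0 <= u <= 1 -> 1 - m%:R * u <= (1 - u) ^+ m.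
Proof.
move=> /andP[u0 u1]; elim: m => [|m ih]; first by rewrite mul0r subr0 expr0.
rewrite exprS; apply: (@le_trans _ _ ((1 - u) * (1 - m%:R * u))).
  have : 0 <= m%:R * u * u by rewrite !mulr_ge0.
  by rewrite -natr1; lra.
by rewrite ler_wpM2l// subr_ge0.
Qed.

(* These polynomials converge pointwise on [0, 1] to the indicator function of
   [0, 1/2[: for u = t ^ N and m = N * 2 ^ N, Bernoulli's inequality gives
   1 - m u <= (1 - u) ^ m <= 1 / (1 + m u) with m u = N * (2 t) ^ N. *)
Definition step_poly N t : R := (1 - t ^+ N) ^+ (N * 2 ^ N).

Lemma step_poly_itv N t : 0 <= t <= 1 -> 0 <= step_poly N t <= 1.
Proof.
move=> /andP[t0 t1]; have tN0 : 0 <= t ^+ N by rewrite exprn_ge0.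
have tN1 : t ^+ N <= 1 by rewrite exprn_ile1.
by rewrite /step_poly exprn_ge0 ?subr_ge0// exprn_ile1 ?subr_ge0// gerBl.
Qed.

(** With z = w^2, Bernoulli's inequality for 1/w = 1 + u bounds N w^N by 1/u, and the remaining
    factor w^N tends to 0. *)
Lemma cvg_mul_expr (z : R) : 0 <= z < 1 -> (N%:R * z ^+ N) @[N --> \oo] --> 0.
Proof.
move=> /andP[z0 z1].
have [->|zn0] := eqVneq z 0.
  apply/cvgrPdist_le => e e0; exists 1%N => // -[//|N] _ /=.
  by rewrite expr0n/= mulr0 subr0 normr0 ltW.
have zp : 0 < z by rewrite lt_neqAle eq_sym zn0.
pose w := Num.sqrt z.
have w0 : 0 < w by rewrite sqrtr_gt0.
have w1 : w < 1 by rewrite -sqrtr1 ltr_sqrt.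
have wz : w ^+ 2 = z by rewrite sqr_sqrtr.
pose u := w^-1 - 1.
have u0 : 0 < u by rewrite subr_gt0 invf_gt1.
have Nw N : N%:R * w ^+ N <= u^-1.
  rewrite -[leRHS]mul1r ler_pdivlMr// mulrAC.
  have := @bernoulli_ge u N (ltW u0).
  rewrite {2}/u addrCA subrr addr0 exprVn => h.
  have wN : 0 < w ^+ N by rewrite exprn_gt0.
  rewrite -ler_pdivlMr// mul1r; apply: le_trans h; rewrite addrC lerDl//.
apply: (@squeeze_cvgr _ _ _ _ (fun=> 0) (fun N => u^-1 * w ^+ N)).
- apply: nearW => N; rewrite mulr_ge0 ?exprn_ge0//= -wz -exprM mulnC exprM expr2 mulrA.
  by rewrite ler_wpM2r// exprn_ge0// ltW.
- exact: cvg_cst.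
- rewrite -[X in _ --> X](mulr0 u^-1); apply: cvgM; first exact: cvg_cst.
  by apply: cvg_expr; rewrite ger0_norm// ltW.
Qed.

Lemma cvg_step_poly t : 0 <= t <= 1 ->
  step_poly N t @[N --> \oo] --> ((t < 2^-1)%R%:R : R).
Proof.
move=> t01; have /andP[t0 t1] := t01.
have tN N : 0 <= t ^+ N <= 1 by rewrite exprn_ge0// exprn_ile1.
have mE N : (N * 2 ^ N)%:R * t ^+ N = N%:R * (2 * t) ^+ N :> R.
  by rewrite natrM natrX exprMn mulrA.
have [tlt|tge] := ltP.
  apply: (@squeeze_cvgr _ _ _ _ (fun N => 1 - N%:R * (2 * t) ^+ N) (fun=> 1)).
  - apply: nearW => N; rewrite -mE bernoulli_le//=.
    by have /andP[] := step_poly_itv N t01.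
  - rewrite -[X in _ --> X]subr0; apply: cvgB; first exact: cvg_cst.
    by apply: cvg_mul_expr; lra.
  - exact: cvg_cst.
apply: (@squeeze_cvgr _ _ _ _ (fun=> 0) (fun N => N.+1%:R^-1)).
- apply: nearW => N; have /andP[-> _] := step_poly_itv N t01.
  have /andP[u0 u1] := tN N; set u := t ^+ N in u0 u1.
  rewrite /= /step_poly -/u; set m := (_ * _)%N.
  (* Here 2 t >= 1, so m u = N (2 t)^N >= N. Since (1 - u)^m (1 + u)^m <= 1, the polynomial is at
     most 1 / (N + 1). *)
  have h1 : N.+1%:R <= (1 + u) ^+ m.
    apply: le_trans (bernoulli_ge m u0); rewrite mE -natr1 addrC lerD2l.
    rewrite -[leLHS]mulr1 ler_wpM2l// exprn_ege1//; lra.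
  have h2 : (1 - u) ^+ m * (1 + u) ^+ m <= 1.
    rewrite -exprMn exprn_ile1//; last by nra.
    by rewrite mulr_ge0//; lra.
  rewrite -[leRHS]mul1r ler_pdivlMr// ; apply: le_trans h2.
  by rewrite ler_wpM2l// exprn_ge0//; lra.
- exact: cvg_cst.
- exact: cvg_harmonic.
Qed.

End step_polynomials.

Section density.
Context {d} {T : measurableType d} {R : realType}.
Variable mu : {measure set T -> \bar R}.
Hypothesis mufin : (mu setT < +oo)%E.
Context {J : choiceType}.
Variable e : J -> T -> R[i].
Hypothesis me : forall j, cmeasurable (e j).
Hypothesis e_le1 : forall j x, sqn (e j x) <= 1.
Hypothesis span1 : inspan e (fun=> 1).
Hypothesis spanM : forall i j, inspan e (fun x => e i x * e j x).
Implicit Types (p q : T -> R[i]) (E F : set T).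

Lemma bounded_L2 (C : R) p : cmeasurable p -> (forall x, sqn (p x) <= C) -> L2 mu p.
Proof.
move=> mp pC; apply/L2P; split => //.
apply: (@le_lt_trans _ _ (\int[mu]_x (cst C%:E) x)%E).
  apply: ge0_le_integral => //.
  - by move=> x _; rewrite lee_fin sqn_ge0.
  - exact: emeasurable_sqn.
  - by move=> x _; rewrite lee_fin.
rewrite integral_cst// lte_mul_pinfty ?lee_fin//.
  apply: le_trans (pC point); exact: sqn_ge0.
Qed.

Lemma bounded_gen_L2 j : L2 mu (e j).
Proof. exact: (@bounded_L2 1). Qed.
Let Le := bounded_gen_L2.

Lemma inspanM p q : inspan e p -> inspan e q -> inspan e (fun x => p x * q x).
Proof.
move=> [F [c ->]] [G [c' ->]].
under eq_fun do rewrite !lincombE mulr_suml.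
apply: inspan_sum => i; under eq_fun do rewrite mulr_sumr.
apply: inspan_sum => j; have := inspanZ (c i * c' j) (spanM i j).
by congr inspan; apply/funext => x; ring.
Qed.

Lemma inspan_cst (c : R[i]) : inspan e (fun=> c).
Proof.
by have := inspanZ c span1; congr inspan; apply/funext => x; rewrite mulr1.
Qed.

Lemma inspanX p m : inspan e p -> inspan e (fun x => p x ^+ m).
Proof.
move=> sp; elim: m => [|m ih]; first exact: inspan_cst.
by under eq_fun do rewrite exprS; exact: inspanM.
Qed.

(* Sets whose indicator is a bounded pointwise limit of elements of the span.
   They form a pi-system containing the sublevel sets of the real elements of
   the span, so a Dynkin argument gives density for the sigma-algebra they
   generate. *)
Definition good_set E := exists p_ : nat -> T -> R,
  [/\ forall k, inspan e (fun x => (p_ k x)%:C),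
      forall k x, 0 <= p_ k x <= 1
    & forall x, p_ k x @[k --> \oo] --> (\1_E x : R)].

Lemma good_setI : setI_closed good_set.
Proof.
move=> E F [p [sp p01 pE]] [q [sq q01 qF]].
exists (fun k x => p k x * q k x); split.
- move=> k; have := inspanM (sp k) (sq k); congr inspan; apply/funext => x.
  by rewrite rmorphM.
- move=> k x; have /andP[p0 p1] := p01 k x; have /andP[q0 q1] := q01 k x.
  by rewrite mulr_ge0// mulr_ile1.
- by move=> x; rewrite indicI /=; exact: cvgM.
Qed.

Lemma good_set_lt (g : T -> R) (C a : R) : (forall x, `|g x| <= C) ->
  inspan e (fun x => (g x)%:C) -> good_set [set x | g x < a].
Proof.
move=> gC sg.
have C0 : 0 <= C := le_trans (normr_ge0 _) (gC point).
(* The affine map [t] sends the range of [g] into [0, 1] and the threshold [a] to 1/2, where the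
   step polynomials jump. The summand 1 keeps [D] positive. *)
pose D := 2 * (C + `|a| + 1).
have a0 := normr_ge0 a.
have D0 : 0 < D by rewrite /D; lra.
pose t x := (g x - a) / D + 2^-1.
have tE x : t x = (g x - a + (C + `|a| + 1)) / D.
  by rewrite /t /D; field; rewrite gt_eqF//; lra.
have t01 x : 0 <= t x <= 1.
  have := gC x; rewrite ler_norml => /andP[h1 h2].
  have := ler_norm a; have := ler_norm (- a); rewrite normrN => h3 h4.
  rewrite tE ler_pdivrMr// mul1r divr_ge0 ?(ltW D0)//=; last by lra.
  by rewrite /D; lra.
exists (fun k x => step_poly k (t x)); split.
- move=> k; have st : inspan e (fun x => (t x)%:C).
    have := inspan_linear (D^-1%:C) sg (inspan_cst (- a / D + 2^-1)%:C).
    congr inspan; apply/funext => x; rewrite -rmorphM -rmorphD; congr (_%:C).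
    by rewrite /t; ring.
  have := inspanX (k * 2 ^ k) (inspan_linear (-1) (inspanX k st) span1).
  congr inspan; apply/funext => x; rewrite /step_poly.
  by rewrite rmorphXn rmorphB rmorph1 rmorphXn /= mulN1r addrC.
- by move=> k x; exact: step_poly_itv.
- move=> x; rewrite indicE.
  have -> : (x \in [set x | g x < a]) = (t x < 2^-1).
    rewrite /t -ltrBrDr subrr pmulr_llt0 ?invr_gt0// subr_lt0.
    by apply/idP/idP; [rewrite inE|move=> h; rewrite inE].
  exact: cvg_step_poly.
Qed.

Lemma good_set_measurable E : good_set E -> measurable E.
Proof.
move=> [p [sp _ pE]]; apply/measurable_indicP.
apply: (@measurable_fun_cvg _ _ _ _ (fun k x => p k x)) => [k|x _]; last exact: pE.
have [m _] : cmeasurable (fun x => (p k x)%:C).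
  by have [mp _] := inspan_L2 Le (sp k).
exact: m.
Qed.

Let ind E : T -> R[i] := fun x => (\1_E x)%:C.

Let mind E : measurable E -> cmeasurable (ind E).
Proof. by move=> mE; apply: cmeasurable_real; exact: measurable_indic. Qed.

Let sind E x : sqn (ind E x) <= 1.
Proof. by rewrite sqn_real indicE; case: (_ \in _); rewrite ?expr1n ?expr0n. Qed.

Let Lind E : measurable E -> L2 mu (ind E).
Proof. by move=> mE; apply: (@bounded_L2 1); [exact: mind|exact: sind]. Qed.

Let mucst (c : R) : mu.-integrable setT (EFin \o (fun=> c)).
Proof.
apply/integrableP; split; first exact: measurable_cst.
by under eq_integral do rewrite /=; rewrite integral_cst// lte_mul_pinfty.
Qed.

Lemma good_set_closed_span E : good_set E -> closed_span mu e (fun x => (\1_E x)%:C).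
Proof.
move=> gE; have mE := good_set_measurable gE.
have [p [sp p01 pE]] := gE.
apply: (closed_span_closed Le); first exact: Lind.
move=> eps e0.
have [|||K KP] := @N2_dominated _ _ _ mu (fun k x => (p k x)%:C) (ind E) (fun=> 1) _
   (mind mE) _ (mucst 1) _ _ e0.
- by move=> k; have [] := inspan_L2 Le (sp k).
- apply: aeW => x; split => /=; [exact: pE|exact: cvg_cst].
- move=> k x; rewrite /ind -rmorphB sqn_real.
  have /andP[p0 p1] := p01 k x; rewrite indicE.
  by case: (x \in E) => /=; nra.
exists (fun x => (p K x)%:C); split; first exact: inspan_closed_span.
by rewrite N2_sub; exact: KP.
Qed.

Lemma closed_span_indic E : <<s good_set >> E -> closed_span mu e (fun x => (\1_E x)%:C).
Proof.
pose H := [set E | measurable E /\ closed_span mu e (ind E)].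
suff : <<s good_set >> `<=` H by move=> h /h[].
apply: lambda_system_subset => //.
- exact: good_setI.
- split=> //.
  + split; first exact: measurableT.
    have := inspan_closed_span Le span1.
    by congr closed_span; apply/funext => x; rewrite /ind indicT.
  + move=> A B BA [mA cA] [mB cB]; split; first exact: measurableD.
    have := closed_span_linear Le (-1) cB cA; congr closed_span.
    apply/funext => x; rewrite /ind !indicE mulN1r addrC -rmorphB; congr (_%:C).
    have [xB|xB] := boolP (x \in B).
      have xA : x \in A by move: xB; rewrite !inE; exact: BA.
      rewrite xA subrr; case: (boolP (x \in A `\` B)) => //.
      by rewrite inE => -[_]; move: xB; rewrite inE.
    rewrite subr0; congr (_%:R); congr nat_of_bool.
    apply/idP/idP; rewrite !inE; last by case.
    by move=> Ax; split => // ; move: xB; rewrite notin_setE.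
  + move=> F ndF FH.
    have mU : measurable (\bigcup_k F k) by apply: bigcup_measurable => k _; case: (FH k).
    split => //; apply: (closed_span_closed Le); first exact: Lind.
    move=> eps e0.
    have [|||K KP] := @N2_dominated _ _ _ mu (fun k => ind (F k)) (ind (\bigcup_k F k))
       (fun=> 1) _ (mind mU) _ (mucst 1) _ _ e0.
    * by move=> k; apply: mind; case: (FH k).
    * apply: aeW => x; split => /=; last exact: cvg_cst.
      have [[k _ Fkx]|nx] := pselect ((\bigcup_k F k) x).
        rewrite indicE mem_set; last by exists k.
        apply: cvg_near_cst; exists k => // m /= km; rewrite indicE mem_set//.
        by move: x Fkx; exact/subsetPset/ndF.
      rewrite indicE memNset//; apply: cvg_near_cst; apply: nearW => m.
      by rewrite indicE memNset// => Fmx; apply: nx; exists m.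
    * move=> k x; rewrite /ind -rmorphB sqn_real !indicE.
      by case: (_ \in _); case: (_ \in _) => /=; rewrite ?subr0 ?subrr ?sub0r ?sqrrN ?expr0n ?expr1n.
    exists (ind (F K)); split; first by case: (FH K).
    by rewrite N2_sub; exact: KP.
- by move=> F gF; split; [exact: good_set_measurable|exact: good_set_closed_span].
Qed.

End density.

Import HBNNSimple.

Section density_simple.
Context {d} {T : measurableType d} {R : realType}.
Variable mu : {measure set T -> \bar R}.
Context {J : choiceType}.
Variable e : J -> T -> R[i].
Hypothesis Le : forall j, L2 mu (e j).
Hypothesis dense_indic : forall E : set T, measurable E ->
  closed_span mu e (fun x => (\1_E x)%:C).

Lemma dense_ge0 (g : T -> R) : L2 mu (fun x => (g x)%:C) -> (forall x, 0 <= g x) ->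
  closed_span mu e (fun x => (g x)%:C).
Proof.
move=> Lg g0; have [[mg _] _] := Lg.
have mgE : measurable_fun setT (EFin \o g) by apply/measurable_EFinP.
pose h k := nnsfun_approx measurableT mgE k.
have hg (x : T) : h k x @[k --> \oo] --> g x.
  have /fine_cvgP[_] : EFin (h k x) @[k --> \oo] --> (g x)%:E; last by [].
  by apply: (@cvg_nnsfun_approx _ _ _ _ measurableT _ mgE) => // y _; rewrite lee_fin.
have hle k (x : T) : h k x <= g x.
  rewrite -lee_fin /h nnsfun_approxE.
  by apply: (@le_approx _ _ _ setT (EFin \o g)) => // y _; rewrite /= lee_fin.
apply: (closed_span_closed Le Lg) => eps e0.
have [|||||K KP] := @N2_dominated _ _ _ mu (fun k x => (h k x)%:C) (fun x => (g x)%:C)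
   (fun x => sqn (g x)%:C) _ _ _ _ _ _ e0.
- by move=> k; apply: cmeasurable_real.
- by case: Lg.
- by apply: aeW => x; split => /=; [exact: hg|exact: cvg_cst].
- exact: integrable_sqn.
- move=> k x; rewrite -rmorphB !sqn_real.
  by have := hle k x; have := g0 x; have : 0 <= h k x by []; nra.
exists (fun x => (h K x)%:C); split; last by rewrite N2_sub; exact: KP.
rewrite (_ : (fun x => _) = fun x => \sum_(y <- fset_set (range (h K)))
    y%:C * (\1_(h K @^-1` [set y]) x)%:C); last first.
  apply/funext => x; rewrite fimfunE fsbig_finite//= rmorph_sum /=.
  by apply: eq_bigr => y _; rewrite rmorphM.
apply: (@closed_span_sum _ _ _ mu _ e Le _ _ (fun y x => y%:C * (\1_(h K @^-1` [set y]) x)%:C)) => y.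
by apply: closed_spanZ => //; exact: dense_indic.
Qed.

Lemma dense_real (g : T -> R) : L2 mu (fun x => (g x)%:C) ->
  closed_span mu e (fun x => (g x)%:C).
Proof.
move=> Lg; have [[mg _] _] := Lg.
have L (s : T -> R) : measurable_fun setT s -> (forall x, `|s x| <= `|g x|) ->
    L2 mu (fun x => (s x)%:C).
  move=> ms sg; apply: L2_le Lg _; first exact: cmeasurable_real.
  by move=> x; rewrite !sqn_real -(real_normK (num_real (s x)))
    -(real_normK (num_real (g x))) ler_sqr// nnegrE.
have mp : measurable_fun setT (fun x => Num.max (g x) 0) by exact: measurable_maxr.
have mn : measurable_fun setT (fun x => Num.max (- g x) 0).
  by apply: measurable_maxr => //; exact: measurable_funN.
have := closed_span_linear Le (-1) (@dense_ge0 (fun x => Num.max (- g x) 0) _ _)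
  (@dense_ge0 (fun x => Num.max (g x) 0) _ _).
have -> : (fun x => -1 * (Num.max (- g x) 0)%:C + (Num.max (g x) 0)%:C) = fun x => (g x)%:C.
  apply/funext => x; rewrite mulN1r -rmorphN -rmorphD; congr (_%:C).
  by rewrite /Num.max; case: ltP => ?; case: ltP => ?; lra.
apply.
- apply: L => // x; rewrite /Num.max; case: ifP => _; rewrite ?normr0 ?normr_ge0//.
  by rewrite normrN.
- by move=> x; rewrite le_max lexx orbT.
- by apply: L => // x; rewrite /Num.max; case: ifP => _; rewrite ?normr0 ?normr_ge0.
- by move=> x; rewrite le_max lexx orbT.
Qed.

Lemma closed_spanT f : L2 mu f -> closed_span mu e f.
Proof.
move=> Lf; have [[m1 m2] _] := Lf.
have := closed_span_linear Le 'i (@dense_real (fun x => complex.Im (f x)) _)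
  (@dense_real (fun x => complex.Re (f x)) _).
have -> : (fun x => 'i * (complex.Im (f x))%:C + (complex.Re (f x))%:C) = f.
  by apply/funext => x; case: (f x) => a b; cring.
apply.
- apply: L2_le Lf _; first exact: cmeasurable_real.
  by move=> x; rewrite sqn_real sqr_Im_le.
- apply: L2_le Lf _; first exact: cmeasurable_real.
  by move=> x; rewrite sqn_real sqr_Re_le.
Qed.

End density_simple.

(** * Fourier series on the torus *)

Lemma ae_prodm_fst d1 d2 (T1 : measurableType d1) (T2 : measurableType d2) (R : realType)
    (m1 : {sigma_finite_measure set T1 -> \bar R})
    (m2 : {sigma_finite_measure set T2 -> \bar R}) (P : T1 -> Prop) :
  (\forall x \ae m1, P x) -> \forall p \ae prodm m1 m2, P p.1.
Proof.
move=> [A [mA A0 PA]]; exists (A `*` setT); split.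
- exact: measurableX.
- transitivity (m1 A * m2 setT)%E; first exact: product_measure1E.
  by rewrite A0 mul0e.
- by move=> p /= np; split => //; exact: PA.
Qed.

Lemma ae_prodm_snd d1 d2 (T1 : measurableType d1) (T2 : measurableType d2) (R : realType)
    (m1 : {sigma_finite_measure set T1 -> \bar R})
    (m2 : {sigma_finite_measure set T2 -> \bar R}) (P : T2 -> Prop) :
  (\forall y \ae m2, P y) -> \forall p \ae prodm m1 m2, P p.2.
Proof.
move=> [A [mA A0 PA]]; exists (setT `*` A); split.
- exact: measurableX.
- transitivity (m1 setT * m2 A)%E; first exact: product_measure1E.
  by rewrite A0 mule0.
- by move=> p /= np; split => //; exact: PA.
Qed.

Section lebesgue_tuples.
Context {R : realType}.
Local Open Scope ereal_scope.

Lemma ge0_integral_prodm d1 d2 (T1 : measurableType d1) (T2 : measurableType d2)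
    (m1 : {sigma_finite_measure set T1 -> \bar R})
    (m2 : {sigma_finite_measure set T2 -> \bar R}) (f : T1 * T2 -> \bar R) :
  measurable_fun setT f -> (forall x, 0 <= f x) ->
  \int[prodm m1 m2]_z f z = \int[m1]_x \int[m2]_y f (x, y).
Proof. by move=> mf f0; exact: fubini_tonelli1. Qed.

Lemma ge0_integral_prodm_swap d1 d2 (T1 : measurableType d1) (T2 : measurableType d2)
    (m1 : {sigma_finite_measure set T1 -> \bar R})
    (m2 : {sigma_finite_measure set T2 -> \bar R}) (f : T1 * T2 -> \bar R) :
  measurable_fun setT f -> (forall x, 0 <= f x) ->
  \int[prodm m1 m2]_z f z = \int[m2]_y \int[m1]_x f (x, y).
Proof. by move=> mf f0; exact: fubini_tonelli2. Qed.

Lemma ge0_integral_leb_cons n (f : Rn R n.+1 -> \bar R) :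
  measurable_fun setT f -> (forall x, 0 <= f x) ->
  \int[leb n.+1]_x f x =
  \int[lebesgue_measure]_a \int[leb n]_y f (cons_Rn (a, y)).
Proof.
move=> mf f0.
apply: (etrans (ge0_integral_pushforward (@measurable_cons_Rn R n)
  (prodm lebesgue_measure (leb n)) measurableT mf (fun x _ => f0 x))).
rewrite preimage_setT ge0_integral_prodm//.
  by apply: measurableT_comp => //; exact: measurable_cons_Rn.
by move=> x; exact: f0.
Qed.

Lemma ge0_integral_torus n (f : Rn R n -> \bar R) :
  measurable_fun setT f -> (forall x, 0 <= f x) ->
  \int[torus n]_x f x = \int[leb n]_(x in cube n) f x.
Proof.
move=> mf f0; have mc := @measurable_cube R n.
rewrite (@ge0_negligible_integral _ _ _ _ _ (~` cube n))//; last 2 first.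
- exact: measurableC.
- by change (@leb R n (~` cube n `&` cube n) = 0); rewrite setICl measure0.
rewrite setTD setCK; apply: eq_measure_integral => A mA Ac.
by change (@leb R n (A `&` cube n) = leb n A); rewrite setIidl.
Qed.

Lemma measurable_rcoord n (i : 'I_n) : measurable_fun setT (fun x : Rn R n => rcoord x i).
Proof. exact: measurable_tnth. Qed.

Lemma cube_cons n a (y : Rn R n) :
  cube n.+1 (cons_Rn (a, y)) <-> (0 <= a < 1)%R /\ cube n y.
Proof.
split.
  move=> c; split; first by have := c ord0; rewrite /rcoord tnth0.
  by move=> i; have := c (lift ord0 i); rewrite /rcoord tnthS.
move=> [a01 cy] i; case: (unliftP ord0 i) => [j ->|->]; last by rewrite /rcoord tnth0.
by rewrite /rcoord tnthS; exact: cy.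
Qed.

Lemma ge0_integral_torus_cons n (f : Rn R n.+1 -> \bar R) :
  measurable_fun setT f -> (forall x, 0 <= f x) ->
  \int[torus n.+1]_x f x =
  \int[lebesgue_measure]_(a in `[0%R, 1%R[) \int[torus n]_y f (cons_Rn (a, y)).
Proof.
move=> mf f0.
have mfa a : measurable_fun setT (fun y => f (cons_Rn (a, y))).
  apply: measurableT_comp => //.
  by apply: (measurableT_comp measurable_cons_Rn); exact: measurable_pair1.
rewrite ge0_integral_torus// integral_mkcond ge0_integral_leb_cons; last 2 first.
- apply/(measurable_restrictT f (@measurable_cube R n.+1)).
  exact: measurable_funTS.
- by move=> x; rewrite patchE; case: ifP.
rewrite [RHS]integral_mkcond; apply: eq_integral => a _.
rewrite patchE; case: ifPn => a01.
  rewrite ge0_integral_torus// [RHS]integral_mkcond; apply: eq_integral => y _.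
  rewrite !patchE; case: ifPn => h1; case: ifPn => h2 //.
    by move: h1 h2; rewrite inE notin_setE => /cube_cons[].
  move: h1 h2; rewrite inE notin_setE => h1 h2; exfalso; apply: h1; apply/cube_cons; split => //.
  by move: a01; rewrite inE /= in_itv.
rewrite integral0_eq// => y _; rewrite patchE; case: ifPn => //.
rewrite inE => /cube_cons[a1 _]; move: a01; rewrite notin_setE /= in_itv /=.
by move=> /(_ a1).
Qed.

Lemma torus_setT n : torus n [set: Rn R n] = 1.
Proof.
elim: n => [|n ih].
  rewrite /torus /mrestr /= setTI diracE mem_set// => i; by case: i.
have := @ge0_integral_torus_cons n (cst 1) (measurable_cst _) (fun _ => lee01).
rewrite integral_cst// mul1e => ->.
rewrite (eq_integral (cst 1)); last first.
  by move=> a _; rewrite integral_cst// mul1e; exact: ih.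
rewrite integral_cst//= mul1e.
have -> : lebesgue_measure (`[0%R, 1%R[%classic : set R) = 1; last by [].
by rewrite lebesgue_measure_itv/= lte_fin ltr01 sube0.
Qed.

Lemma integral_cst_torus n (c : \bar R) : \int[torus n]_x cst c x = c.
Proof.
rewrite integral_cst//; apply: etrans (mule1 _); congr (_ * _).
exact: torus_setT.
Qed.

Lemma torus_ae_cube n : \forall x \ae (torus n : {measure set (Rn R n) -> \bar R}), cube n x.
Proof.
exists (~` cube n); split => //; first by apply: measurableC; exact: (@measurable_cube R n).
change (@leb R n (~` cube n `&` cube n) = 0); rewrite setICl; exact: measure0.
Qed.

End lebesgue_tuples.

Section characters.
Context {R : realType}.

Lemma expi_2pi_int (k : int) : expi (2 * pi * k%:~R : R) = 1.
Proof.
have E (m : nat) : expi (2 * pi * m%:R : R) = 1.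
  elim: m => [|m ih]; first by rewrite mulr0 expi0.
  rewrite -(natr1 m) mulrDr expiD ih mul1r mulr1 /expi mulr_natl cos2pi sin2pi.
  by [].
case: k => m; first exact: E.
by rewrite NegzE mulrN expiN E rmorph1.
Qed.

(** The added 1 makes the integrand nonnegative, so that the integrals over the torus can be
    iterated by Tonelli. The phase [t] holds the contribution of the other coordinates. *)
Lemma integral_cos_affine (k : int) (t : R) : k != 0 ->
  (\int[lebesgue_measure]_(a in `[0%R, 1%R[)
     (1 + cos (2 * pi * k%:~R * a + t))%:E = 1)%E.
Proof.
move=> k0; pose c : R := 2 * pi * k%:~R.
have c0 : c != 0.
  by rewrite /c !mulf_neq0 ?intr_eq0// gt_eqF// pi_gt0.
have cf : continuous (fun a : R => 1 + cos (c * a + t)).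
  move=> x; apply: cvgD; first exact: cvg_cst.
  apply: (@continuous_comp _ _ _ (fun a => c * a + t) cos); last exact: continuous_cos.
  by apply: cvgD; [apply: cvgM; [exact: cvg_cst|exact: cvg_id]|exact: cvg_cst].
rewrite integral_itv_bndo_bndc; last first.
  apply/measurable_funTS/measurable_EFinP; exact: continuous_measurable_fun.
pose F (a : R) := a + c^-1 * sin (c * a + t).
have dF (x : R) : is_derive x 1 F (1 + cos (c * x + t)).
  have -> : 1 + cos (c * x + t) = 1 + c^-1 * (c * cos (c * x + t)).
    by rewrite mulrA mulVf// mul1r.
  have d1 : is_derive x 1 (fun a : R => c * a + t) c.
    have -> : (fun a : R => c * a + t) = (c \*: id) + cst t by [].
    by apply: is_derive_eq; rewrite addr0 /GRing.scale /= mulr1.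
  have d2 : is_derive x 1 (fun a : R => sin (c * a + t)) (c * cos (c * x + t)).
    rewrite mulrC.
    exact: (@is_derive1_comp _ sin (fun a => c * a + t)).
  change (is_derive x 1 (id + (c^-1 \*: (fun a : R => sin (c * a + t))))
    (1 + c^-1 *: (c * cos (c * x + t)))).
  exact: is_deriveD.
rewrite (@continuous_FTC2 _ (fun a => 1 + cos (c * a + t)) F)//.
- rewrite /F mulr0 add0r mulr1 -EFinB; congr EFin.
  have : complex.Im (expi (c + t)) = complex.Im (expi t) by rewrite expiD expi_2pi_int mul1r.
  by rewrite add0r /= => ->; ring.
- exact: continuous_subspaceT.
- have cF : continuous F.
    move=> x; have [dFx _] := dF x.
    exact/differentiable_continuous/derivable1_diffP.
  split => [x _||]; first by have [] := dF x.
    exact/cvg_at_right_filter/cF.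
  exact/cvg_at_left_filter/cF.
- by move=> x _; rewrite derive1E; apply: derive_val.
Qed.

(** The phases t = 0 and t = -pi/2 give the real and imaginary parts of the integral; [b] tells
    whether the character is trivial. *)
Lemma cintegral_expi d (T : measurableType d) (mu : {measure set T -> \bar R})
    (h : T -> R) (b : bool) : mu setT = 1%E -> measurable_fun setT h ->
  (forall t, \int[mu]_x (1 + cos (h x + t))%:E = (1 + b%:R * cos t)%:E)%E ->
  cintegral mu (fun x => expi (h x)) = b%:R.
Proof.
move=> mu1 mh H.
have mc t : measurable_fun setT (fun x => cos (h x + t)).
  apply: (measurableT_comp (f := cos)).
    by apply: continuous_measurable_fun; exact: continuous_cos.
  exact: measurable_funD.
have i1 (c : R) : mu.-integrable setT (EFin \o (fun=> c)).
  apply/integrableP; split; first exact: measurable_cst.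
  rewrite (eq_integral (cst `|c|%:E))// integral_cst//.
  by rewrite mu1 mule1 ltry.
have ic t : mu.-integrable setT (fun x => (cos (h x + t))%:E).
  apply: (@le_integrable _ _ _ mu _ measurableT _ (EFin \o (fun=> 1))) => //.
    exact/measurable_EFinP.
  by move=> x _ /=; rewrite lee_fin normr1 cos_max.
have E t : Rintegral mu setT (fun x => cos (h x + t)) = b%:R * cos t.
  have := H t; under eq_integral do rewrite EFinD.
  rewrite (@integralD _ _ _ mu setT measurableT (EFin \o (fun=> 1)))//.
  rewrite (integral_cst _ measurableT) mu1 mule1.
  rewrite -(fineK (integrable_fin_num measurableT (ic t))) -EFinD => -[/addrI].
  by [].
rewrite /cintegral /expi /=.
have -> : Rintegral mu setT (fun x => cos (h x)) = b%:R.
  by have := E 0; rewrite cos0 mulr1 => <-; apply: eq_Rintegral => x _; rewrite addr0.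
have -> : Rintegral mu setT (fun x => sin (h x)) = 0.
  have := E (- (pi / 2)); rewrite cosN cos_pihalf mulr0 => <-.
  by apply: eq_Rintegral => x _; rewrite cosBpihalf.
by case: b H E.
Qed.

Definition zadd n (k l : Zn n) : Zn n := [tuple tnth k i + tnth l i | i < n].
Definition zopp n (k : Zn n) : Zn n := [tuple - tnth k i | i < n].
Definition zzero n : Zn n := [tuple 0 | i < n].

Lemma zaddC n (k l : Zn n) : zadd k l = zadd l k.
Proof. by apply: eq_from_tnth => i; rewrite !tnth_mktuple addrC. Qed.

Lemma zaddA n (k l m : Zn n) : zadd k (zadd l m) = zadd (zadd k l) m.
Proof. by apply: eq_from_tnth => i; rewrite !tnth_mktuple addrA. Qed.

Lemma zaddN n (k : Zn n) : zadd k (zopp k) = zzero n.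
Proof. by apply: eq_from_tnth => i; rewrite !tnth_mktuple subrr. Qed.

Lemma zadd0 n (k : Zn n) : zadd k (zzero n) = k.
Proof. by apply: eq_from_tnth => i; rewrite !tnth_mktuple addr0. Qed.

Lemma zaddNK n (k l : Zn n) : zadd (zadd k (zopp l)) l = k.
Proof. by rewrite -zaddA (zaddC _ l) zaddN zadd0. Qed.

Lemma zaddK n (k l : Zn n) : zadd (zadd k l) (zopp l) = k.
Proof. by rewrite -zaddA zaddN zadd0. Qed.

Lemma zsub_eq0 n (k l : Zn n) : (zadd k (zopp l) == zzero n) = (k == l).
Proof.
apply/eqP/eqP => [h|->]; last by rewrite zaddN.
by rewrite -(zaddNK k l) h zaddC zadd0.
Qed.

Lemma dot_addl n (x y z : Rn R n) : dot (vadd x y) z = dot x z + dot y z.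
Proof.
rewrite /dot -big_split; apply: eq_bigr => i _.
by rewrite /rcoord tnth_mktuple mulrDl.
Qed.

Lemma dotC n (x y : Rn R n) : dot x y = dot y x.
Proof. by apply: eq_bigr => i _; rewrite mulrC. Qed.

Lemma dot_addr n (x y z : Rn R n) : dot z (vadd x y) = dot z x + dot z y.
Proof. by rewrite dotC dot_addl !(dotC z). Qed.

Lemma dot_subl n (x y z : Rn R n) : dot (vsub x y) z = dot x z - dot y z.
Proof.
rewrite /dot -sumrB; apply: eq_bigr => i _.
by rewrite /rcoord tnth_mktuple mulrBl.
Qed.

Lemma intv_add n (k l : Zn n) : intv (zadd k l) = vadd (intv k) (intv l) :> Rn R n.
Proof. by apply: eq_from_tnth => i; rewrite !tnth_mktuple /rcoord !tnth_mktuple intrD. Qed.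

Lemma dot_intv_opp n (k : Zn n) (x : Rn R n) : dot (intv (zopp k)) x = - dot (intv k) x.
Proof.
rewrite /dot -sumrN; apply: eq_bigr => i _.
by rewrite /rcoord !tnth_mktuple intrN mulNr.
Qed.

Lemma dot_intv0 n (x : Rn R n) : dot (intv (zzero n)) x = 0.
Proof. by rewrite /dot big1// => i _; rewrite /rcoord !tnth_mktuple mul0r. Qed.

Lemma dot_intv n (k l : Zn n) : exists z : int, dot (intv k) (intv l) = z%:~R :> R.
Proof.
exists (\sum_(i < n) tnth k i * tnth l i); rewrite rmorph_sum; apply: eq_bigr => i _.
by rewrite /rcoord !tnth_mktuple -intrM.
Qed.

Lemma measurable_dot d (T : measurableType d) n (f g : T -> Rn R n) :
  measurable_fun setT f -> measurable_fun setT g ->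
  measurable_fun setT (fun x => dot (f x) (g x)).
Proof.
move=> mf mg; apply: measurable_sum => i; apply: measurable_funM.
  exact: (measurableT_comp (measurable_rcoord i)).
exact: (measurableT_comp (measurable_rcoord i)).
Qed.

Definition chr n (m : Zn n) (x : Rn R n) : R[i] := expi (2 * pi * dot (intv m) x).

Lemma measurable_chr_arg n (m : Zn n) :
  measurable_fun setT (fun x : Rn R n => 2 * pi * dot (intv m) x).
Proof.
apply: measurable_funM; first exact: measurable_cst.
by apply: measurable_dot; [exact: measurable_cst|exact: measurable_id].
Qed.

Lemma cmeasurable_chr n (m : Zn n) : cmeasurable (chr m).
Proof. by apply: cmeasurable_expi; exact: measurable_chr_arg. Qed.

Lemma chrD n (k l : Zn n) x : chr (zadd k l) x = chr k x * chr l x.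
Proof. by rewrite /chr intv_add dot_addl mulrDr expiD. Qed.

Lemma chr0 n x : chr (zzero n) x = 1.
Proof. by rewrite /chr dot_intv0 mulr0 expi0. Qed.

Lemma chrN n (k : Zn n) x : chr (zopp k) x = ((chr k x)^*)%R.
Proof. by rewrite /chr dot_intv_opp mulrN expiN. Qed.

Lemma sqn_chr n (k : Zn n) x : sqn (chr k x) = 1.
Proof. exact: sqn_expi. Qed.

Lemma chr_intv n (k l : Zn n) : chr k (intv l) = 1.
Proof. by have [z zE] := dot_intv k l; rewrite /chr zE expi_2pi_int. Qed.

Lemma chr_vadd n (k : Zn n) x y : chr k (vadd x y) = chr k x * chr k y.
Proof. by rewrite /chr dot_addr mulrDr expiD. Qed.

(** Induction on the dimension: the integral over the last coordinates sees the first one only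
    through the phase, which is why [t] is universally quantified. *)
Lemma integral_cos_torus n (m : Zn n) (t : R) :
  (\int[torus n]_x (1 + cos (2 * pi * dot (intv m) x + t))%:E =
   (1 + (m == zzero n)%:R * cos t)%:E)%E.
Proof.
elim: n m t => [|n ih] m t.
  rewrite (_ : m == zzero 0 = true); last by apply/eqP; apply: eq_from_tnth => -[].
  rewrite (eq_integral (cst (1 + cos t)%:E)); last first.
    by move=> x _; rewrite /dot big_ord0 mulr0 add0r.
  by rewrite integral_cst_torus mul1r.
have mt k (m' : Zn k) (s : R) : measurable_fun setT
    (fun x : Rn R k => (1 + cos (2 * pi * dot (intv m') x + s))%:E).
  apply/measurable_EFinP; apply: measurable_funD; first exact: measurable_cst.
  apply: (measurableT_comp (f := cos)); first by apply: continuous_measurable_fun; exact: continuous_cos.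
  by apply: measurable_funD; [exact: measurable_chr_arg|exact: measurable_cst].
rewrite ge0_integral_torus_cons; last 2 first.
- exact: mt.
- by move=> x; rewrite lee_fin -lerBlDl sub0r cos_geN1.
pose m' : Zn n := [tuple tnth m (lift ord0 i) | i < n].
have E a (y : Rn R n) : dot (intv m) (cons_Rn (a, y)) =
    (tnth m ord0)%:~R * a + dot (intv m') y.
  rewrite /dot big_ord_recl /rcoord !tnth_mktuple tnth0; congr (_ + _).
  by apply: eq_bigr => i _; rewrite !tnth_mktuple tnthS.
under eq_integral => a _.
  under eq_integral => y _ do rewrite E mulrDr [2 * pi * (_ * a) + _]addrC -addrA.
  rewrite ih; over.
have -> : (m == zzero n.+1) = (tnth m ord0 == 0) && (m' == zzero n).
  apply/eqP/andP => [h|[/eqP h1 /eqP h2]].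
    split; first by rewrite h tnth_mktuple.
    by apply/eqP; apply: eq_from_tnth => i; rewrite !tnth_mktuple h tnth_mktuple.
  apply: eq_from_tnth => i; rewrite tnth_mktuple.
  case: (unliftP ord0 i) => [j ->|->//].
  by have := congr1 (fun z => tnth z j) h2; rewrite !tnth_mktuple.
have L1 : lebesgue_measure (`[0%R, 1%R[%classic : set R) = 1%E.
  by rewrite lebesgue_measure_itv/= lte_fin ltr01 sube0.
case: (m' == zzero n); last first.
  rewrite andbF mul0r (eq_integral (cst 1%E)); last by move=> a _; rewrite mul0r addr0.
  by rewrite integral_cst//= mul1e addr0.
rewrite andbT; have [h0|h0] := eqVneq (tnth m ord0) 0.
  rewrite (eq_integral (cst (1 + cos t)%:E)); last first.
    by move=> a _; rewrite h0 mul0r mulr0 add0r mul1r.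
  by rewrite integral_cst//= L1 mule1 mul1r.
rewrite mul0r addr0 -(integral_cos_affine t h0); apply: eq_integral => a _.
by rewrite mul1r mulrA.
Qed.

Lemma inner_chr n (k l : Zn n) : inner (torus n) (chr k) (chr l) = (k == l)%:R.
Proof.
rewrite /inner -zsub_eq0.
rewrite (_ : (fun x => _) = fun x => expi (2 * pi * dot (intv (zadd k (zopp l))) x)).
  apply: cintegral_expi; [exact: torus_setT|exact: measurable_chr_arg|].
  by move=> t; exact: integral_cos_torus.
by apply/funext => x; rewrite -[RHS]/(chr _ x) chrD chrN.
Qed.

Definition torus2 n : {sigma_finite_measure set (Rn R n * Rn R n)%type -> \bar R} :=
  prodm (torus n) (torus n).

Lemma torus2_setT n : torus2 n setT = 1%E.
Proof.
have := @product_measure1E _ _ _ _ R (torus n) (torus n) setT setT measurableT measurableT.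
rewrite setXTT => h; apply: (etrans h).
by rewrite -[RHS]mule1; congr (_ * _)%E; exact: torus_setT.
Qed.

Definition chr2 n (kl : Zn n * Zn n) (p : Rn R n * Rn R n) : R[i] :=
  chr kl.1 p.1 * chr kl.2 p.2.

Lemma cmeasurable_chr2 n (kl : Zn n * Zn n) : cmeasurable (chr2 kl).
Proof.
apply: cmeasurableM; apply: cmeasurable_comp; by [|exact: cmeasurable_chr].
Qed.

Lemma sqn_chr2 n (kl : Zn n * Zn n) p : sqn (chr2 kl p) = 1.
Proof. by rewrite sqnM !sqn_chr mulr1. Qed.

Lemma inner_chr2 n (k l : Zn n * Zn n) : inner (torus2 n) (chr2 k) (chr2 l) = (k == l)%:R.
Proof.
case: k l => [k k'] [l l'].
pose h (p : Rn R n * Rn R n) := 2 * pi * dot (intv (zadd k (zopp l))) p.1 +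
  2 * pi * dot (intv (zadd k' (zopp l'))) p.2.
rewrite /inner (_ : (fun x => _) = fun x => expi (h x)); last first.
  apply/funext => p; rewrite /h expiD -/(chr _ p.1) -/(chr _ p.2) !chrD !chrN.
  by rewrite /chr2 /= rmorphM /=; ring.
have mh : measurable_fun setT h.
  by apply: measurable_funD;
    apply: (measurableT_comp (measurable_chr_arg _)).
apply: cintegral_expi => //; first exact: torus2_setT.
move=> t; rewrite ge0_integral_prodm; last 2 first.
- apply/measurable_EFinP; apply: measurable_funD; first exact: measurable_cst.
  apply: (measurableT_comp (f := cos)); first by apply: continuous_measurable_fun; exact: continuous_cos.
  by apply: measurable_funD => //; exact: measurable_cst.
- by move=> x; rewrite lee_fin -lerBlDl sub0r cos_geN1.
under eq_integral => x _.
  under eq_integral => y _ do rewrite /h /= [2 * pi * dot _ x + _]addrC -addrA.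
  rewrite integral_cos_torus zsub_eq0; over.
rewrite xpair_eqE; have [_|_] := eqVneq k' l'; last first.
  rewrite andbF mul0r (eq_integral (cst 1%E)); last by move=> a _; rewrite mul0r addr0.
  by rewrite integral_cst_torus addr0.
rewrite andbT -zsub_eq0 -(integral_cos_torus _ t); apply: eq_integral => x _.
by rewrite mul1r.
Qed.

Lemma torus_fin n : (torus n [set: Rn R n] < +oo)%E.
Proof. by rewrite torus_setT ltry. Qed.

Lemma torus2_fin n : (torus2 n [set: Rn R n * Rn R n] < +oo)%E.
Proof. by rewrite torus2_setT ltry. Qed.

Lemma L2_chr n (k : Zn n) : L2 (torus n) (chr k).
Proof.
apply: (@bounded_L2 _ _ _ _ (torus_fin n) 1); first exact: cmeasurable_chr.
by move=> x; rewrite sqn_chr.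
Qed.

Lemma L2_chr2 n (k : Zn n * Zn n) : L2 (torus2 n) (chr2 k).
Proof.
apply: (@bounded_L2 _ _ _ _ (torus2_fin n) 1); first exact: cmeasurable_chr2.
by move=> x; rewrite sqn_chr2.
Qed.

End characters.

(** * Density of trigonometric polynomials on the torus *)

Lemma cos_expi (R : realType) (t : R) : (cos t)%:C = 2^-1 * (expi t + expi (- t)).
Proof. by rewrite expiN /expi; apply/eqP; rewrite eq_complex /=; apply/andP; split; apply/eqP; field. Qed.

Lemma sin_expi (R : realType) (t : R) : (sin t)%:C = (- 'i / 2) * (expi t - expi (- t)).
Proof. by rewrite expiN /expi; apply/eqP; rewrite eq_complex /=; apply/andP; split; apply/eqP; field. Qed.

Lemma inspan_cos_sin (R : realType) d (T : measurableType d) (J : choiceType) (e : J -> T -> R[i]) (h : T -> R) i j :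
  (forall x, e i x = expi (h x)) -> (forall x, e j x = expi (- h x)) ->
  inspan e (fun x => (cos (h x))%:C) /\ inspan e (fun x => (sin (h x))%:C).
Proof.
move=> ei ej; split.
  under eq_fun do rewrite cos_expi -ei -ej.
  apply: inspanZ; exact: inspanD (inspan_gen _ _) (inspan_gen _ _).
under eq_fun do rewrite sin_expi -ei -ej.
apply: inspanZ; have := inspan_linear (-1) (inspan_gen e j) (inspan_gen e i).
by congr inspan; apply/funext => x; rewrite mulN1r addrC.
Qed.

Section trigonometric_density.
Context {d} {T : measurableType d} {R : realType}.
Variable mu : {measure set T -> \bar R}.
Hypothesis mufin : (mu setT < +oo)%E.
Context {J : choiceType}.
Variable e : J -> T -> R[i].
Hypothesis me : forall j, cmeasurable (e j).
Hypothesis e_le1 : forall j x, sqn (e j x) <= 1.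
Hypothesis span1 : inspan e (fun=> 1).
Hypothesis spanM : forall i j, inspan e (fun x => e i x * e j x).

Local Notation Tg := (g_sigma_algebraType (good_set e)).

Lemma measurable_good_fun (g : T -> R) (C : R) : (forall x, `|g x| <= C) ->
  inspan e (fun x => (g x)%:C) -> measurable_fun [set: Tg] (g : Tg -> R).
Proof.
move=> gC sg _; apply: (measurability _ (RGenInftyO.measurableE R)); last exact: measurableT.
move=> _ [_ [a ->] <-]; rewrite setTI; apply: sub_sigma_algebra.
rewrite (_ : _ @^-1` _ = [set x | g x < a]); first exact: good_set_lt gC sg.
by apply/seteqP; split => x /=; rewrite in_itv.
Qed.

(* The inverse of t |-> (cos (2 pi t), sin (2 pi t)) on [0, 1[. *)
Definition circle_coord (u v : R) : R :=
  if 0 <= v then acos u / (2 * pi) else 1 - acos u / (2 * pi).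

Lemma circle_coordK (t : R) : 0 <= t < 1 ->
  circle_coord (cos (2 * pi * t)) (sin (2 * pi * t)) = t.
Proof.
move=> /andP[t0 t1]; have p0 : 0 < pi :> R := pi_gt0 R.
have p2 : 0 < 2 * pi :> R by rewrite mulr_gt0.
have [th|th] := leP t 2^-1.
  have h : 2 * pi * t \in `[0, pi].
    by rewrite in_itv /=; apply/andP; split; nra.
  rewrite /circle_coord sin_ge0_pi; last by rewrite in_itv in h.
  by rewrite cosK// mulrC mulKf// gt_eqF.
have E : 2 * pi * t = - (2 * pi * (1 - t)) + pi *+ 2 by rewrite -mulr_natl; ring.
have h : 0 < 2 * pi * (1 - t) < pi by apply/andP; split; nra.
have /andP[h1 h2] := h.
rewrite /circle_coord E sinD2pi cosD2pi sinN cosN leNgt oppr_lt0 sin_gt0_pi//=.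
rewrite cosK ?in_itv/= ?(ltW h1) ?(ltW h2)//.
by rewrite [_ * (1 - t)]mulrC mulfK ?gt_eqF//; ring.
Qed.

(** Since [acos] is decreasing, its sublevel sets are superlevel sets of the cosine, which lie in
    the sigma-algebra generated by the good sets. Levels outside ]0, pi] give the empty set or the
    whole space. *)
Lemma measurable_circle_coord (h : T -> R) i j :
  (forall x, e i x = expi (2 * pi * h x)) -> (forall x, e j x = expi (- (2 * pi * h x))) ->
  measurable_fun [set: Tg]
    ((fun x => circle_coord (cos (2 * pi * h x)) (sin (2 * pi * h x))) : Tg -> R).
Proof.
move=> ei ej; have [sc ss] := inspan_cos_sin ei ej.
have mc := measurable_good_fun (fun x => cos_max _) sc.
have ms := measurable_good_fun (fun x => sin_max _) ss.
have ma : measurable_fun [set: Tg] ((fun x => acos (cos (2 * pi * h x))) : Tg -> R).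
  move=> _; apply: (measurability _ (RGenInftyO.measurableE R)); last exact: measurableT.
  move=> _ [_ [a ->] <-]; rewrite setTI.
  have u01 x : -1 <= cos (2 * pi * h x) <= 1 by rewrite cos_geN1 cos_le1.
  have [a0|a0] := leP a 0.
    rewrite (_ : _ @^-1` _ = set0); first exact: measurable0.
    apply/seteqP; split => x //=; rewrite in_itv /= => h1.
    by have := acos_ge0 (u01 x); lra.
  have [api|api] := leP a pi; last first.
    rewrite (_ : _ @^-1` _ = setT); first exact: measurableT.
    apply/seteqP; split => x //= _; rewrite in_itv /=.
    by have := acos_lepi (u01 x); lra.
  rewrite (_ : _ @^-1` _ = (fun x : Tg => cos (2 * pi * h x)) @^-1` `]cos a, +oo[%classic).
    by rewrite -[X in measurable X]setTI; apply: mc.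
  have aI : a \in `[0, pi] by rewrite in_itv /= (ltW a0).
  apply/seteqP; split => x /=; rewrite !in_itv /= andbT => h1.
    rewrite -(acosK (x := cos (2 * pi * h x))) ?in_itv//= ltr_cos// in_itv/=.
    by rewrite acos_ge0// acos_lepi.
  move: h1; rewrite -{1}(acosK (x := cos (2 * pi * h x))) ?in_itv//= ltr_cos//.
  by rewrite in_itv/= acos_ge0// acos_lepi.
rewrite /circle_coord; apply: measurable_fun_ifT.
- apply: measurable_fun_ler => //; exact: measurable_cst.
- by apply: measurable_funM => //; exact: measurable_cst.
- apply: measurable_funB; first exact: measurable_cst.
  by apply: measurable_funM => //; exact: measurable_cst.
Qed.

(** Each measurable [E] coincides almost everywhere with its preimage under [psi], and that preimage
    belongs to the generated sigma-algebra, to which the Dynkin argument applies. *)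
Lemma trig_dense (psi : T -> T) (D : set T) :
  measurable_fun [set: Tg] (psi : Tg -> T) ->
  (\forall x \ae mu, D x) -> (forall x, D x -> psi x = x) ->
  forall f, L2 mu f -> closed_span mu e f.
Proof.
move=> mpsi aeD psiD; have Le := bounded_gen_L2 mufin me e_le1.
apply: closed_spanT => // E mE.
have mE' : <<s good_set e >> (psi @^-1` E).
  by have := mpsi measurableT _ mE; rewrite setTI.
apply: (closed_span_ae Le _ (closed_span_indic mufin me e_le1 span1 spanM mE')).
  by apply: cmeasurable_real; exact: measurable_indic.
apply: filterS aeD => x Dx _; congr (_%:C); rewrite !indicE; congr (_%:R).
by congr nat_of_bool; apply/idP/idP; rewrite !inE /= psiD.
Qed.

End trigonometric_density.

Section torus_density.
Context {R : realType}.

Definition zdelta n (i : 'I_n) : Zn n := [tuple (j == i)%:R | j < n].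

Lemma dot_zdelta n (i : 'I_n) (x : Rn R n) : dot (intv (zdelta i)) x = rcoord x i.
Proof.
rewrite /dot (bigD1 i)//= big1 ?addr0 => [|j ji].
  by rewrite /rcoord !tnth_mktuple eqxx mul1r.
by rewrite /rcoord !tnth_mktuple (negbTE ji) mul0r.
Qed.

Lemma inspan_chr1 n : inspan (@chr R n) (fun=> 1).
Proof. by have := inspan_gen (@chr R n) (zzero n); congr inspan; apply/funext => x; rewrite chr0. Qed.

Lemma inspan_chrM n (i j : Zn n) : inspan (@chr R n) (fun x => chr i x * chr j x).
Proof.
by have := inspan_gen (@chr R n) (zadd i j); congr inspan; apply/funext => x; rewrite chrD.
Qed.

Lemma inspan_chr21 n : inspan (@chr2 R n) (fun=> 1).
Proof.
have := inspan_gen (@chr2 R n) (zzero n, zzero n).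
by congr inspan; apply/funext => x; rewrite /chr2 !chr0 mulr1.
Qed.

Lemma inspan_chr2M n (i j : Zn n * Zn n) : inspan (@chr2 R n) (fun x => chr2 i x * chr2 j x).
Proof.
have := inspan_gen (@chr2 R n) (zadd i.1 j.1, zadd i.2 j.2).
by congr inspan; apply/funext => x; rewrite /chr2 !chrD; ring.
Qed.

Definition circle_tuple n (x : Rn R n) : Rn R n :=
  [tuple circle_coord (cos (2 * pi * rcoord x i)) (sin (2 * pi * rcoord x i)) | i < n].

Lemma circle_tupleK n (x : Rn R n) : cube n x -> circle_tuple x = x.
Proof.
move=> cx; apply: eq_from_tnth => i.
by rewrite tnth_mktuple circle_coordK//; exact: cx.
Qed.

Lemma chr_zdelta n (i : 'I_n) (x : Rn R n) : chr (zdelta i) x = expi (2 * pi * rcoord x i).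
Proof. by rewrite /chr dot_zdelta. Qed.

Lemma chr_zdeltaN n (i : 'I_n) (x : Rn R n) :
  chr (zopp (zdelta i)) x = expi (- (2 * pi * rcoord x i)).
Proof. by rewrite /chr dot_intv_opp dot_zdelta mulrN. Qed.

Lemma torus_dense n f : L2 (torus n) f -> closed_span (torus n) (@chr R n) f.
Proof.
have le1 (j : Zn n) (x : Rn R n) : sqn (chr j x) <= 1 by rewrite sqn_chr.
apply: (@trig_dense _ _ _ _ (torus_fin n) _ _ (@cmeasurable_chr R n) le1 (inspan_chr1 n)
  (@inspan_chrM n) (@circle_tuple n) (cube n)).
- apply/measurable_fun_tnthP => i.
  have := measurable_circle_coord (inspan_chr1 n) (@inspan_chrM n) (chr_zdelta i) (chr_zdeltaN i).
  by congr (measurable_fun _ _); apply/funext => x /=; rewrite tnth_mktuple.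
- exact: torus_ae_cube.
- exact: circle_tupleK.
Qed.

Lemma measurable_g_sigma_pair (T : pointedType) (G : set (set T)) d1 d2
    (T1 : measurableType d1) (T2 : measurableType d2)
    (f : g_sigma_algebraType G -> T1) (g : g_sigma_algebraType G -> T2) :
  measurable_fun setT f -> measurable_fun setT g ->
  measurable_fun setT (fun x => (f x, g x)).
Proof. exact: measurable_fun_pair. Qed.

Lemma torus2_ae_cube n :
  \forall p \ae (torus2 n : {measure set (Rn R n * Rn R n) -> \bar R}), cube n p.1 /\ cube n p.2.
Proof.
exact: filterS2 (ae_prodm_fst (torus n) (@torus_ae_cube R n))
  (ae_prodm_snd (torus n) (@torus_ae_cube R n)) => p.
Qed.

Lemma torus2_dense n f : L2 (torus2 n) f -> closed_span (torus2 n) (@chr2 R n) f.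
Proof.
have le1 (j : Zn n * Zn n) (x : Rn R n * Rn R n) : sqn (chr2 j x) <= 1 by rewrite sqn_chr2.
have E1 (k : Zn n) (p : Rn R n * Rn R n) : chr2 (k, zzero n) p = chr k p.1.
  by rewrite /chr2 chr0 mulr1.
have E2 (k : Zn n) (p : Rn R n * Rn R n) : chr2 (zzero n, k) p = chr k p.2.
  by rewrite /chr2 chr0 mul1r.
have mcc := measurable_circle_coord (inspan_chr21 n) (@inspan_chr2M n).
apply: (@trig_dense _ _ _ _ (torus2_fin n) _ _ (@cmeasurable_chr2 R n) le1 (inspan_chr21 n)
  (@inspan_chr2M n) (fun p => (circle_tuple p.1, circle_tuple p.2))
  [set p | cube n p.1 /\ cube n p.2]).
- apply: measurable_g_sigma_pair; apply/measurable_fun_tnthP => i.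
    have := mcc _ _ _ (fun p => etrans (E1 _ p) (chr_zdelta i p.1))
      (fun p => etrans (E1 _ p) (chr_zdeltaN i p.1)).
    by congr (measurable_fun _ _); apply/funext => x /=; rewrite tnth_mktuple.
  have := mcc _ _ _ (fun p => etrans (E2 _ p) (chr_zdelta i p.2))
    (fun p => etrans (E2 _ p) (chr_zdeltaN i p.2)).
  by congr (measurable_fun _ _); apply/funext => x /=; rewrite tnth_mktuple.
- exact: torus2_ae_cube.
- by move=> [x y] /= [cx cy]; rewrite !circle_tupleK.
Qed.

End torus_density.

(** * The Plancherel theorem *)

Section translation.
Context {R : realType}.
Local Open Scope ereal_scope.

(** By uniqueness of Lebesgue measure: its image under the translation gives the same value to every
    half-open interval. *)
Lemma lebesgue_measure_shift (v : R) (A : set R) : measurable A ->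
  lebesgue_measure ((fun x : R => x + v)%R @^-1` A) = lebesgue_measure A.
Proof.
move=> mA.
have mv : measurable_fun [set: measurableTypeR R] ((fun x => x + v)%R : measurableTypeR R -> measurableTypeR R).
  by apply: measurable_funD; [exact: measurable_id|exact: measurable_cst].
pose m : {measure set (measurableTypeR R) -> \bar R} :=
  @measure_function_pushforward__canonical__measure_function_Measure
    _ _ _ _ _ lebesgue_measure _ mv.
apply/esym; apply: (@lebesgue_measure_unique R m) => // X [[a b] _ <-].
have -> : m `](a, b).1, (a, b).2]%classic = lebesgue_measure `](a - v)%R, (b - v)%R]%classic.
  rewrite /m /= /pushforward; congr lebesgue_measure.
  by apply/seteqP; split => x /=; rewrite !in_itv /= ltrBlDr lerBrDr.
rewrite !lebesgue_measure_itv /= !lte_fin ltrD2r; case: ifP => // _.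
by rewrite -!EFinB; congr EFin; ring.
Qed.

Lemma ge0_integral_lebesgue_shift (v : R) (f : measurableTypeR R -> \bar R) :
  measurable_fun setT f -> (forall x, 0 <= f x) ->
  \int[lebesgue_measure]_x f (x + v)%R = \int[lebesgue_measure]_x f x.
Proof.
move=> mf f0.
have mv : measurable_fun [set: measurableTypeR R] ((fun x => x + v)%R : measurableTypeR R -> measurableTypeR R).
  by apply: measurable_funD; [exact: measurable_id|exact: measurable_cst].
have := ge0_integral_pushforward mv lebesgue_measure measurableT mf (fun x _ => f0 x).
rewrite preimage_setT => <-; apply: eq_measure_integral => A mA _.
exact: lebesgue_measure_shift.
Qed.

Lemma measurable_vadd d (T : measurableType d) n (f g : T -> Rn R n) :
  measurable_fun setT f -> measurable_fun setT g ->
  measurable_fun setT (fun x => vadd (f x) (g x)).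
Proof.
move=> mf mg; apply/measurable_fun_tnthP => i.
rewrite (_ : _ \o _ = fun x => (rcoord (f x) i + rcoord (g x) i)%R); last first.
  by apply/funext => x /=; rewrite tnth_mktuple.
by apply: measurable_funD; apply: (measurableT_comp (measurable_rcoord i)).
Qed.

Lemma measurable_vsub d (T : measurableType d) n (f g : T -> Rn R n) :
  measurable_fun setT f -> measurable_fun setT g ->
  measurable_fun setT (fun x => vsub (f x) (g x)).
Proof.
move=> mf mg; apply/measurable_fun_tnthP => i.
rewrite (_ : _ \o _ = fun x => (rcoord (f x) i - rcoord (g x) i)%R); last first.
  by apply/funext => x /=; rewrite tnth_mktuple.
by apply: measurable_funB; apply: (measurableT_comp (measurable_rcoord i)).
Qed.

Lemma vaddC n (x y : Rn R n) : vadd x y = vadd y x.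
Proof. by apply: eq_from_tnth => i; rewrite !tnth_mktuple addrC. Qed.

Lemma vaddA n (x y z : Rn R n) : vadd x (vadd y z) = vadd (vadd x y) z.
Proof. by apply: eq_from_tnth => i; rewrite !tnth_mktuple /rcoord !tnth_mktuple addrA. Qed.

Lemma vaddK n (x y : Rn R n) : vsub (vadd x y) y = x.
Proof. by apply: eq_from_tnth => i; rewrite !tnth_mktuple /rcoord !tnth_mktuple addrK. Qed.

Lemma ge0_integral_leb_vadd n (v : Rn R n) (f : Rn R n -> \bar R) :
  measurable_fun setT f -> (forall x, 0 <= f x) ->
  \int[leb n]_x f (vadd x v) = \int[leb n]_x f x.
Proof.
elim: n v f => [|n ih] v f mf f0.
  by apply: eq_integral => x _; congr f; apply: eq_from_tnth => -[].
apply: etrans (ge0_integral_leb_cons _ _) _ => //.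
  apply: measurableT_comp => //; apply: measurable_vadd; first exact: measurable_id.
  exact: measurable_cst.
apply: etrans (esym (ge0_integral_leb_cons mf f0)).
pose v' : Rn R n := [tuple rcoord v (lift ord0 i) | i < n].
have E a (y : Rn R n) : vadd (cons_Rn (a, y)) v = cons_Rn ((a + rcoord v ord0)%R, vadd y v').
  apply: eq_from_tnth => i; rewrite tnth_mktuple /rcoord.
  case: (unliftP ord0 i) => [j ->|->]; last by rewrite !tnth0.
  by rewrite !tnthS /= !tnth_mktuple /rcoord tnth_mktuple.
have mfa a : measurable_fun setT (fun y => f (cons_Rn (a, y))).
  apply: measurableT_comp => //.
  by apply: (measurableT_comp measurable_cons_Rn); exact: measurable_pair1.
under eq_integral => a _.
  under eq_integral => y _ do rewrite E.
  rewrite (ih v' (fun y => f (cons_Rn ((a + rcoord v ord0)%R, y))))//; over.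
rewrite (@ge0_integral_lebesgue_shift _ (fun a => \int[leb n]_x f (cons_Rn (a, x))))//.
- apply: (@measurable_fun_fubini_tonelli_F _ _ _ _ _ _ (f \o @cons_Rn R n)) => //.
    by apply: measurableT_comp => //; exact: measurable_cons_Rn.
  by move=> x; exact: f0.
- by move=> x; apply: integral_ge0 => y _; exact: f0.
Qed.

Lemma integral_leb_vadd n (v : Rn R n) (f : Rn R n -> \bar R) :
  measurable_fun setT f -> \int[leb n]_x f (vadd x v) = \int[leb n]_x f x.
Proof.
move=> mf; rewrite integralE [RHS]integralE; congr (_ - _).
  apply: etrans (ge0_integral_leb_vadd v (measurable_funepos mf) _) => //.
  by apply: eq_integral => x _; rewrite !funeposE.
apply: etrans (ge0_integral_leb_vadd v (measurable_funeneg mf) _) => //.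
by apply: eq_integral => x _; rewrite !funenegE.
Qed.

Lemma integral_torus n (f : Rn R n -> \bar R) : measurable_fun setT f ->
  \int[torus n]_x f x = \int[leb n]_(x in cube n) f x.
Proof.
move=> mf; rewrite integralE [RHS]integralE; congr (_ - _).
  by rewrite ge0_integral_torus//; exact: measurable_funepos.
by rewrite ge0_integral_torus//; exact: measurable_funeneg.
Qed.

Lemma cintegral_leb_vadd n (v : Rn R n) (f : Rn R n -> R[i]) : cmeasurable f ->
  cintegral (leb n) (fun x => f (vadd x v)) = cintegral (leb n) f.
Proof.
move=> [m1 m2]; rewrite /cintegral /Rintegral; congr (fine _ +i* fine _).
  rewrite (@integral_leb_vadd _ v (fun x => (complex.Re (f x))%:E))//.
  exact/measurable_EFinP.
rewrite (@integral_leb_vadd _ v (fun x => (complex.Im (f x))%:E))//.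
exact/measurable_EFinP.
Qed.

Lemma N2_leb_vadd n (v : Rn R n) (f : Rn R n -> R[i]) : cmeasurable f ->
  N2 (leb n) (fun x => f (vadd x v)) = N2 (leb n) f.
Proof.
move=> mf; rewrite /N2 (@ge0_integral_leb_vadd _ v (fun x => (sqn (f x))%:E))//.
  exact: emeasurable_sqn.
by move=> x; rewrite lee_fin sqn_ge0.
Qed.

End translation.

(** * Periodization over the integer lattice *)

Section periodization.
Context {R : realType}.

Definition zfloor n (x : Rn R n) : Zn n := [tuple Num.floor (rcoord x i) | i < n].

(** The cell m + [0, 1)^n, encoded as a fiber of [zfloor] so that the cells partition the space by
    construction. *)
Definition zcube n (m : Zn n) : set (Rn R n) := [set x | zfloor x = m].

Lemma zcubeE n (m : Zn n) (x : Rn R n) : zcube m x <-> cube n (vsub x (intv m)).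
Proof.
split=> [<- i|c].
  rewrite /rcoord !tnth_mktuple /rcoord tnth_mktuple.
  have /andP[h1 h2] := floor_itv (tnth x i).
  rewrite tnth_mktuple; move: h2; rewrite intrD1 => h2.
  by apply/andP; split; lra.
apply: eq_from_tnth => i; rewrite tnth_mktuple; apply: floor_def.
have := c i; rewrite /rcoord !tnth_mktuple /rcoord tnth_mktuple.
by rewrite subr_ge0 ltrBlDr [1 + _]addrC intrD1.
Qed.

Lemma zcube_vadd n (m : Zn n) (x : Rn R n) : zcube m (vadd x (intv m)) <-> cube n x.
Proof. by rewrite zcubeE vaddK. Qed.

Lemma measurable_zcube n (m : Zn n) : measurable (zcube m).
Proof.
rewrite (_ : zcube m = (fun x => vsub x (intv m)) @^-1` cube n); last first.
  by apply/seteqP; split => x /zcubeE.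
rewrite -[X in measurable X]setTI; apply: measurable_vsub => //; exact: measurable_cube.
Qed.

(** Passage to a series over the natural numbers, for which integration term by term is available.
    Codes that represent no index contribute 0. *)
Lemma esum_countable (J : countType) (a : J -> \bar R) : (forall j, 0 <= a j)%E ->
  (\esum_(j in setT) a j =
   \sum_(i <oo) (if @pickle_inv J i is Some j then a j else 0))%E.
Proof.
move=> a0; pose b i : \bar R := (if @pickle_inv J i is Some j then a j else 0)%E.
have b0 i : (0 <= b i)%E by rewrite /b; case: pickle_inv.
rewrite nneseries_esumT//.
have bij : set_bij [set: J] (range (@choice.pickle J)) (@choice.pickle J).
  split; [by move=> x _; exists x|by move=> x y _ _; exact: (pcan_inj choice.pickleK)|].
  by move=> _ [x _ <-]; exists x.
transitivity (\esum_(i in range (@choice.pickle J)) b i)%E.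
  rewrite (@reindex_esum _ _ _ _ _ _ _ bij); apply: eq_esum => j _.
  by rewrite /b pickleK_inv.
rewrite esum_mkcond; apply: eq_esum => i _.
case: ifPn => // iN; rewrite /b; case E : (@pickle_inv J i) => [j|//].
exfalso; move: iN; rewrite notin_setE; apply; exists j => //.
by have := @pickle_invK J i; rewrite E.
Qed.

Lemma integral_esum d (T : measurableType d) (mu : {measure set T -> \bar R})
    (J : countType) (f : J -> T -> \bar R) :
  (forall j, measurable_fun setT (f j)) -> (forall j x, 0 <= f j x)%E ->
  (\int[mu]_x (\esum_(j in setT) f j x) = \esum_(j in setT) \int[mu]_x f j x)%E.
Proof.
move=> mf f0.
rewrite esum_countable; last by move=> j; exact: integral_ge0.
under eq_integral do rewrite esum_countable//.
rewrite integral_nneseries//.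
- apply: eq_eseriesr => i _; case: pickle_inv => //; exact: integral0.
- move=> i; case: pickle_inv => [j|]; [exact: mf|exact: measurable_cst].
- by move=> i x _; case: pickle_inv.
Qed.

(** The integral is cut along the cells [zcube m], each of which is carried to the unit cube by a
    lattice translation. *)
Lemma ge0_integral_leb_periodize n (f : Rn R n -> \bar R) :
  measurable_fun setT f -> (forall x, 0 <= f x)%E ->
  (\int[leb n]_x f x = \esum_(m in [set: Zn n]) \int[torus n]_x f (vadd x (intv m)))%E.
Proof.
move=> mf f0; pose J : countType := n.-tuple int.
rewrite (@esum_countable J); last by move=> j; exact: integral_ge0.
pose F i : set (Rn R n) := if @pickle_inv J i is Some m then zcube m else set0.
have mF i : measurable (F i).
  by rewrite /F; case: pickle_inv => [m|]; [exact: measurable_zcube|exact: measurable0].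
have UF : \bigcup_i F i = setT.
  apply/seteqP; split => x // _; exists (@choice.pickle J (zfloor x)) => //.
  by rewrite /F pickleK_inv.
rewrite -{1}UF ge0_integral_bigcup//; last 2 first.
- by rewrite UF.
- apply/trivIsetP => i j _ _ ij; rewrite -subset0 => x [].
  rewrite /F; case Ei : (@pickle_inv J i) => [k|//]; case Ej : (@pickle_inv J j) => [l|//].
  move=> h1 h2; have kl : k = l by rewrite -[LHS]h1 -[RHS]h2.
  have := @pickle_invK J i; have := @pickle_invK J j; rewrite Ei Ej /= kl => h3 h4.
  by move: ij; rewrite -h3 -h4 eqxx.
apply: eq_eseriesr => i _; rewrite /F; case: pickle_inv => [m|]; last by rewrite integral_set0.
rewrite ge0_integral_torus//; last first.
  apply: measurableT_comp => //; apply: measurable_vadd => //; exact: measurable_cst.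
rewrite integral_mkcond [RHS]integral_mkcond -(ge0_integral_leb_vadd (intv m)).
- apply: eq_integral => x _; rewrite !patchE; congr (if _ then _ else _).
  by apply/idP/idP; rewrite !inE => /zcube_vadd.
- apply/(measurable_restrictT f (measurable_zcube m)); exact: measurable_funTS.
- by move=> x; rewrite patchE; case: ifP.
Qed.

End periodization.

Section cintegral_tools.
Context {R : realType}.

(** Valid for every measurable integrand: the integrals of the positive and negative parts are
    measurable in the parameter by Tonelli, and [fine] is measurable. *)
Lemma measurable_Rintegral_param d1 d2 (T1 : measurableType d1) (T2 : measurableType d2)
    (mu : {sigma_finite_measure set T2 -> \bar R}) (h : T1 * T2 -> R) :
  measurable_fun setT h -> measurable_fun setT (fun x => Rintegral mu setT (fun y => h (x, y))).
Proof.
move=> mh; have mhE : measurable_fun setT (EFin \o h) by exact/measurable_EFinP.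
rewrite /Rintegral.
apply: (measurableT_comp (f := fine)); first exact: fine_measurable.
rewrite (_ : (fun x => _) = (fun x => \int[mu]_y ((EFin \o h)^\+ (x, y)) -
    \int[mu]_y ((EFin \o h)^\- (x, y)))%E); last first.
  apply/funext => x; rewrite integralE; congr (_ - _)%E.
    by apply: eq_integral => y _; rewrite !funeposE.
  by apply: eq_integral => y _; rewrite !funenegE.
apply: emeasurable_funB.
  apply: measurable_fun_fubini_tonelli_F; first exact: measurable_funepos.
  by move=> x; exact: funepos_ge0.
apply: measurable_fun_fubini_tonelli_F; first exact: measurable_funeneg.
by move=> x; exact: funeneg_ge0.
Qed.

Lemma cmeasurable_cintegral_param d1 d2 (T1 : measurableType d1) (T2 : measurableType d2)
    (mu : {sigma_finite_measure set T2 -> \bar R}) (h : T1 * T2 -> R[i]) :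
  cmeasurable h -> cmeasurable (fun x => cintegral mu (fun y => h (x, y))).
Proof.
move=> [m1 m2]; split.
  exact: (measurable_Rintegral_param mu m1).
exact: (measurable_Rintegral_param mu m2).
Qed.

Lemma cmeasurable_indic d (T : measurableType d) (E : set T) : measurable E ->
  cmeasurable (fun x => ((\1_E x)%:C : R[i])).
Proof. by move=> mE; apply: cmeasurable_real; exact: measurable_indic. Qed.

Lemma sqn_indic_le1 (T : Type) (E : set T) x : sqn ((\1_E x)%:C : R[i]) <= 1.
Proof. by rewrite sqn_real indicE; case: (_ \in _); rewrite ?expr1n ?expr0n. Qed.

Lemma cintegral_torusE n (g : Rn R n -> R[i]) : cmeasurable g ->
  cintegral (torus n) g = cintegral (leb n) (fun x => g x * (\1_(@cube R n) x)%:C).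
Proof.
have E (h h' : Rn R n -> R) : measurable_fun setT h ->
    (forall x, h' x = h x * \1_(@cube R n) x) ->
    Rintegral (torus n) setT h = Rintegral (leb n) setT h'.
  move=> mh hh'; rewrite /Rintegral integral_torus; last exact/measurable_EFinP.
  rewrite [in LHS]integral_mkcond; congr fine; apply: eq_integral => x _.
  rewrite patchE hh' indicE; case: (x \in cube n); by rewrite ?mulr1 ?mulr0.
move=> [m1 m2]; rewrite /cintegral; congr (_ +i* _); apply: E => // x.
  by rewrite cReM /= mulr0 subr0.
by rewrite cImM /= mulr0 add0r.
Qed.

(** Periodization for complex integrands. A support made of finitely many cells reduces it to the
    additivity of the integral. *)
Lemma cintegral_leb_split n (F : {fset Zn n}) (h : Rn R n -> R[i]) :
  cintegrable (leb n) h -> (forall x, zfloor x \notin F -> h x = 0) ->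
  cintegral (leb n) h =
  \sum_(j <- F) cintegral (torus n) (fun x => h (vadd x (intv j))).
Proof.
move=> ih hF; have [i1 i2] := ih.
have mh : cmeasurable h.
  by split; apply/measurable_EFinP; [exact: measurable_int i1|exact: measurable_int i2].
have Eh : h = fun x => \sum_(j <- F) h x * (\1_(zcube j) x)%:C.
  apply/funext => x.
  have E j : \1_(zcube j) x = (zfloor x == j)%:R :> R.
    rewrite indicE; congr (_%:R); congr nat_of_bool.
    by apply/idP/eqP; rewrite ?inE// => ->; rewrite inE.
  under eq_bigr do rewrite E.
  have [xF|xF] := boolP (zfloor x \in F); last first.
    by rewrite hF// big1// => j _; rewrite mul0r.
  rewrite (bigD1_seq (zfloor x)) ?fset_uniq// eqxx mulr1 big1; first by rewrite [RHS]addr0.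
  move=> j jx.
  by rewrite eq_sym (negbTE jx) mulr0.
have mi j : cmeasurable (fun x : Rn R n => h x * (\1_(zcube j) x)%:C).
  by apply: cmeasurableM => //; apply: cmeasurable_indic; exact: measurable_zcube.
rewrite {1}Eh (@cintegral_sum _ _ _ _ _ _ (fun j x => h x * (\1_(zcube j) x)%:C)); last first.
  move=> j; apply: cintegrable_mul_le1 => //.
    by apply: cmeasurable_indic; exact: measurable_zcube.
  by move=> x; exact: sqn_indic_le1.
apply: eq_bigr => j _; rewrite cintegral_torusE; last first.
  apply: (cmeasurable_comp _ mh).
  by apply: measurable_vadd; [exact: measurable_id|exact: measurable_cst].
rewrite -(cintegral_leb_vadd (intv j))//; apply: eq_cintegral => x.
congr (_ * _%:C); rewrite !indicE; congr (_%:R); congr nat_of_bool.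
by apply/idP/idP; rewrite !inE => /zcube_vadd.
Qed.

Lemma L2_torus n (f : Rn R n -> R[i]) : L2 (leb n) f -> L2 (torus n) f.
Proof.
move=> /L2P[mf Nf]; apply/L2P; split=> //; apply: le_lt_trans Nf.
rewrite /N2 ge0_integral_torus; last 2 first.
- exact: emeasurable_sqn.
- by move=> x; rewrite lee_fin sqn_ge0.
apply: ge0_subset_integral => //; first exact: measurable_cube.
  exact: emeasurable_sqn.
by move=> x _; rewrite lee_fin sqn_ge0.
Qed.

Lemma esum_supp (J : choiceType) (F : {fset J}) (a : J -> \bar R) :
  (forall j, 0 <= a j)%E -> (forall j, j \notin F -> a j = 0%E) ->
  (\esum_(j in setT) a j = \sum_(j <- F) a j)%E.
Proof.
move=> a0 aF; transitivity (\esum_(j in [set` F]) a j)%E; last first.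
  by rewrite esum_fset// fsbig_finite// set_fsetK.
rewrite [RHS]esum_mkcond; apply: eq_esum => j _.
by case: ifPn => //; rewrite notin_setE => jF; apply: aF; apply/negP.
Qed.

Lemma leb_zcube_fin n (j : Zn n) : (@leb R n (zcube j) < +oo)%E.
Proof.
rewrite -[X in leb n X]setIT -integral_indic//; last exact: measurable_zcube.
rewrite -(ge0_integral_leb_vadd (intv j)); last 2 first.
- by apply/measurable_EFinP; apply: measurable_indic; exact: measurable_zcube.
- by move=> x; rewrite lee_fin.
rewrite (_ : (\int[_]_x _)%E = torus n [set: Rn R n]); first by rewrite torus_setT ltry.
rewrite /torus /mrestr setTI -[X in leb n X]setIT -integral_indic//; last exact: measurable_cube.
by apply: eq_integral => x _; congr (_%:R%:E); congr nat_of_bool;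
  apply/idP/idP; rewrite !inE => /zcube_vadd.
Qed.

Definition zbox n (F : {fset Zn n}) : set (Rn R n) := \bigcup_(j in [set` F]) zcube j.

Lemma zboxP n (F : {fset Zn n}) x : zbox F x <-> zfloor x \in F.
Proof. by split=> [[j jF xj]|xF]; [rewrite (_ : zfloor x = j)|exists (zfloor x)]. Qed.

Lemma measurable_zbox n (F : {fset Zn n}) : measurable (zbox F).
Proof. by apply: fin_bigcup_measurable => // j _; exact: measurable_zcube. Qed.

Lemma leb_zbox_fin n (F : {fset Zn n}) : (leb n (zbox F) < +oo)%E.
Proof.
rewrite measure_fin_bigcup//; last 2 first.
- by move=> i j _ _ [x [<- <-]].
- by move=> j _; exact: measurable_zcube.
by rewrite fsbig_finite//; apply: lte_sum_pinfty => j _; exact: leb_zcube_fin.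
Qed.

Lemma L2_leb_vadd n (v : Rn R n) (f : Rn R n -> R[i]) : L2 (leb n) f ->
  L2 (leb n) (fun x => f (vadd x v)).
Proof.
move=> /L2P[mf Nf]; apply/L2P; rewrite N2_leb_vadd//; split=> //.
by apply: (cmeasurable_comp _ mf); apply: measurable_vadd => //; exact: measurable_cst.
Qed.

Lemma zoppK n (k : Zn n) : zopp (zopp k) = k.
Proof. by apply: eq_from_tnth => i; rewrite !tnth_mktuple opprK. Qed.

Lemma esum_zopp n (a : Zn n -> \bar R) :
  (\esum_(m in setT) a (zopp m) = \esum_(m in setT) a m)%E.
Proof.
rewrite [RHS](@reindex_esum _ _ _ setT setT (@zopp n))//.
split=> //; first by move=> x y _ _ /(congr1 (@zopp n)); rewrite !zoppK.
by move=> x _; exists (zopp x) => //; rewrite zoppK.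
Qed.

Lemma cmeasurable_mul_expi d (T : measurableType d) (f : T -> R[i]) (h : T -> R) :
  cmeasurable f -> measurable_fun setT h -> cmeasurable (fun x => f x * expi (h x)).
Proof. by move=> mf mh; apply: cmeasurableM => //; exact: cmeasurable_expi. Qed.

Lemma L2_mul_expi d (T : measurableType d) (mu : {measure set T -> \bar R})
    (f : T -> R[i]) (h : T -> R) : L2 mu f -> measurable_fun setT h ->
  L2 mu (fun x => f x * expi (h x)).
Proof.
move=> Lf mh; apply: (L2_le _ Lf).
  by apply: cmeasurable_mul_expi => //; exact: L2_cmeasurable Lf.
by move=> x; rewrite sqnM sqn_expi mulr1.
Qed.

End cintegral_tools.

Section fourier.
Context {R : realType} {n : nat}.
Implicit Types f : Rn R n -> R[i].

(** The Fourier transform with a positive exponent, the sign that the Weyl kernel produces in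
    [weyl_four]. *)
Definition four f (xi : Rn R n) : R[i] :=
  cintegral (leb n) (fun x => f x * expi (2 * pi * dot x xi)).

Lemma measurable_phase d (T : measurableType d) (g h : T -> Rn R n) (c : R) :
  measurable_fun setT g -> measurable_fun setT h ->
  measurable_fun setT (fun x => c * dot (g x) (h x)).
Proof. by move=> mg mh; apply: measurable_funM => //; exact: measurable_dot. Qed.

Lemma cmeasurable_four f : cmeasurable f -> cmeasurable (four f).
Proof.
move=> mf.
pose h (p : Rn R n * Rn R n) := f p.2 * expi (2 * pi * dot p.2 p.1).
apply: (@cmeasurable_cintegral_param _ _ _ _ _ (leb n) h).
apply: cmeasurable_mul_expi; first exact: (cmeasurable_comp measurable_snd mf).
by apply: measurable_phase.
Qed.

Variables (f : Rn R n -> R[i]) (F : {fset Zn n}).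
Hypothesis Lf : L2 (leb n) f.
Hypothesis fF : forall x, zfloor x \notin F -> f x = 0.

Lemma supp_cintegrable : cintegrable (leb n) f.
Proof.
apply: (L2_supp_cintegrable (measurable_zbox F) (leb_zbox_fin F)) => // x xF.
by apply: fF; apply/negP => xF'; apply: xF; exact/zboxP.
Qed.

(* The periodization of f(x) e(x.xi): its Fourier coefficients are the values
   of the Fourier transform of f at the points of xi + Z^n. *)
Let G xi x : R[i] := \sum_(j <- F) f (vadd x (intv j)) * expi (2 * pi * dot (vadd x (intv j)) xi).

Let LG xi : L2 (torus n) (G xi).
Proof.
apply: L2_sum => j; apply: L2_torus.
apply: (@L2_leb_vadd _ _ (intv j) (fun x => f x * expi (2 * pi * dot x xi))).
apply: L2_mul_expi => //; apply: measurable_phase => //; exact: measurable_cst.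
Qed.

Let four_inner xi m : four f (vadd xi (intv m)) = inner (torus n) (G xi) (chr (zopp m)).
Proof.
rewrite /four (@cintegral_leb_split _ _ F); last 2 first.
- apply: cintegrable_mul_le1; first exact: supp_cintegrable.
    apply: cmeasurable_expi; apply: measurable_phase => //; exact: measurable_cst.
  by move=> x; rewrite sqn_expi.
- by move=> x /fF ->; rewrite mul0r.
rewrite /inner /G.
under [RHS]eq_cintegral do rewrite mulr_suml.
rewrite cintegral_sum; last first.
  move=> j; apply: L2_cintegrable; last exact: L2_chr.
  apply: L2_torus.
  apply: (@L2_leb_vadd _ _ (intv j) (fun x => f x * expi (2 * pi * dot x xi))).
  apply: L2_mul_expi => //; apply: measurable_phase => //; exact: measurable_cst.
apply: eq_bigr => j _; apply: eq_cintegral => x.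
rewrite dot_addr mulrDr expiD mulrA; congr (_ * _).
(* The character [chr m] is periodic under the lattice, so the shift by [j] drops out of it. The
   index [zopp m] compensates the conjugation in the inner product and the positive exponent. *)
by rewrite -chrN zoppK dotC -/(chr m _) chr_vadd chr_intv mulr1.
Qed.

Let mG : cmeasurable (fun p : Rn R n * Rn R n => G p.1 p.2).
Proof.
apply: cmeasurable_sum => j.
have mv : measurable_fun setT (fun p : Rn R n * Rn R n => vadd p.2 (intv j)).
  by apply: measurable_vadd => //; exact: measurable_cst.
apply: cmeasurable_mul_expi; first exact: (cmeasurable_comp mv (L2_cmeasurable Lf)).
exact: measurable_phase.
Qed.

(** Orthonormality of the characters is used twice. For fixed [xi], Parseval's identity turns the
    sum over xi + Z^n into the norm of [G xi]. After exchange of the integrals, for fixed [x], [G]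
    is up to a unimodular factor a trigonometric polynomial in [xi] with coefficients f(x + j), and
    the sum of their squared moduli is the periodization of |f|^2. *)
Lemma plancherel_supp : N2 (leb n) (four f) = N2 (leb n) f.
Proof.
have m4 := cmeasurable_four (L2_cmeasurable Lf).
have mv (m : Zn n) : measurable_fun setT (fun x : Rn R n => vadd x (intv m)).
  by apply: measurable_vadd => //; exact: measurable_cst.
have mf := L2_cmeasurable Lf.
rewrite {1}/N2 ge0_integral_leb_periodize; last 2 first.
- exact: emeasurable_sqn.
- by move=> x; rewrite lee_fin sqn_ge0.
rewrite -(@integral_esum _ _ _ _ (n.-tuple int) (fun m x => (sqn (four f (vadd x (intv m))))%:E)); last 2 first.
- by move=> m; apply: emeasurable_sqn; exact: (cmeasurable_comp (mv m) m4).
- by move=> m x; rewrite lee_fin sqn_ge0.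
transitivity (\int[torus n]_xi \int[torus n]_x (sqn (G xi x))%:E)%E.
  apply: eq_integral => xi _.
  under eq_esum do rewrite four_inner.
  rewrite (@esum_zopp _ _ (fun m => (sqn (inner (torus n) (G xi) (chr m)))%:E)).
  by apply: parseval => //; [exact: L2_chr|exact: inner_chr|exact: torus_dense].
rewrite -(@ge0_integral_prodm _ _ _ _ _ _ _ (fun p => (sqn (G p.1 p.2))%:E)); last 2 first.
- exact: emeasurable_sqn.
- by move=> x; rewrite lee_fin sqn_ge0.
rewrite ge0_integral_prodm_swap; last 2 first.
- exact: emeasurable_sqn.
- by move=> x; rewrite lee_fin sqn_ge0.
rewrite /N2 ge0_integral_leb_periodize; last 2 first.
- exact: emeasurable_sqn.
- by move=> x; rewrite lee_fin sqn_ge0.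
rewrite (@esum_supp _ (Zn n) F); last 2 first.
- by move=> m; apply: integral_ge0 => x _; rewrite lee_fin sqn_ge0.
- move=> m mF; rewrite integral_torus; last first.
    by apply: emeasurable_sqn; exact: (cmeasurable_comp (mv m) mf).
  apply: integral0_eq => x cx; rewrite fF ?sqn0//.
  by have /zcube_vadd -> := cx.
rewrite -ge0_integral_sum//; last 2 first.
- by move=> m; apply: emeasurable_sqn; exact: (cmeasurable_comp (mv m) mf).
- by move=> m x _; rewrite lee_fin sqn_ge0.
apply: eq_integral => x _.
rewrite sumEFin -(N2_lincomb (@L2_chr R n) (@inner_chr R n)).
apply: eq_integral => xi _; congr (_%:E).
have -> : G xi x = expi (2 * pi * dot x xi) * lincomb F (fun j => f (vadd x (intv j))) (@chr R n) xi.
  rewrite lincombE mulr_sumr; apply: eq_bigr => j _.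
  by rewrite dot_addl mulrDr expiD mulrCA.
by rewrite sqnM sqn_expi mul1r.
Qed.

End fourier.

(** An inequality between squared norms on two different spaces passes to limits. Applied in both
    directions, it extends isometries from dense families. *)
Lemma N2_le_approx (R : realType) d d' (T : measurableType d) (T' : measurableType d')
    (mu : {measure set T -> \bar R}) (mu' : {measure set T' -> \bar R})
    (f : T -> R[i]) (g : T' -> R[i]) : cmeasurable f -> cmeasurable g ->
  (forall eps : R, 0 < eps -> exists f' g', [/\ cmeasurable f', cmeasurable g',
     (N2 mu f' <= N2 mu' g')%E, (N2 mu (fun x => f x - f' x)%R <= eps%:E)%E
     & (N2 mu' (fun x => g x - g' x)%R <= eps%:E)%E]) ->
  (N2 mu f <= N2 mu' g)%E.
Proof.
move=> mf mg H.
have [Ng|Ng] := ltP (N2 mu' g) +oo%E; last by apply: le_trans Ng; exact: leey.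
have Lg : L2 mu' g by exact/L2P.
rewrite (N2rE Lg); set G := N2r mu' g; have G0 : 0 <= G by exact: N2r_ge0.
apply/lee_addgt0Pr => e e0.
(* With (1 + 1/t) eps = t/3, the final estimate is (1 + t) ((1 + t) G + t/3) + t/3. For t <= 1 this
   is at most G + t (3 G + 1), hence the choice of [t]. *)
pose t : R := Num.min 1 (e / (3 * G + 1)).
have D0 : 0 < 3 * G + 1 by lra.
have t0 : 0 < t by rewrite lt_min ltr01 divr_gt0.
have t1 : t <= 1 by rewrite ge_min lexx.
have tG : t * (3 * G + 1) <= e by rewrite -ler_pdivlMr// ge_min lexx orbT.
have V0 : 0 < 1 + t^-1 by rewrite addr_gt0// invr_gt0.
pose eps := t / (3 * (1 + t^-1)).
have eps0 : 0 < eps by rewrite divr_gt0// mulr_gt0.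
have epsE : (1 + t^-1) * eps = t / 3.
  have aux (a v : R) : 0 < v -> v * (a / (3 * v)) = a / 3.
    by move=> v0; field; rewrite lt0r_neq0.
  exact: aux.
have [f' [g' [mf' mg' N1 N2f N2g]]] := H _ eps0.
have E1 : (N2 mu f <= (1 + t)%:E * N2 mu f' + (t / 3)%:E)%E.
  have := N2D_le mu t0 mf' (cmeasurableB mf mf').
  rewrite (_ : (fun x => _) = f); last by apply/funext => x; rewrite addrC subrK.
  move=> h; apply: (le_trans h); apply: leeD => //.
  rewrite -epsE EFinM; apply: lee_wpmul2l => //; rewrite lee_fin; exact: ltW.
have E2 : (N2 mu' g' <= (1 + t)%:E * G%:E + (t / 3)%:E)%E.
  have := N2D_le mu' t0 mg (cmeasurableB mg' mg).
  rewrite (_ : (fun x => _) = g'); last by apply/funext => x; rewrite addrC subrK.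
  move=> h; apply: (le_trans h); rewrite (N2rE Lg); apply: leeD => //.
  rewrite -epsE EFinM; apply: lee_wpmul2l; first by rewrite lee_fin ltW.
  by rewrite N2_sub.
apply: (le_trans E1).
apply: (@le_trans _ _ ((1 + t)%:E * ((1 + t)%:E * G%:E + (t / 3)%:E) + (t / 3)%:E)%E).
  apply: leeD => //; apply: lee_wpmul2l; first by rewrite lee_fin; lra.
  exact: le_trans N1 E2.
change (((1 + t) * ((1 + t) * G + t / 3) + t / 3)%:E <= (G + e)%:E)%E; rewrite lee_fin.
have : t * t * G <= t * G by rewrite ler_wpM2r// ler_piMl// ltW.
have : t * t <= t by rewrite ler_piMl// ltW.
by nra.
Qed.

Section dominated.
Context {R : realType}.

Lemma ccvg_near (u : nat -> R[i]) (l : R[i]) (N : nat) :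
  (forall k, (N <= k)%N -> u k = l) -> ccvg u l.
Proof.
move=> H; split; apply: cvg_near_cst; exists N => // k /= Nk; by rewrite H.
Qed.

Lemma cintegral_dominated d (T : measurableType d) (mu : {measure set T -> \bar R})
    (g_ : nat -> T -> R[i]) (g : T -> R[i]) :
  (forall k, cmeasurable (g_ k)) -> (forall x, ccvg (g_ ^~ x) (g x)) ->
  cintegrable mu g ->
  (forall k x, `|complex.Re (g_ k x)| <= `|complex.Re (g x)|) ->
  (forall k x, `|complex.Im (g_ k x)| <= `|complex.Im (g x)|) ->
  ccvg (fun k => cintegral mu (g_ k)) (cintegral mu g).
Proof.
have D (u_ : nat -> T -> R) (u : T -> R) : (forall k, measurable_fun setT (u_ k)) ->
    (forall x, u_ k x @[k --> \oo] --> u x) ->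
    mu.-integrable setT (EFin \o u) -> (forall k x, `|u_ k x| <= `|u x|) ->
    Rintegral mu setT (u_ k) @[k --> \oo] --> Rintegral mu setT u.
  move=> mu_ u_u iu le; rewrite /Rintegral; apply: fine_cvg.
  rewrite fineK; last exact: integrable_fin_num.
  apply: (@dominated_cvg _ _ _ mu setT measurableT (fun k x => (u_ k x)%:E)
    (fun x => (u x)%:E) (fun x => `|(u x)%:E|%E)) => //.
  - by move=> k; exact/measurable_EFinP.
  - by move=> x _; apply: cvg_EFin; [exact: nearW|exact: u_u].
  - exact: integrable_abse.
  - by move=> k x _; rewrite lee_fin.
move=> mg gcvg [i1 i2] l1 l2; split => /=.
  apply: D => //; first by move=> k; case: (mg k).
  by move=> x; case: (gcvg x).
apply: D => //; first by move=> k; case: (mg k).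
by move=> x; case: (gcvg x).
Qed.

End dominated.

Section plancherel.
Context {R : realType} {n : nat}.
Implicit Types f : Rn R n -> R[i].

(** The lattice points with code below [r]: finite sets that increase to Z^n. *)
Definition zfset (r : nat) : {fset Zn n} :=
  [fset m in pmap (@pickle_inv (n.-tuple int)) (iota 0 r)]%fset.

Lemma mem_zfset (m : Zn n) r : (@choice.pickle (n.-tuple int) m < r)%N -> m \in zfset r.
Proof.
move=> mr; rewrite inE /= mem_pmap; apply/mapP; exists (@choice.pickle (n.-tuple int) m).
  by rewrite mem_iota.
by rewrite pickleK_inv.
Qed.

Definition ztrunc (r : nat) (x : Rn R n) : R[i] := (\1_(zbox (zfset r)) x)%:C.

Lemma cmeasurable_ztrunc r : cmeasurable (ztrunc r).
Proof. by apply: cmeasurable_indic; exact: measurable_zbox. Qed.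

Lemma ztrunc01 r x : ztrunc r x = 0 \/ ztrunc r x = 1.
Proof. by rewrite /ztrunc indicE; case: (_ \in _); [right|left]. Qed.

Lemma ztrunc_supp r x : zfloor x \notin zfset r -> ztrunc r x = 0.
Proof.
move=> xr; rewrite /ztrunc indicE memNset// => /zboxP; by apply/negP.
Qed.

Lemma ztrunc_near x : exists N, forall r, (N <= r)%N -> ztrunc r x = 1.
Proof.
exists (@choice.pickle (n.-tuple int) (zfloor x)).+1 => r Nr.
by rewrite /ztrunc indicE mem_set//; apply/zboxP; exact: mem_zfset.
Qed.

Lemma sqn_ztrunc_le r (z : R[i]) x : sqn (z * ztrunc r x) <= sqn z.
Proof. by case: (ztrunc01 r x) => ->; rewrite ?mulr1// mulr0 sqn0 sqn_ge0. Qed.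

Lemma ccvg_ztrunc (z : R[i]) x : ccvg (fun r => z * ztrunc r x) z.
Proof.
have [N NP] := ztrunc_near x; apply: (@ccvg_near _ _ _ N) => k Nk.
by rewrite NP// mulr1.
Qed.

Lemma four_linear (a : R[i]) f g xi : cintegrable (leb n) f -> cintegrable (leb n) g ->
  four (fun x => a * f x + g x) xi = a * four f xi + four g xi.
Proof.
move=> cf cg; rewrite /four.
have ph h : cintegrable (leb n) h -> cintegrable (leb n) (fun x => h x * expi (2 * pi * dot x xi)).
  move=> ch; apply: cintegrable_mul_le1 => //.
    by apply: cmeasurable_expi; apply: measurable_phase => //; exact: measurable_cst.
  by move=> x; rewrite sqn_expi.
rewrite -cintegralZ; last exact: ph.
rewrite -cintegralD; [|by apply: cintegrableZ; exact: ph|exact: ph].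
by apply: eq_cintegral => x; rewrite mulrDl mulrA.
Qed.

(** Truncation to finitely many cells. The transforms of the truncations converge pointwise by
    dominated convergence, so Fatou gives one inequality; applied to the difference between [f] and
    a truncation, this inequality controls the error in the other one. *)
Lemma plancherel f : cintegrable (leb n) f -> L2 (leb n) f ->
  N2 (leb n) (four f) = N2 (leb n) f.
Proof.
pose tr (f : Rn R n -> R[i]) r x := f x * ztrunc r x.
have mtr (g : Rn R n -> R[i]) r : cmeasurable g -> cmeasurable (tr g r).
  by move=> mg; apply: cmeasurableM => //; exact: cmeasurable_ztrunc.
have Ltr (g : Rn R n -> R[i]) r : L2 (leb n) g -> L2 (leb n) (tr g r).
  move=> Lg; apply: (L2_le _ Lg); first exact/mtr/L2_cmeasurable/Lg.
  by move=> x; exact: sqn_ztrunc_le.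
have Ctr (g : Rn R n -> R[i]) r : cintegrable (leb n) g -> cintegrable (leb n) (tr g r).
  move=> cg; apply: cintegrable_mul_le1 => //; first exact: cmeasurable_ztrunc.
  by move=> x; exact: sqn_indic_le1.
have Ptr (g : Rn R n -> R[i]) r : L2 (leb n) g -> N2 (leb n) (four (tr g r)) = N2 (leb n) (tr g r).
  move=> Lg; apply: (@plancherel_supp _ _ _ (zfset r)); first exact: Ltr.
  by move=> x xr; rewrite /tr ztrunc_supp// mulr0.
have le (g : Rn R n -> R[i]) : cintegrable (leb n) g -> L2 (leb n) g -> (N2 (leb n) (four g) <= N2 (leb n) g)%E.
  move=> cg Lg; have mg := L2_cmeasurable Lg.
  apply: (@N2_fatou _ _ R (leb n) (fun r => four (tr g r)) _ _ 0).
  - by move=> k; apply: cmeasurable_four; exact: mtr.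
  - exact: cmeasurable_four.
  - apply: aeW => xi; rewrite /four.
    apply: cintegral_dominated.
    + move=> k; apply: cmeasurable_mul_expi; first exact: mtr.
      by apply: measurable_phase => //; exact: measurable_cst.
    + by move=> x; apply: ccvgM; [exact: ccvg_ztrunc|exact: ccvg_cst].
    + apply: cintegrable_mul_le1 => //.
        by apply: cmeasurable_expi; apply: measurable_phase => //; exact: measurable_cst.
      by move=> x; rewrite sqn_expi.
    + by move=> k x; rewrite /tr; case: (ztrunc01 k x) => ->;
        rewrite ?mulr1// mulr0 mul0r normr0.
    + by move=> k x; rewrite /tr; case: (ztrunc01 k x) => ->;
        rewrite ?mulr1// mulr0 mul0r normr0.
  - move=> k _; rewrite Ptr//; apply: N2_le => //; first exact: mtr.
    by move=> x; exact: sqn_ztrunc_le.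
move=> cf Lf; have mf := L2_cmeasurable Lf; apply/eqP; rewrite eq_le le//=.
apply: N2_le_approx => //; first exact: cmeasurable_four.
move=> eps eps0.
have [|||K KP] := @N2_dominated _ _ _ (leb n) (tr f) f (fun x => sqn (f x)) _ mf _
    (integrable_sqn Lf) _ _ eps0.
- by move=> k; exact: mtr.
- by apply: aeW => x; exact: ccvg_ztrunc.
- move=> k x; rewrite /tr; case: (ztrunc01 k x) => ->; first by rewrite mulr0 sub0r sqnN.
  by rewrite mulr1 subrr sqn0 sqn_ge0.
have KN : (N2 (leb n) (fun x => f x - tr f K x)%R <= eps%:E)%E by rewrite N2_sub; exact: KP.
exists (tr f K), (four (tr f K)); split => //.
- exact: mtr.
- exact/cmeasurable_four/mtr.
- by rewrite Ptr.
rewrite (_ : (fun x => _) = four (fun x => -1 * tr f K x + f x)); last first.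
  apply/funext => xi; rewrite four_linear//; last exact: Ctr.
  by rewrite mulN1r addrC.
rewrite (_ : (fun x => -1 * _ + _) = fun x => f x - tr f K x); last first.
  by apply/funext => x; rewrite mulN1r addrC.
apply: le_trans KN; apply: le; last by apply: L2B => //; exact: Ltr.
rewrite (_ : (fun x => _) = (fun x => -1 * tr f K x + f x)); last first.
  by apply/funext => x; rewrite mulN1r addrC.
by apply: cintegrableD => //; apply: cintegrableZ; exact: Ctr.
Qed.

End plancherel.

(** * The kernel of the Weyl transform *)

Section weyl_integral.
Context {R : realType} {n : nat}.
Implicit Types phi psi K : Rn R n * Rn R n -> R[i].

(* In the coordinates (xi, eta - xi), passing to the Weyl kernel is a Fourier
   transform in the first variable. *)
Lemma weyl_four phi xi y : weyl_kernel_int phi (xi, vadd y xi) =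
  four (fun x => phi (x, y) * expi (pi * dot x y)) xi.
Proof.
apply: eq_cintegral => x /=; rewrite vaddK -mulrA -expiD; congr (_ * expi _).
by rewrite !dot_addr; ring.
Qed.

Lemma cmeasurable_weyl phi : cmeasurable phi -> cmeasurable (weyl_kernel_int phi).
Proof.
move=> mphi.
pose h (q : (Rn R n * Rn R n) * Rn R n) :=
  phi (q.2, vsub q.1.2 q.1.1) * expi (pi * dot q.2 (vadd q.1.1 q.1.2)).
apply: (@cmeasurable_cintegral_param _ _ _ _ _ (leb n) h).
have m11 : measurable_fun setT (fun q : (Rn R n * Rn R n) * Rn R n => q.1.1).
  exact: measurableT_comp measurable_fst measurable_fst.
have m12 : measurable_fun setT (fun q : (Rn R n * Rn R n) * Rn R n => q.1.2).
  exact: measurableT_comp measurable_snd measurable_fst.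
apply: cmeasurable_mul_expi.
  apply: (cmeasurable_comp _ mphi); apply: measurable_fun_pair => //.
  exact: measurable_vsub.
by apply: measurable_phase => //; exact: measurable_vadd.
Qed.

Lemma N2_prodm_swap d1 d2 (T1 : measurableType d1) (T2 : measurableType d2)
    (m1 : {sigma_finite_measure set T1 -> \bar R})
    (m2 : {sigma_finite_measure set T2 -> \bar R}) (f : T1 * T2 -> R[i]) :
  cmeasurable f -> N2 (prodm m1 m2) f = (\int[m2]_y N2 m1 (fun x => f (x, y)))%E.
Proof.
move=> mf; rewrite /N2 ge0_integral_prodm_swap//; first exact: emeasurable_sqn.
by move=> x; rewrite lee_fin sqn_ge0.
Qed.

Lemma N2_prodm d1 d2 (T1 : measurableType d1) (T2 : measurableType d2)
    (m1 : {sigma_finite_measure set T1 -> \bar R})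
    (m2 : {sigma_finite_measure set T2 -> \bar R}) (f : T1 * T2 -> R[i]) :
  cmeasurable f -> N2 (prodm m1 m2) f = (\int[m1]_x N2 m2 (fun y => f (x, y)))%E.
Proof.
move=> mf; rewrite /N2 ge0_integral_prodm//; first exact: emeasurable_sqn.
by move=> x; rewrite lee_fin sqn_ge0.
Qed.

Lemma measurable_N2_section d1 d2 (T1 : measurableType d1) (T2 : measurableType d2)
    (m2 : {sigma_finite_measure set T2 -> \bar R}) (f : T1 * T2 -> R[i]) :
  cmeasurable f -> measurable_fun setT (fun x => N2 m2 (fun y => f (x, y))).
Proof.
move=> mf.
apply: (@measurable_fun_fubini_tonelli_F _ _ _ _ _ _ (fun p => (sqn (f p))%:E)).
  exact: emeasurable_sqn.
by move=> x; rewrite lee_fin sqn_ge0.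
Qed.

Lemma measurable_N2_section_swap d1 d2 (T1 : measurableType d1) (T2 : measurableType d2)
    (m1 : {sigma_finite_measure set T1 -> \bar R}) (f : T1 * T2 -> R[i]) :
  cmeasurable f -> measurable_fun setT (fun y => N2 m1 (fun x => f (x, y))).
Proof.
move=> mf.
apply: (@measurable_fun_fubini_tonelli_G _ _ _ _ _ _ (fun p => (sqn (f p))%:E)).
  exact: emeasurable_sqn.
by move=> x; rewrite lee_fin sqn_ge0.
Qed.

Lemma cmeasurable_shear K : cmeasurable K ->
  cmeasurable (fun p : Rn R n * Rn R n => K (p.1, vadd p.2 p.1)).
Proof.
move=> mK; apply: (cmeasurable_comp _ mK); apply: measurable_fun_pair => //.
exact: measurable_vadd.
Qed.

(** For fixed [xi], translation invariance in the second variable, between two applications of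
    Tonelli. *)
Lemma N2_shear K : cmeasurable K ->
  N2 (leb2 n) K = (\int[leb n]_y N2 (leb n) (fun xi => K (xi, vadd y xi)))%E.
Proof.
move=> mK; have mS := cmeasurable_shear mK.
apply: etrans (N2_prodm_swap (leb n) (leb n) mS).
apply: etrans (N2_prodm (leb n) (leb n) mK) _.
apply: etrans (esym (N2_prodm (leb n) (leb n) mS)).
apply: eq_integral => xi _; apply/esym.
apply: (@N2_leb_vadd R n xi (fun y => K (xi, y))).
by apply: (cmeasurable_comp _ mK); exact: measurable_pair1.
Qed.

Lemma N2_shear_eq0 K : cmeasurable K ->
  (\forall y \ae leb n, forall xi, K (xi, vadd y xi) = 0) -> N2 (leb2 n) K = 0%E.
Proof.
move=> mK K0; rewrite N2_shear//.
transitivity (\int[leb n]_y cst (0%E : \bar R) y)%E; last by rewrite integral0.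
apply: ae_eq_integral => //.
- exact: (measurable_N2_section_swap (leb n) (cmeasurable_shear mK)).
- apply: filterS K0 => y y0 _; rewrite -(N2_0 (leb n)).
  by apply: eq_N2 => x; rewrite y0.
Qed.

(** The preimage of a null set under (xi, eta) -> eta - xi is null: the shear formula computes the
    squared norm of its indicator. *)
Lemma ae_shear (P : Rn R n -> Prop) : (\forall y \ae leb n, P y) ->
  \forall p \ae leb2 n, P (vsub p.2 p.1).
Proof.
move=> [A [mA A0 PA]].
have mI : cmeasurable (fun y : Rn R n => (\1_A y)%:C : R[i]) by exact: cmeasurable_indic.
have mJ : cmeasurable (fun p : Rn R n * Rn R n => (\1_A (vsub p.2 p.1))%:C : R[i]).
  by apply: (cmeasurable_comp _ mI); exact: measurable_vsub.
suff : N2 (leb2 n) (fun p : Rn R n * Rn R n => (\1_A (vsub p.2 p.1))%:C : R[i]) = 0%E.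
  move=> /(N2_eq0 mJ); apply: filterS => p /(_ I); rewrite indicE => pA.
  apply: contrapT => nP; move: pA; rewrite mem_set; last exact: PA.
  by move=> [] /eqP; rewrite oner_eq0.
apply: N2_shear_eq0 => //; exists A; split=> // y /= Hy.
apply: contrapT => nA; apply: Hy => xi; rewrite vaddK indicE memNset//.
Qed.

Lemma ae_section_cintegrable phi : cintegrable (leb2 n) phi ->
  \forall y \ae leb n, cintegrable (leb n) (fun x => phi (x, y)).
Proof.
by move=> [/ae_integrable2 i1 /ae_integrable2 i2]; apply: filterS2 i1 i2.
Qed.

Lemma ae_section_L2 phi : L2 (leb2 n) phi ->
  \forall y \ae leb n, L2 (leb n) (fun x => phi (x, y)).
Proof.
move=> Lphi; have mphi := L2_cmeasurable Lphi.
have := ae_integrable2 (integrable_sqn Lphi); apply: filterS => y /integrableP[_].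
under eq_integral do rewrite gee0_abs ?lee_fin ?sqn_ge0//.
move=> h; apply/L2P; split=> //.
by apply: (cmeasurable_comp _ mphi); exact: measurable_pair2.
Qed.

Lemma ae_weyl_integrable phi : cintegrable (leb2 n) phi ->
  \forall p \ae leb2 n, cintegrable (leb n)
    (fun x => phi (x, vsub p.2 p.1) * expi (pi * dot x (vadd p.1 p.2))).
Proof.
move=> /ae_section_cintegrable/ae_shear; apply: filterS => p ip.
apply: cintegrable_mul_le1 => //; last by move=> x; rewrite sqn_expi.
by apply: cmeasurable_expi; apply: measurable_phase => //; exact: measurable_cst.
Qed.

(** Additivity of [cintegral] rests on integrability, which Fubini provides only for almost every
    section; hence an equality almost everywhere. *)
Lemma weyl_int_linear (a : R[i]) phi psi :
  cintegrable (leb2 n) phi -> cintegrable (leb2 n) psi ->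
  weyl_kernel_int (fun p => a * phi p + psi p) =
  (fun p => a * weyl_kernel_int phi p + weyl_kernel_int psi p) %[ae leb2 n].
Proof.
move=> /ae_weyl_integrable i1 /ae_weyl_integrable i2.
apply: filterS2 i1 i2 => p p1 p2 _ /=.
rewrite /weyl_kernel_int -cintegralZ// -cintegralD//; last exact: cintegrableZ.
by apply: eq_cintegral => x; rewrite mulrDl mulrA.
Qed.

Lemma weyl_int_isometry phi : cintegrable (leb2 n) phi -> L2 (leb2 n) phi ->
  N2 (leb2 n) (weyl_kernel_int phi) = N2 (leb2 n) phi.
Proof.
move=> cphi Lphi; have mphi := L2_cmeasurable Lphi.
have mW := cmeasurable_weyl mphi.
rewrite N2_shear//; apply: etrans (esym (N2_prodm_swap (leb n) (leb n) mphi)).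
apply: ae_eq_integral => //.
- exact: (measurable_N2_section_swap (leb n) (cmeasurable_shear mW)).
- exact: (measurable_N2_section_swap (leb n) mphi).
apply: filterS2 (ae_section_cintegrable cphi) (ae_section_L2 Lphi) => y cy Ly _.
rewrite (_ : (fun xi => _) = four (fun x => phi (x, y) * expi (pi * dot x y))); last first.
  by apply/funext => xi; exact: weyl_four.
have mp : measurable_fun setT (fun x : Rn R n => pi * dot x y).
  by apply: measurable_phase => //; exact: measurable_cst.
rewrite plancherel.
- by apply: eq_N2 => x; rewrite sqnM sqn_expi mulr1.
- apply: cintegrable_mul_le1 => //; first exact: cmeasurable_expi.
  by move=> x; rewrite sqn_expi.
- exact: L2_mul_expi.
Qed.

End weyl_integral.

Lemma L2norm_cvg0 d (T : measurableType d) (R : realType)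
    (mu : {measure set T -> \bar R}) (u : nat -> T -> R[i]) :
  L2norm mu (u j) @[j --> \oo] --> 0%E <->
  forall eps : R, 0 < eps -> exists K, forall k, (K <= k)%N -> (N2 mu (u k) <= eps%:E)%E.
Proof.
rewrite cvge0P; last by move=> k; exact: Lnorm_ge0.
split=> H eps eps0.
  have s0 : 0 < Num.sqrt eps by rewrite sqrtr_gt0.
  have [K KP] := H _ (divr_gt0 s0 (ltr0Sn _ 1)).
  exists K => k /KP h; rewrite -(sqr_sqrtr (ltW eps0)); apply: ltW; rewrite -L2norm_lt//.
  apply: (le_lt_trans h); rewrite lte_fin ltr_pdivrMr// mulrDr mulr1; lra.
have e0 : 0 < (eps / 2) ^+ 2 by rewrite exprn_gt0// divr_gt0.
have [K KP] := H _ e0; exists K => k /KP h; apply: ltW; rewrite L2norm_lt//.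
apply: (le_lt_trans h); rewrite lte_fin; nra.
Qed.

Section shift.
Context {R : realType} {n : nat}.
Implicit Types phi psi K : Rn R n * Rn R n -> R[i].

Lemma vsub_intv (x : Rn R n) (k : Zn n) : vsub x (intv k) = vadd x (intv (zopp k)).
Proof.
by apply: eq_from_tnth => i; rewrite !tnth_mktuple /rcoord !tnth_mktuple mulrNz.
Qed.

Lemma ge0_integral_leb2_vadd (u v : Rn R n) (f : Rn R n * Rn R n -> \bar R) :
  measurable_fun setT f -> (forall p, 0 <= f p)%E ->
  (\int[leb2 n]_p f (vadd p.1 u, vadd p.2 v) = \int[leb2 n]_p f p)%E.
Proof.
move=> mf f0.
have ms : measurable_fun setT (fun p : Rn R n * Rn R n => f (vadd p.1 u, vadd p.2 v)).
  apply: (measurableT_comp mf); apply: measurable_fun_pair;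
    by apply: measurable_vadd => //; exact: measurable_cst.
apply: etrans (ge0_integral_prodm (leb n) (leb n) ms _) _ => //.
apply: etrans (esym (ge0_integral_prodm (leb n) (leb n) mf f0)).
transitivity (\int[leb n]_x \int[leb n]_y f (vadd x u, y))%E.
  apply: eq_integral => x _.
  apply: (@ge0_integral_leb_vadd R n v (fun y => f (vadd x u, y))) => //.
  by apply: (measurableT_comp mf); exact: measurable_pair1.
apply: (@ge0_integral_leb_vadd R n u (fun x => \int[leb n]_y f (x, y))%E).
  exact: measurable_fun_fubini_tonelli_F.
by move=> x; apply: integral_ge0.
Qed.

Lemma cmeasurable_leb2_vadd (u v : Rn R n) phi : cmeasurable phi ->
  cmeasurable (fun p => phi (vadd p.1 u, vadd p.2 v)).
Proof.
move=> mphi; apply: (cmeasurable_comp _ mphi); apply: measurable_fun_pair;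
  by apply: measurable_vadd => //; exact: measurable_cst.
Qed.

Lemma N2_leb2_vadd (u v : Rn R n) phi : cmeasurable phi ->
  N2 (leb2 n) (fun p => phi (vadd p.1 u, vadd p.2 v)) = N2 (leb2 n) phi.
Proof.
move=> mphi; apply: (@ge0_integral_leb2_vadd u v (fun p => (sqn (phi p))%:E)).
  exact: emeasurable_sqn.
by move=> p; rewrite lee_fin sqn_ge0.
Qed.

Lemma twistedE (kl : Zn n * Zn n) phi p : twisted_translation kl phi p =
  expi (pi * (dot p.1 (intv kl.2) - dot p.2 (intv kl.1))) *
  phi (vadd p.1 (intv (zopp kl.1)), vadd p.2 (intv (zopp kl.2))).
Proof. by rewrite /twisted_translation !vsub_intv. Qed.

Lemma cmeasurable_twisted kl phi : cmeasurable phi -> cmeasurable (twisted_translation kl phi).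
Proof.
move=> mphi; rewrite (_ : twisted_translation kl phi = fun p => twisted_translation kl phi p)//.
under eq_fun do rewrite twistedE.
apply: cmeasurableM; last exact: cmeasurable_leb2_vadd.
apply: cmeasurable_expi; apply: measurable_funM => //; apply: measurable_funB;
  apply: measurable_dot => //; exact: measurable_cst.
Qed.

Lemma N2_twisted kl phi : cmeasurable phi ->
  N2 (leb2 n) (twisted_translation kl phi) = N2 (leb2 n) phi.
Proof.
move=> mphi; rewrite -[RHS](N2_leb2_vadd (intv (zopp kl.1)) (intv (zopp kl.2)))//.
by apply: eq_N2 => p; rewrite twistedE sqnM sqn_expi mul1r.
Qed.

Lemma L2_twisted kl phi : L2 (leb2 n) phi -> L2 (leb2 n) (twisted_translation kl phi).
Proof.
move=> /L2P[mphi Nphi]; apply/L2P; rewrite N2_twisted//; split=> //.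
exact: cmeasurable_twisted.
Qed.

Lemma Lp1_twisted kl phi : Lp (leb2 n) 1%:E phi -> Lp (leb2 n) 1%:E (twisted_translation kl phi).
Proof.
move=> Lphi; have mphi : cmeasurable phi by case: Lphi.
split; first exact: cmeasurable_twisted.
case: Lphi => _; rewrite /cnorm !Lnorm1.
have E (f : Rn R n * Rn R n -> R[i]) : (\int[leb2 n]_x `|(modulus (f x))%:E|)%E =
    (\int[leb2 n]_x (modulus (f x))%:E)%E.
  by apply: eq_integral => x _; rewrite gee0_abs// lee_fin modulus_ge0.
rewrite !E; congr (_ < _)%E; apply/esym.
rewrite -(@ge0_integral_leb2_vadd (intv (zopp kl.1)) (intv (zopp kl.2))
  (fun p => (modulus (phi p))%:E)).
- by apply: eq_integral => p _; rewrite !modulusE twistedE sqnM sqn_expi mul1r.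
- exact/measurable_EFinP/measurable_modulus.
- by move=> p; rewrite lee_fin modulus_ge0.
Qed.

Lemma twisted_linear kl (a : R[i]) phi psi :
  twisted_translation kl (fun p => a * phi p + psi p) =
  fun p => a * twisted_translation kl phi p + twisted_translation kl psi p.
Proof. by apply/funext => p; rewrite /twisted_translation mulrDr mulrCA. Qed.

End shift.

Section weyl_kernel.
Context {R : realType} {n : nat}.
Implicit Types phi psi K L : Rn R n * Rn R n -> R[i].

Let sub_linear (T : Type) (f g : T -> R[i]) : (fun x => f x - g x) = (fun x => -1 * g x + f x).
Proof. by apply/funext => x; rewrite mulN1r addrC. Qed.

Lemma N2_weyl_sub phi psi :
  cintegrable (leb2 n) phi -> L2 (leb2 n) phi ->
  cintegrable (leb2 n) psi -> L2 (leb2 n) psi ->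
  N2 (leb2 n) (fun p => weyl_kernel_int phi p - weyl_kernel_int psi p) =
  N2 (leb2 n) (fun p => phi p - psi p).
Proof.
move=> c1 L1 c2 L2'; rewrite [in RHS]sub_linear.
rewrite -[RHS]weyl_int_isometry; last 2 first.
- by apply: cintegrableD => //; exact: cintegrableZ.
- by rewrite -sub_linear; exact: L2B.
have m1 := L2_cmeasurable L1; have m2 := L2_cmeasurable L2'.
apply: ae_N2.
- by apply: cmeasurableB; exact: cmeasurable_weyl.
- by apply: cmeasurable_weyl; rewrite -sub_linear; exact: cmeasurableB.
have := weyl_int_linear (-1) c2 c1; apply: filterS => p /(_ I) pE _; rewrite pE//.
by rewrite mulN1r addrC.
Qed.

Lemma L2_weyl_kernel_int phi : cintegrable (leb2 n) phi -> L2 (leb2 n) phi ->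
  L2 (leb2 n) (weyl_kernel_int phi).
Proof.
move=> c1 L1; apply/L2P; rewrite weyl_int_isometry//; split.
  exact/cmeasurable_weyl/L2_cmeasurable/L1.
by have /L2P[] := L1.
Qed.

(** The truncations of [phi] to products of bounded boxes are in L^1, as L^2 functions carried by
    sets of finite measure, and tend to [phi] in L^2. The isometry makes their kernels a Cauchy
    sequence. *)
Lemma weyl_kernel_exists phi : L2 (leb2 n) phi -> exists K, is_weyl_kernel phi K.
Proof.
move=> Lphi; have mphi := L2_cmeasurable Lphi.
pose tr r (p : Rn R n * Rn R n) : R[i] := ztrunc r p.1 * ztrunc r p.2.
have mtr r : cmeasurable (tr r).
  by apply: cmeasurableM; [apply: (cmeasurable_comp measurable_fst)|
    apply: (cmeasurable_comp measurable_snd)]; exact: cmeasurable_ztrunc.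
have tr01 r p : tr r p = 0 \/ tr r p = 1.
  rewrite /tr; case: (ztrunc01 r p.1) => ->; first by left; rewrite mul0r.
  by rewrite mul1r; exact: ztrunc01.
pose phi_ r p := phi p * tr r p.
have mphi_ r : cmeasurable (phi_ r) by exact: cmeasurableM.
have Lphi_ r : L2 (leb2 n) (phi_ r).
  apply: (L2_le _ Lphi) => // p; rewrite /phi_.
  by case: (tr01 r p) => ->; rewrite ?mulr1// mulr0 sqn0 sqn_ge0.
have cphi_ r : cintegrable (leb2 n) (phi_ r).
  apply: (@L2_supp_cintegrable _ _ _ _ _ (zbox (zfset r) `*` zbox (zfset r))) => //.
  - by apply: measurableX; exact: measurable_zbox.
  - have mb := @measurable_zbox R n (zfset r).
    suff : (leb n (zbox (zfset r)) * leb n (zbox (zfset r)) < +oo :> \bar R)%E.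
      by rewrite -(product_measure1E (leb n) (leb n) mb mb).
    by rewrite lte_mul_pinfty// ?ge0_fin_numE//; exact: leb_zbox_fin.
  - move=> p np; rewrite /phi_; case: (tr01 r p) => e; first by rewrite e mulr0.
    exfalso; apply: np; split; apply: contrapT => np;
      move: e; rewrite /tr /ztrunc !indicE (memNset np) ?mul0r ?mulr0 => -[] /eqP;
      by rewrite eq_sym oner_eq0.
have H : forall eps : R, 0 < eps -> exists N : nat, forall k, (N <= k)%N ->
    (N2 (leb2 n) (fun p => phi_ k p - phi p)%R <= eps%:E)%E.
  apply: (@N2_dominated _ _ _ _ _ _ (fun x => sqn (phi x))) => //.
  - apply: aeW => p; have [N1 N1P] := ztrunc_near p.1; have [N2 N2P] := ztrunc_near p.2.
    apply: (@ccvg_near _ _ _ (maxn N1 N2)) => k; rewrite geq_max => /andP[k1 k2].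
    by rewrite /phi_ /tr N1P// N2P// !mulr1.
  - exact: integrable_sqn.
  - move=> k p; rewrite /phi_; case: (tr01 k p) => ->.
      by rewrite mulr0 sub0r sqnN.
    by rewrite mulr1 subrr sqn0 sqn_ge0.
have LW r : L2 (leb2 n) (weyl_kernel_int (phi_ r)) by exact: L2_weyl_kernel_int.
have [|K [LK HK _]] := L2_complete LW.
  move=> eps /(N2_cauchy mphi_ mphi H)[N NP]; exists N => j k Nj Nk.
  by rewrite N2_weyl_sub//; exact: NP.
exists K; split=> //; exists phi_; split.
- by move=> j; split=> //; exact/Lp1_cintegrable.
- exact/L2norm_cvg0.
- exact/L2norm_cvg0.
Qed.

Lemma weyl_kernel_isometry phi K : L2 (leb2 n) phi -> is_weyl_kernel phi K ->
  N2 (leb2 n) K = N2 (leb2 n) phi.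
Proof.
move=> Lphi [LK [phi_ [Lphi_ /L2norm_cvg0 H1 /L2norm_cvg0 H2]]].
have mphi := L2_cmeasurable Lphi; have mK := L2_cmeasurable LK.
have Hb (eps : R) : 0 < eps -> exists j,
    [/\ (N2 (leb2 n) (fun p => phi p - phi_ j p)%R <= eps%:E)%E
      & (N2 (leb2 n) (fun p => K p - weyl_kernel_int (phi_ j) p)%R <= eps%:E)%E].
  move=> eps0; have [N1 N1P] := H1 _ eps0; have [N2' N2P] := H2 _ eps0.
  by exists (maxn N1 N2'); rewrite !(N2_sub _ phi) (N2_sub _ K); split;
    [apply: N1P; exact: leq_maxl|apply: N2P; exact: leq_maxr].
have I j : N2 (leb2 n) (weyl_kernel_int (phi_ j)) = N2 (leb2 n) (phi_ j).
  by have [/Lp1_cintegrable c1 L1] := Lphi_ j; exact: weyl_int_isometry.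
have m_ j : cmeasurable (phi_ j) by have [_ /L2_cmeasurable] := Lphi_ j.
apply/eqP; rewrite eq_le; apply/andP; split; apply: N2_le_approx => // eps /Hb[j [h1 h2]].
  by exists (weyl_kernel_int (phi_ j)), (phi_ j); split=> //; [exact: cmeasurable_weyl|rewrite I].
by exists (phi_ j), (weyl_kernel_int (phi_ j)); split=> //; [exact: cmeasurable_weyl|rewrite I].
Qed.

Lemma N2_linear_cvg d (T : measurableType d) (mu : {measure set T -> \bar R}) (a : R[i])
    (f_ g_ : nat -> T -> R[i]) (f g : T -> R[i]) :
  (forall k, cmeasurable (f_ k)) -> (forall k, cmeasurable (g_ k)) ->
  cmeasurable f -> cmeasurable g ->
  L2norm mu (fun x => f_ j x - f x) @[j --> \oo] --> 0%E ->
  L2norm mu (fun x => g_ j x - g x) @[j --> \oo] --> 0%E ->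
  L2norm mu (fun x => a * f_ j x + g_ j x - (a * f x + g x)) @[j --> \oo] --> 0%E.
Proof.
move=> mf_ mg_ mf mg /L2norm_cvg0 Hf /L2norm_cvg0 Hg; apply/L2norm_cvg0 => eps eps0.
have [|N1 N1P] := Hf (eps / (4 * (1 + sqn a))).
  by have := sqn_ge0 a => a0; rewrite divr_gt0// mulr_gt0//; lra.
have [N2' N2P] := Hg _ (divr_gt0 eps0 (ltr0Sn R 3)).
exists (maxn N1 N2') => k; rewrite geq_max => /andP[k1 k2].
by apply: N2_linear_small => //; [exact: N1P|exact: N2P].
Qed.

Lemma weyl_kernel_linear (a : R[i]) phi psi K L : L2 (leb2 n) phi -> L2 (leb2 n) psi ->
  is_weyl_kernel phi K -> is_weyl_kernel psi L ->
  is_weyl_kernel (fun p => a * phi p + psi p) (fun p => a * K p + L p).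
Proof.
move=> Lphi Lpsi [LK [phi_ [Lphi_ H1 H2]]] [LL [psi_ [Lpsi_ H3 H4]]].
split; first by apply: L2D => //; exact: L2Z.
have m1 j : cmeasurable (phi_ j) by have [_ /L2_cmeasurable] := Lphi_ j.
have m2 j : cmeasurable (psi_ j) by have [_ /L2_cmeasurable] := Lpsi_ j.
have W j := cmeasurable_weyl (m1 j); have W' j := cmeasurable_weyl (m2 j).
have ML (f g : Rn R n * Rn R n -> R[i]) : cmeasurable f -> cmeasurable g ->
    cmeasurable (fun p => a * f p + g p).
  by move=> mf mg; apply: cmeasurableD => //; apply: cmeasurableM => //; exact: cmeasurable_cst.
exists (fun j p => a * phi_ j p + psi_ j p); split.
- move=> j; have [/Lp1_cintegrable c1 L1] := Lphi_ j.
  have [/Lp1_cintegrable c2 L2'] := Lpsi_ j; split.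
    by apply/Lp1_cintegrable; apply: cintegrableD => //; exact: cintegrableZ.
  by apply: L2D => //; exact: L2Z.
- by apply: N2_linear_cvg => //; apply: L2_cmeasurable; eassumption.
- have := N2_linear_cvg a W W' (L2_cmeasurable LK) (L2_cmeasurable LL) H2 H4.
  rewrite [X in X @ _ --> _ -> _](_ : _ = fun j => L2norm (leb2 n) (fun p =>
    weyl_kernel_int (fun p => a * phi_ j p + psi_ j p) p - (a * K p + L p)))//.
  apply/funext => k; rewrite !L2normE; congr poweR.
  have [/Lp1_cintegrable c1 _] := Lphi_ k; have [/Lp1_cintegrable c2 _] := Lpsi_ k.
  have [mK mL] := (L2_cmeasurable LK, L2_cmeasurable LL).
  apply: ae_N2.
  + by apply: cmeasurableB; exact: ML.
  + by apply: cmeasurableB; [exact/cmeasurable_weyl/ML|exact: ML].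
  + by have := weyl_int_linear a c1 c2; apply: filterS => p /(_ I) pE _; rewrite pE.
Qed.

(** The translation by [k] in the integration variable is undone by a substitution and leaves a
    character in [xi]. The translation by [l] acts on the difference eta - xi, that is, as a shift
    of [xi]. *)
Lemma weyl_int_twisted (kl : Zn n * Zn n) phi : cintegrable (leb2 n) phi ->
  weyl_kernel_int (twisted_translation kl phi) = (fun p =>
    expi (pi * dot (intv kl.1) (intv kl.2)) * chr kl.1 p.1 *
    weyl_kernel_int phi (vadd p.1 (intv kl.2), p.2)) %[ae leb2 n].
Proof.
move=> cphi; have mphi : cmeasurable phi by have [] := (Lp1_cintegrable (leb2 n) phi).2 cphi.
have : cintegrable (leb2 n) (twisted_translation kl phi).
  by apply/Lp1_cintegrable/Lp1_twisted/Lp1_cintegrable.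
move=> /ae_weyl_integrable; apply: filterS => -[xi eta] ci _ /=.
case: kl ci => k l ci /=.
set c := expi _ * chr _ _.
(* The unimodular constant is moved to the side of the translated function, whose integrand is the
   one known to be integrable from [ci]; [cintegralZ] applies there. *)
have c1 : c^* * c = 1.
  rewrite mulrC mulc_conj /c sqnM sqn_expi sqn_chr mulr1//.
rewrite -[LHS]mul1r -c1 [X in X * _]mulrC -mulrA; congr (_ * _).
rewrite /weyl_kernel_int -cintegralZ//=.
set g := fun x => phi (x, vsub eta (vadd xi (intv l))) * expi (pi * dot x (vadd (vadd xi (intv l)) eta)).
have mg : cmeasurable g.
  apply: cmeasurable_mul_expi; first by apply: (cmeasurable_comp _ mphi); exact: measurable_pair2.
  by apply: measurable_phase => //; exact: measurable_cst.
rewrite -(cintegral_leb_vadd (intv (zopp k)) mg).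
apply: eq_cintegral => x; rewrite /g -vsub_intv /twisted_translation /=.
have -> : vsub (vsub eta xi) (intv l) = vsub eta (vadd xi (intv l)).
  apply: eq_from_tnth => i; rewrite !tnth_mktuple /rcoord !tnth_mktuple.
  by rewrite opprD addrA /rcoord tnth_mktuple.
rewrite mulrCA -!mulrA mulrCA; congr (_ * _).
have -> : (c^*)%R = expi (- (pi * dot (intv k) (intv l)) - 2 * pi * dot (intv k) xi).
  by rewrite /c rmorphM /= -!expiN -expiD.
rewrite -!expiD; congr expi.
rewrite !(dot_addr, dot_subl) (dotC eta) (dotC xi (intv k)); ring.
Qed.

Lemma weyl_kernel_twisted (kl : Zn n * Zn n) phi K : L2 (leb2 n) phi ->
  is_weyl_kernel phi K ->
  is_weyl_kernel (twisted_translation kl phi) (fun p =>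
    expi (pi * dot (intv kl.1) (intv kl.2)) * chr kl.1 p.1 * K (vadd p.1 (intv kl.2), p.2)).
Proof.
move=> Lphi [LK [phi_ [Lphi_ /L2norm_cvg0 H1 /L2norm_cvg0 H2]]].
have mphi := L2_cmeasurable Lphi; have mK := L2_cmeasurable LK.
have m_ j : cmeasurable (phi_ j) by have [_ /L2_cmeasurable] := Lphi_ j.
(* The action of the twisted translation on kernels. It is linear and isometric, so it carries the
   approximating kernels of [phi] to those of the translate. *)
pose S (G : Rn R n * Rn R n -> R[i]) (p : Rn R n * Rn R n) :=
  expi (pi * dot (intv kl.1) (intv kl.2)) * chr kl.1 p.1 * G (vadd p.1 (intv kl.2), p.2).
have mS0 (G : Rn R n * Rn R n -> R[i]) : cmeasurable G -> cmeasurable (fun p => G (vadd p.1 (intv kl.2), p.2)).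
  move=> mG; apply: (cmeasurable_comp _ mG); apply: measurable_fun_pair => //.
  by apply: measurable_vadd => //; exact: measurable_cst.
have mS (G : Rn R n * Rn R n -> R[i]) : cmeasurable G -> cmeasurable (S G).
  move=> mG; apply: cmeasurableM; last exact: mS0.
  apply: cmeasurableM; first exact: cmeasurable_cst.
  exact: (cmeasurable_comp measurable_fst (cmeasurable_chr kl.1)).
have NS (G : Rn R n * Rn R n -> R[i]) : cmeasurable G -> N2 (leb2 n) (S G) = N2 (leb2 n) G.
  move=> mG; rewrite -[RHS](N2_leb2_vadd (intv kl.2) (intv (zzero n)))//.
  apply: eq_N2 => p; rewrite /S !sqnM sqn_expi sqn_chr !mul1r; congr (sqn (G (_, _))).
  by apply: eq_from_tnth => i; rewrite tnth_mktuple /rcoord !tnth_mktuple addr0.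
have SB (G H : Rn R n * Rn R n -> R[i]) p : S G p - S H p = S (fun p => G p - H p) p by rewrite /S mulrBr.
split; first by apply/L2P; rewrite NS//; split; [exact: mS|have /L2P[] := LK].
exists (fun j => twisted_translation kl (phi_ j)); split.
- by move=> j; have [L1 L2'] := Lphi_ j; split; [exact: Lp1_twisted|exact: L2_twisted].
- apply/L2norm_cvg0 => eps /H1[N NP]; exists N => k /NP.
  rewrite sub_linear -(N2_twisted kl) ?twisted_linear -?sub_linear//.
  exact: cmeasurableB.
- apply/L2norm_cvg0 => eps /H2[N NP]; exists N => k /NP h; apply: le_trans h.
  have [/Lp1_cintegrable c1 _] := Lphi_ k.
  rewrite -[X in (_ <= X)%E]NS; last by apply: cmeasurableB => //; exact: cmeasurable_weyl.
  rewrite (@ae_N2 _ _ _ _ _ (S (fun p => weyl_kernel_int (phi_ k) p - K p)))//.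
  + apply: cmeasurableB; last exact: mS.
    by apply: cmeasurable_weyl; exact: cmeasurable_twisted.
  + by apply: mS; apply: cmeasurableB => //; exact: cmeasurable_weyl.
  + by have := weyl_int_twisted kl c1; apply: filterS => p /(_ I) pE _; rewrite -SB pE.
Qed.

End weyl_kernel.

(** * The Weyl-Zak transform *)

Lemma invn_le_near (R : archiRealFieldType) (eps : R) : 0 < eps ->
  exists N : nat, forall k, (N <= k)%N -> k.+1%:R^-1 <= eps.
Proof.
move=> e0; exists (Num.truncn eps^-1) => k Nk.
rewrite -[leRHS]invrK lef_pV2 ?posrE ?invr_gt0//.
by apply: ltW; apply: (lt_le_trans (truncnS_gt _)); rewrite ler_nat ltnS.
Qed.

Section zak.
Context {R : realType} {n : nat}.
Implicit Types (K L : Rn R n * Rn R n -> R[i]) (Z : Rn R n * Rn R n * Rn R n -> R[i]).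

Lemma N2_subxx d (T : measurableType d) (mu : {measure set T -> \bar R}) (f : T -> R[i]) :
  N2 mu (fun x => f x - f x) = 0%E.
Proof. by rewrite -(N2_0 mu); apply: eq_N2 => x; rewrite subrr. Qed.

Lemma sum_fset_sub (J : choiceType) (V : nmodType) (F0 F : {fset J}) (X : J -> V) :
  (F0 `<=` F)%fset ->
  \sum_(m <- F) X m = \sum_(m <- F0) X m + \sum_(m <- F) (if m \in F0 then 0 else X m).
Proof.
move=> F0F; rewrite (bigID (mem F0)) /=; congr (_ + _); last first.
  by rewrite big_mkcond; apply: eq_bigr => m _; case: (m \in F0).
rewrite big_mkcond; transitivity (\sum_(m <- F0) (if m \in F0 then X m else 0)).
  apply/esym; apply: big_fset_incl => // m _ mF0; by rewrite (negbTE mF0).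
by apply: eq_big_seq => m ->.
Qed.

Definition zak_term K (m : Zn n) (p : Rn R n * Rn R n * Rn R n) : R[i] :=
  K (vadd (intv m) p.1.1, p.2) * chr (zopp m) p.1.2.

Lemma zak_partial_sumE K F : zak_partial_sum K F = lincomb F (fun=> 1) (zak_term K).
Proof.
apply/funext => p; rewrite /zak_partial_sum lincombE; apply: eq_bigr => m _.
by rewrite mul1r /zak_term /chr dot_intv_opp mulrN.
Qed.

Lemma cmeasurable_zak_term K m : cmeasurable K -> cmeasurable (zak_term K m).
Proof.
move=> mK.
have m11 : measurable_fun setT (fun q : (Rn R n * Rn R n) * Rn R n => q.1.1).
  exact: measurableT_comp measurable_fst measurable_fst.
have m12 : measurable_fun setT (fun q : (Rn R n * Rn R n) * Rn R n => q.1.2).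
  exact: measurableT_comp measurable_snd measurable_fst.
apply: cmeasurableM; last exact: (cmeasurable_comp m12 (cmeasurable_chr (zopp m))).
apply: (cmeasurable_comp _ mK); apply: measurable_fun_pair => //.
by apply: measurable_vadd => //; exact: measurable_cst.
Qed.

Definition zak_shift K (m : Zn n) (q : Rn R n * Rn R n) : R[i] := K (vadd q.1 (intv m), q.2).

(** The mass of the kernel over the strip where its first variable lies in the cell [m]. *)
Definition zak_coef K m : \bar R := N2 (prodm (torus n) (leb n)) (zak_shift K m).

Lemma zak_coef_ge0 K m : (0 <= zak_coef K m)%E.
Proof. exact: N2_ge0. Qed.

Lemma cmeasurable_zak_shift K m : cmeasurable K -> cmeasurable (zak_shift K m).
Proof.
move=> mK; apply: (cmeasurable_comp _ mK); apply: measurable_fun_pair => //.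
by apply: measurable_vadd => //; exact: measurable_cst.
Qed.

(** For fixed xi and eta the combination is a trigonometric polynomial in xi', and the
    orthonormality of the characters removes the cross terms. *)
Lemma N2_zak_lincomb K (F : {fset Zn n}) (c : Zn n -> R[i]) : cmeasurable K ->
  N2 (torus3 n) (lincomb F c (zak_term K)) = (\sum_(m <- F) (sqn (c m))%:E * zak_coef K m)%E.
Proof.
move=> mK.
have mS : cmeasurable (lincomb F c (zak_term K)).
  by apply: cmeasurable_lincomb => m; exact: cmeasurable_zak_term.
have mh m : cmeasurable (fun q => c m * zak_shift K m q).
  by apply: cmeasurableM; [exact: cmeasurable_cst|exact: cmeasurable_zak_shift].
pose g (q : Rn R n * Rn R n) : \bar R := (\sum_(m <- F) (sqn (c m * zak_shift K m q))%:E)%E.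
have mg : measurable_fun setT g.
  by apply: emeasurable_sum => m; exact: emeasurable_sqn.
have g0 q : (0 <= g q)%E by apply: sume_ge0 => m _; rewrite lee_fin sqn_ge0.
apply: etrans (N2_prodm_swap (torus2 n) (leb n) mS) _.
transitivity (\int[prodm (torus n) (leb n)]_q g q)%E.
  apply: etrans (esym (ge0_integral_prodm_swap (torus n) (leb n) mg g0)).
  apply: eq_integral => eta _.
  have mSe : cmeasurable (fun q => lincomb F c (zak_term K) (q, eta)).
    by apply: (cmeasurable_comp _ mS); exact: measurable_pair2.
  apply: etrans (N2_prodm (torus n) (torus n) mSe) _; apply: eq_integral => xi _.
  rewrite (_ : (fun y => _) = lincomb F (fun m => c m * zak_shift K m (xi, eta))
      (fun m => chr (zopp m))); last first.
    apply/funext => y; rewrite !lincombE; apply: eq_bigr => m _.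
    by rewrite /zak_term /zak_shift /= vaddC mulrA.
  rewrite N2_lincomb; last 2 first.
  - by move=> m; exact: L2_chr.
  - by move=> i j; rewrite inner_chr (can_eq (@zoppK n)).
  by rewrite /g sumEFin.
rewrite /g ge0_integral_sum//; last 2 first.
- by move=> m; exact: emeasurable_sqn.
- by move=> m q _; rewrite lee_fin sqn_ge0.
apply: eq_bigr => m _; rewrite /zak_coef -N2Z//; exact: cmeasurable_zak_shift.
Qed.

Lemma N2_zak_partial_sum K (F : {fset Zn n}) : cmeasurable K ->
  N2 (torus3 n) (zak_partial_sum K F) = (\sum_(m <- F) zak_coef K m)%E.
Proof.
move=> mK; rewrite zak_partial_sumE N2_zak_lincomb//; apply: eq_bigr => m _.
by rewrite sqn1 mul1e.
Qed.

Lemma esum_zak_coef K : cmeasurable K -> (\esum_(m in setT) zak_coef K m = N2 (leb2 n) K)%E.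
Proof.
move=> mK.
transitivity (\esum_(m in setT) (\int[leb n]_eta N2 (torus n) (fun xi => zak_shift K m (xi, eta))))%E.
  by apply: eq_esum => m _; apply: N2_prodm_swap; exact: cmeasurable_zak_shift.
rewrite -(@integral_esum R _ _ (leb n) (n.-tuple int) (fun m eta =>
  N2 (torus n) (fun xi => zak_shift K m (xi, eta)))); last 2 first.
- by move=> m; apply: measurable_N2_section_swap; exact: cmeasurable_zak_shift.
- by move=> m eta; exact: N2_ge0.
apply/esym; apply: etrans (N2_prodm_swap (leb n) (leb n) mK) _.
apply: eq_integral => eta _; apply: ge0_integral_leb_periodize.
  apply: emeasurable_sqn; apply: (cmeasurable_comp _ mK); exact: measurable_pair2.
by move=> x; rewrite lee_fin sqn_ge0.
Qed.

Lemma L2_zak_partial_sum K F : L2 (leb2 n) K -> L2 (torus3 n) (zak_partial_sum K F).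
Proof.
move=> /L2P[mK NK]; apply/L2P; split.
  rewrite zak_partial_sumE; apply: cmeasurable_lincomb => m; exact: cmeasurable_zak_term.
rewrite N2_zak_partial_sum//; apply: le_lt_trans NK.
by rewrite -esum_zak_coef//; apply: fset_le_esum => m; exact: zak_coef_ge0.
Qed.

(** The difference is the combination with coefficient 0 on [F0] and 1 on the rest of [F], so its
    squared norm is at most the mass that [F0] misses. *)
Lemma zak_tail K (F0 F : {fset Zn n}) (eps : R) : L2 (leb2 n) K -> (F0 `<=` F)%fset ->
  (N2 (leb2 n) K <= \sum_(m <- F0) zak_coef K m + eps%:E)%E ->
  (N2 (torus3 n) (fun p => zak_partial_sum K F p - zak_partial_sum K F0 p)%R <= eps%:E)%E.
Proof.
move=> LK F0F KF0; have mK := L2_cmeasurable LK.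
rewrite (_ : (fun p => _) = lincomb F (fun m => (m \notin F0)%:R) (zak_term K)); last first.
  apply/funext => p; rewrite !zak_partial_sumE !lincombE (sum_fset_sub _ F0F) addrAC subrr add0r.
  by apply: eq_bigr => m _; case: (m \in F0); rewrite /= ?mul0r.
have fin0 : (\sum_(m <- F0) zak_coef K m)%E \is a fin_num.
  have := L2_fin (L2_zak_partial_sum F0 LK); by rewrite N2_zak_partial_sum.
rewrite N2_zak_lincomb// -(leeD2lE _ _ fin0); apply: le_trans KF0.
apply: (@le_trans _ _ (\sum_(m <- F) zak_coef K m)%E); last first.
  by rewrite -esum_zak_coef//; apply: fset_le_esum => m; exact: zak_coef_ge0.
rewrite le_eqVlt; apply/orP; left; apply/eqP.
rewrite [RHS](sum_fset_sub _ F0F); congr (_ + _)%E; apply: eq_bigr => m _.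
by case: (m \in F0); rewrite /= ?sqn0 ?mul0e// sqn1 mul1e.
Qed.

Lemma is_zak_sumP K Z : is_zak_sum K Z <-> L2 (torus3 n) Z /\
  forall eps : R, 0 < eps -> exists F0 : {fset Zn n},
    forall F : {fset Zn n}, (F0 `<=` F)%fset ->
      (N2 (torus3 n) (fun p => (zak_partial_sum K F p - Z p)%R) <= eps%:E)%E.
Proof.
split=> -[LZ H]; split=> // eps eps0.
  have s0 : 0 < Num.sqrt eps by rewrite sqrtr_gt0.
  have [F0 F0P] := H _ s0; exists F0 => F /F0P; rewrite L2norm_lt// sqr_sqrtr ?(ltW eps0)//.
  exact: ltW.
have e0 : 0 < (eps / 2) ^+ 2 by rewrite exprn_gt0// divr_gt0.
have [F0 F0P] := H _ e0; exists F0 => F /F0P h; rewrite L2norm_lt//.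
by apply: (le_lt_trans h); rewrite lte_fin; nra.
Qed.

(** The set [F_ k] carries all but 1 / (k + 1) of the mass of the kernel. Two partial sums are
    compared through the one over the union of their index sets, and the tail bound for arbitrary
    larger sets yields unconditional convergence. *)
Lemma zak_exists K : L2 (leb2 n) K -> exists Z, is_zak_sum K Z.
Proof.
move=> LK; have mK := L2_cmeasurable LK.
have /choice[F_ FP] : forall k : nat, exists F : {fset Zn n},
    (N2 (leb2 n) K <= \sum_(m <- F) zak_coef K m + (k.+1%:R^-1)%:E)%E.
  move=> k; rewrite -esum_zak_coef//; apply: esum_approx.
  - by move=> m; exact: zak_coef_ge0.
  - by rewrite esum_zak_coef//; have /L2P[] := LK.
  - by rewrite invr_gt0.
have LS F : L2 (torus3 n) (zak_partial_sum K F) by exact: L2_zak_partial_sum.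
have mS F := L2_cmeasurable (LS F).
have tail F k : (F_ k `<=` F)%fset -> (N2 (torus3 n)
    (fun p => zak_partial_sum K F p - zak_partial_sum K (F_ k) p)%R <= (k.+1%:R^-1)%:E)%E.
  by move=> h; apply: zak_tail.
have [|Z [LZ HZ _]] := L2_complete (fun k => LS (F_ k)).
  move=> eps eps0; have [N NP] := invn_le_near (divr_gt0 eps0 (ltr0Sn R 3)).
  exists N => j k Nj Nk.
  apply: (N2_tri_eps (mS (F_ j)) (mS (F_ j `|` F_ k)%fset) (mS (F_ k))).
    by rewrite N2_sub; apply: (le_trans (tail _ _ (fsubsetUl _ _))); rewrite lee_fin NP.
  by apply: (le_trans (tail _ _ (fsubsetUr _ _))); rewrite lee_fin NP.
exists Z; apply/is_zak_sumP; split=> // eps eps0.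
have e4 : 0 < eps / 4 by rewrite divr_gt0.
have [N1 N1P] := invn_le_near e4; have [N2' N2P] := HZ _ e4.
pose k := maxn N1 N2'; exists (F_ k) => F kF.
apply: (N2_tri_eps (mS F) (mS (F_ k)) (L2_cmeasurable LZ)).
  by apply: (le_trans (tail _ _ kF)); rewrite lee_fin N1P// leq_maxl.
by apply: N2P; exact: leq_maxr.
Qed.

Lemma zak_isometry K Z : L2 (leb2 n) K -> is_zak_sum K Z -> N2 (torus3 n) Z = N2 (leb2 n) K.
Proof.
move=> LK /is_zak_sumP[LZ H]; have mK := L2_cmeasurable LK; have mZ := L2_cmeasurable LZ.
have mS F := L2_cmeasurable (L2_zak_partial_sum F LK).
have NS F : (N2 (torus3 n) (zak_partial_sum K F) <= N2 (leb2 n) K)%E.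
  rewrite N2_zak_partial_sum// -esum_zak_coef//; apply: fset_le_esum => m.
  exact: zak_coef_ge0.
apply/eqP; rewrite eq_le; apply/andP; split.
  apply: N2_le_approx => // eps eps0; have [F0 /(_ F0 (fsubset_refl _)) h] := H _ eps0.
  exists (zak_partial_sum K F0), K; split=> //; first by rewrite N2_sub.
  by rewrite N2_subxx lee_fin ltW.
(* The partial sum over [F] is no larger than the one over the union of [F0] and [F], which is close
   to [Z]. *)
rewrite -esum_zak_coef//; apply: esum_le_fset => F; rewrite -N2_zak_partial_sum//.
apply: N2_le_approx => // eps eps0; have [F0 /(_ (F0 `|` F)%fset (fsubsetUl _ _)) h] := H _ eps0.
exists (zak_partial_sum K F), (zak_partial_sum K (F0 `|` F)%fset); split=> //.
- rewrite !N2_zak_partial_sum// (sum_fset_sub _ (fsubsetUr F0 F)); apply: leeDl.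
  by apply: sume_ge0 => m _; case: ifP => // _; exact: zak_coef_ge0.
- by rewrite N2_subxx lee_fin ltW.
- by rewrite N2_sub.
Qed.

Lemma zak_linear (a : R[i]) K L Z Y : L2 (leb2 n) K -> L2 (leb2 n) L ->
  is_zak_sum K Z -> is_zak_sum L Y ->
  is_zak_sum (fun p => a * K p + L p) (fun p => a * Z p + Y p).
Proof.
move=> LK LL /is_zak_sumP[LZ HZ] /is_zak_sumP[LY HY]; apply/is_zak_sumP.
split; first by apply: L2D => //; exact: L2Z.
move=> eps eps0; have a0 : 0 <= sqn a by exact: sqn_ge0.
have e1 : 0 < eps / (4 * (1 + sqn a)) by rewrite divr_gt0// mulr_gt0//; lra.
have [F1 F1P] := HZ _ e1; have [F2 F2P] := HY _ (divr_gt0 eps0 (ltr0Sn R 3)).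
exists (F1 `|` F2)%fset => F; rewrite fsubUset => /andP[h1 h2].
rewrite (_ : (fun p => _) = fun p => a * zak_partial_sum K F p + zak_partial_sum L F p -
    (a * Z p + Y p)); last first.
  apply/funext => p; congr (_ - _); rewrite /zak_partial_sum mulr_sumr -big_split.
  by apply: eq_bigr => m _; rewrite mulrDl mulrA.
apply: N2_linear_small => //.
- exact: L2_cmeasurable (L2_zak_partial_sum F LK).
- exact: L2_cmeasurable (L2_zak_partial_sum F LL).
- exact: L2_cmeasurable LZ.
- exact: L2_cmeasurable LY.
- exact: F1P.
- exact: F2P.
Qed.

(** Reindexing by m + l turns the shift of xi by l into the character of index l in xi', while the
    character of index k in xi is periodic and leaves the sum. The finite index sets are translated
    accordingly. *)
Lemma zak_twisted (kl : Zn n * Zn n) (c : R[i]) K Z : sqn c = 1 -> is_zak_sum K Z ->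
  is_zak_sum (fun p => c * chr kl.1 p.1 * K (vadd p.1 (intv kl.2), p.2))
    (fun p => c * chr2 kl p.1 * Z p).
Proof.
case: kl => k l /= c1 /is_zak_sumP[LZ HZ]; have mZ := L2_cmeasurable LZ; apply/is_zak_sumP.
pose ph (p : Rn R n * Rn R n * Rn R n) : R[i] := c * chr2 (k, l) p.1.
have sph p : sqn (ph p) = 1 by rewrite /ph sqnM c1 mul1r sqn_chr2.
split.
  apply: (L2_le _ LZ); last by move=> p; rewrite sqnM sph mul1r.
  apply: cmeasurableM => //; apply: cmeasurableM; first exact: cmeasurable_cst.
  exact: (cmeasurable_comp measurable_fst (cmeasurable_chr2 (k, l))).
move=> eps /HZ[F0 F0P].
exists [fset zadd m (zopp l) | m in F0]%fset => F F0F.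
pose G : {fset Zn n} := [fset zadd m l | m in F]%fset.
have F0G : (F0 `<=` G)%fset.
  apply/fsubsetP => m mF0; apply/imfsetP; exists (zadd m (zopp l)); last by rewrite zaddNK.
  by apply: (fsubsetP F0F); apply/imfsetP; exists m.
apply: le_trans (F0P _ F0G); rewrite le_eqVlt; apply/orP; left; apply/eqP.
apply: eq_N2 => p; rewrite -[RHS]mul1r -(sph p) -sqnM; congr sqn.
rewrite mulrBr; congr (_ - _); rewrite /zak_partial_sum mulr_sumr /G big_imfset; last first.
  by move=> x y _ _ /(congr1 (fun m => zadd m (zopp l))); rewrite !zaddK.
apply: eq_bigr => m _ /=.
rewrite -[expi _](_ : chr (zopp m) p.1.2 = _); last by rewrite /chr dot_intv_opp mulrN.
rewrite -[X in _ = _ * (_ * X)](_ : chr (zopp (zadd m l)) p.1.2 = _); last first.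
  by rewrite /chr dot_intv_opp mulrN.
have -> : vadd (vadd (intv m) p.1.1) (intv l) = vadd (intv (zadd m l)) p.1.1.
  by rewrite intv_add -!vaddA (vaddC p.1.1).
have -> : zopp m = zadd l (zopp (zadd m l)).
  by apply: eq_from_tnth => i; rewrite !tnth_mktuple opprD addrCA subrr addr0.
rewrite chrD chr_vadd chr_intv /ph /chr2 /=; ring.
Qed.

End zak.

Section weyl_zak.
Context {R : realType} {n : nat}.
Implicit Types (phi psi : Rn R n * Rn R n -> R[i]) (Z : Rn R n * Rn R n * Rn R n -> R[i]).

(** The transform as a relation between representatives. Sums and twisted translations preserve it
    exactly, whereas the chosen [weyl_zak] respects them only almost everywhere. *)
Definition is_weyl_zak phi Z := exists K, is_weyl_kernel phi K /\ is_zak_sum K Z.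

Lemma is_weyl_zak_L2 phi Z : is_weyl_zak phi Z -> L2 (torus3 n) Z.
Proof. by move=> [K [_ []]]. Qed.

Lemma weyl_zakP phi : L2 (leb2 n) phi -> is_weyl_zak phi (weyl_zak phi).
Proof.
move=> Lphi; exists (weyl_kernel phi).
have HK : is_weyl_kernel phi (weyl_kernel phi).
  by have [K KP] := weyl_kernel_exists Lphi; apply: (@xgetPex _ _ [set K | is_weyl_kernel phi K]); exists K.
split=> //; have [Z ZP] : exists Z, is_zak_sum (weyl_kernel phi) Z by apply: zak_exists; case: HK.
by apply: (@xgetPex _ _ [set Z | is_zak_sum (weyl_kernel phi) Z]); exists Z.
Qed.

Lemma is_weyl_zak_isometry phi Z : L2 (leb2 n) phi -> is_weyl_zak phi Z ->
  N2 (torus3 n) Z = N2 (leb2 n) phi.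
Proof.
move=> Lphi [K [HK HZ]]; rewrite (zak_isometry _ HZ); last by case: HK.
exact: weyl_kernel_isometry.
Qed.

Lemma is_weyl_zak_linear (a : R[i]) phi psi Z Y : L2 (leb2 n) phi -> L2 (leb2 n) psi ->
  is_weyl_zak phi Z -> is_weyl_zak psi Y ->
  is_weyl_zak (fun p => a * phi p + psi p) (fun p => a * Z p + Y p).
Proof.
move=> L1 L2' [K [HK HZ]] [L [HL HY]]; exists (fun p => a * K p + L p); split.
  exact: weyl_kernel_linear.
by apply: zak_linear => //; [case: HK|case: HL].
Qed.

Lemma is_weyl_zak_sub phi psi Z Y : L2 (leb2 n) phi -> L2 (leb2 n) psi ->
  is_weyl_zak phi Z -> is_weyl_zak psi Y ->
  N2 (torus3 n) (fun p => Z p - Y p) = N2 (leb2 n) (fun p => phi p - psi p).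
Proof.
move=> L1 L2' HZ HY; have := is_weyl_zak_isometry _ (is_weyl_zak_linear (-1) L2' L1 HY HZ).
have E (T : Type) (f g : T -> R[i]) : (fun x => -1 * g x + f x) = (fun x => f x - g x).
  by apply/funext => x; rewrite mulN1r addrC.
by rewrite !E => ->//; exact: L2B.
Qed.

Lemma is_weyl_zak_unique phi Z Y : L2 (leb2 n) phi ->
  is_weyl_zak phi Z -> is_weyl_zak phi Y -> Z = Y %[ae torus3 n].
Proof.
move=> Lphi HZ HY; apply/N2B_eq0.
- exact: L2_cmeasurable (is_weyl_zak_L2 HZ).
- exact: L2_cmeasurable (is_weyl_zak_L2 HY).
- rewrite (is_weyl_zak_sub Lphi Lphi HZ HY) -(N2_0 (leb2 n)).
  by apply: eq_N2 => p; rewrite subrr.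
Qed.

Definition twist_phase (kl : Zn n * Zn n) : R[i] := expi (pi * dot (intv kl.1) (intv kl.2)).

Lemma is_weyl_zak_twisted kl phi Z : L2 (leb2 n) phi -> is_weyl_zak phi Z ->
  is_weyl_zak (twisted_translation kl phi) (fun p => twist_phase kl * chr2 kl p.1 * Z p).
Proof.
move=> Lphi [K [HK HZ]].
exists (fun p => twist_phase kl * chr kl.1 p.1 * K (vadd p.1 (intv kl.2), p.2)); split.
  exact: weyl_kernel_twisted.
by apply: zak_twisted => //; exact: sqn_expi.
Qed.

End weyl_zak.

(** * Riesz sequences of twisted translates *)

Section riesz.
Context {d} {T : measurableType d} {R : realType}.
Variable mu : {measure set T -> \bar R}.
Context {J : choiceType}.
Implicit Types (f : T -> R[i]) (V : set (T -> R[i])).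

(** Squaring adapts the bound to [N2] and makes the constant nonnegative whatever the sign of
    [M]. *)
Lemma bounded_operator_N2 V U : (forall f, V f -> L2 mu f) -> bounded_operator mu V U ->
  exists2 C : R, 0 <= C & forall f, V f -> (N2 mu (U f) <= C%:E * N2 mu f)%E.
Proof.
move=> VL [VU _ [M MP]]; exists (M ^+ 2); first exact: sqr_ge0.
move=> f Vf; have Lf := VL _ Vf; have LU := VL _ (VU _ Vf).
have := MP _ Vf; rewrite !L2normE (N2rE Lf) (N2rE LU) !poweR_EFin.
rewrite !powR12_sqrt ?N2r_ge0// -!EFinM !lee_fin => h.
rewrite -[leLHS]sqr_sqrtr ?N2r_ge0// -[X in _ * X]sqr_sqrtr ?N2r_ge0//.
rewrite -exprMn ler_sqr// ?nnegrE ?sqrtr_ge0//; apply: le_trans h; exact: sqrtr_ge0.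
Qed.

Lemma bounded_operator_lincomb (u e : J -> T -> R[i]) (V := closed_span mu u) U :
  (forall j, L2 mu (u j)) -> bounded_operator mu V U ->
  (forall j, e j = U (u j) %[ae mu]) -> forall (F : {fset J}) c,
  U (lincomb F c u) = lincomb F c e %[ae mu].
Proof.
move=> Lu [VU linU _] eU F c; rewrite !lincombE.
have V0 : V (fun=> 0) by apply: inspan_closed_span => //; exact: inspan0.
have Vu j : V (u j) by apply: inspan_closed_span => //; exact: inspan_gen.
have VS s : V (fun x => \sum_(j <- s) c j * u j x).
  by apply: (closed_span_sum Lu) => j; apply: (closed_spanZ Lu); exact: Vu.
elim: (enum_fset F) => [|j s ih].
  (* Linearity with coefficient -1 at the zero function gives U 0 = - U 0 + U 0 = 0 almost
     everywhere, the case of the empty sum. *)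
  have := linU (-1) _ _ V0 V0; apply: filterS => x /(_ I) E _.
  rewrite big_nil [X in U X](_ : _ = fun y => -1 * (fun=> 0) y + (fun=> 0) y); last first.
    by apply/funext => y; rewrite big_nil mulr0 addr0.
  by rewrite [LHS]E mulN1r addNr.
have := linU (c j) _ _ (Vu j) (VS s).
apply: filterS3 ih (eU j) => x /(_ I) E1 /(_ I) E2 /(_ I) E3 _.
rewrite big_cons -E1 E2 -E3; congr (U _ x); apply/funext => y.
by rewrite big_cons.
Qed.

(** The sum of the |c j|^2 is the squared norm of the same combination of the orthonormal basis [u].
    The operator [U] gives the first bound, its inverse [W] the second, and the sum of their
    constants serves for both. *)
Lemma riesz_bounds (e : J -> T -> R[i]) : (forall j, L2 mu (e j)) -> riesz_sequence mu e ->
  exists2 C : R, 0 <= C & forall (F : {fset J}) c,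
    (N2 mu (lincomb F c e) <= C%:E * (\sum_(j <- F) sqn (c j))%:E)%E /\
    ((\sum_(j <- F) sqn (c j))%:E <= C%:E * N2 mu (lincomb F c e))%E.
Proof.
move=> Le [u [U [[[Vu uO] uV] [bU [W [bW WU]]] eU]]].
have VL f : closed_span mu e f -> L2 mu f by exact: closed_span_L2.
have Lu j : L2 mu (u j) by exact/VL/Vu.
have [C C0 CP] := bounded_operator_N2 VL bU.
have [D D0 DP] := bounded_operator_N2 VL bW.
exists (C + D); first exact: addr_ge0.
move=> F c; set f := lincomb F c u.
have Vf : closed_span mu e f.
  rewrite -uV; apply: inspan_closed_span => //; by exists F, c.
have bU' : bounded_operator mu (closed_span mu u) U by rewrite uV.
have UfE : U f = lincomb F c e %[ae mu] by exact: bounded_operator_lincomb.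
have VUf : closed_span mu e (U f) by case: bU => h _ _; exact: h.
have mUf := L2_cmeasurable (VL _ VUf).
have mle : cmeasurable (lincomb F c e) by exact: L2_cmeasurable (L2_lincomb _ _ Le).
rewrite -(ae_N2 mUf mle UfE) -(N2_lincomb Lu uO); split.
  apply: (le_trans (CP _ Vf)); apply: lee_wpmul2r; first exact: N2_ge0.
  by rewrite lee_fin lerDl.
have [WUf _] := WU _ Vf.
have mWUf : cmeasurable (W (U f)).
  by apply: L2_cmeasurable; apply: VL; case: bW => h _ _; exact: h.
rewrite -(ae_N2 mWUf (L2_cmeasurable (VL _ Vf)) WUf).
apply: (le_trans (DP _ VUf)); apply: lee_wpmul2r; first exact: N2_ge0.
by rewrite lee_fin lerDr.
Qed.

(** Norm approximants need not converge pointwise; completeness supplies an almost everywhere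
    convergent subsequence, and its limit agrees with [f] because both are the L^2 limit. *)
Lemma closed_span_ae_approx (e : J -> T -> R[i]) f : (forall j, L2 mu (e j)) ->
  closed_span mu e f -> exists p_ : nat -> T -> R[i],
  [/\ forall k, inspan e (p_ k),
      forall eps : R, 0 < eps -> exists N : nat, forall k, (N <= k)%N ->
        (N2 mu (fun x => f x - p_ k x)%R <= eps%:E)%E
    & \forall x \ae mu, ccvg (p_ ^~ x) (f x)].
Proof.
move=> Le /closed_spanP[Lf H]; have mf := L2_cmeasurable Lf.
have /choice[p pP] : forall k : nat, exists p, inspan e p /\
    (N2 mu (fun x => f x - p x)%R <= (k.+1%:R^-1)%:E)%E.
  by move=> k; apply: H; rewrite invr_gt0.
have Np (eps : R) : 0 < eps -> exists N : nat, forall k, (N <= k)%N ->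
    (N2 mu (fun x => f x - p k x)%R <= eps%:E)%E.
  move=> /invn_le_near[N NP]; exists N => k /NP h; have [_ h'] := pP k.
  by apply: (le_trans h'); rewrite lee_fin.
have Lp' k : L2 mu (p k) by apply: (inspan_L2 Le); case: (pP k).
have mp k := L2_cmeasurable (Lp' k).
have Np' (eps : R) : 0 < eps -> exists N : nat, forall k, (N <= k)%N ->
    (N2 mu (fun x => p k x - f x)%R <= eps%:E)%E.
  by move=> /Np[N NP]; exists N => k /NP; rewrite N2_sub.
have [|g [Lg gP [s [sk sg]]]] := L2_complete Lp'; first exact: N2_cauchy Np'.
have fg : f = g %[ae mu].
  apply: ae_eq_N2_small => //; first exact: L2_cmeasurable Lg.
  move=> eps eps0; have [N1 N1P] := Np _ (divr_gt0 eps0 (ltr0Sn R 3)).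
  have [N2' N2P] := gP _ (divr_gt0 eps0 (ltr0Sn R 3)).
  apply: (N2_tri_eps mf (mp (maxn N1 N2')) (L2_cmeasurable Lg)).
    by apply: N1P; exact: leq_maxl.
  by apply: N2P; exact: leq_maxr.
exists (fun k => p (s k)); split.
- by move=> k; case: (pP (s k)).
- move=> eps /Np[N NP]; exists N => k Nk; apply: NP; exact: leq_trans (sk k).
- by apply: filterS2 fg sg => x /(_ I) ->.
Qed.

End riesz.

(** * Multipliers in Zak space and bounds on the bracket *)

Section multipliers.
Context {R : realType} {n : nat}.
Implicit Types (phi f : Rn R n * Rn R n -> R[i]) (q : Rn R n * Rn R n -> R[i])
  (Z Y : Rn R n * Rn R n * Rn R n -> R[i]).

Local Notation translates phi := (fun kl : Zn n * Zn n => twisted_translation kl phi).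

(* In Zak space the elements of the closed span of the translates are the
   products of Z with functions of the torus variables only. *)
Definition zmul q Z (p : Rn R n * Rn R n * Rn R n) : R[i] := q p.1 * Z p.

Lemma cmeasurable_zmul q Z : cmeasurable q -> cmeasurable Z -> cmeasurable (zmul q Z).
Proof. by move=> mq mZ; apply: cmeasurableM => //; exact: (cmeasurable_comp measurable_fst mq). Qed.

(** The bracket of [phi] with itself when [Z] is the transform of [phi], kept as an extended real
    because finiteness holds only almost everywhere. *)
Definition fiber Z (x : Rn R n * Rn R n) : \bar R := N2 (leb n) (fun eta => Z (x, eta)).

Lemma N2_zmul q Z : cmeasurable q -> cmeasurable Z ->
  N2 (torus3 n) (zmul q Z) = (\int[torus2 n]_x ((sqn (q x))%:E * fiber Z x))%E.
Proof.
move=> mq mZ; apply: etrans (N2_prodm (torus2 n) (leb n) (cmeasurable_zmul mq mZ)) _.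
apply: eq_integral => x _; rewrite -N2Z//.
by apply: (cmeasurable_comp _ mZ); exact: measurable_pair1.
Qed.

Lemma measurable_fiber Z : cmeasurable Z -> measurable_fun setT (fiber Z).
Proof. exact: (measurable_N2_section (leb n)). Qed.

Lemma is_weyl_zak_lincomb phi Z (F : {fset Zn n * Zn n}) c : L2 (leb2 n) phi ->
  is_weyl_zak phi Z -> is_weyl_zak (lincomb F c (translates phi))
    (zmul (lincomb F (fun kl => c kl * twist_phase kl) (@chr2 R n)) Z).
Proof.
move=> Lphi HZ; rewrite /zmul !lincombE.
have LT kl := L2_twisted kl Lphi.
elim: (enum_fset F) => [|kl s ih].
  have := is_weyl_zak_linear (-1) Lphi Lphi HZ HZ; congr is_weyl_zak; apply/funext => p.
    by rewrite big_nil mulN1r addNr.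
  by rewrite big_nil mul0r mulN1r addNr.
have Ls : L2 (leb2 n) (fun x => \sum_(j <- s) c j * twisted_translation j phi x).
  by apply: L2_sum => j; exact: L2Z.
have := is_weyl_zak_linear (c kl) (LT kl) Ls (is_weyl_zak_twisted kl Lphi HZ) ih.
congr is_weyl_zak; apply/funext => p; rewrite big_cons//.
by rewrite mulrDl !mulrA.
Qed.

Lemma sqn_twist_phase (kl : Zn n * Zn n) : sqn (twist_phase kl : R[i]) = 1.
Proof. exact: sqn_expi. Qed.

(** The conjugate phases cancel those created by the twisted translations. Every trigonometric
    polynomial is thus the multiplier of some combination of translates, with coefficients of
    unchanged modulus. *)
Lemma trig_lift phi Z (F : {fset Zn n * Zn n}) (c : Zn n * Zn n -> R[i]) : L2 (leb2 n) phi ->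
  is_weyl_zak phi Z -> is_weyl_zak
    (lincomb F (fun kl => c kl * ((twist_phase kl)^*)%R) (translates phi))
    (zmul (lincomb F c (@chr2 R n)) Z).
Proof.
move=> Lphi HZ; have := is_weyl_zak_lincomb F (fun kl => c kl * ((twist_phase kl)^*)%R) Lphi HZ.
congr (is_weyl_zak _ (zmul _ _)); apply/funext => p; rewrite !lincombE.
apply: eq_bigr => kl _; rewrite -[c kl * _ * _]mulrA [_^* * _]mulrC mulc_conj sqn_twist_phase.
by rewrite mulr1.
Qed.

Lemma zmul_subl q q' Z : (fun p => zmul q Z p - zmul q' Z p) = zmul (fun x => q x - q' x) Z.
Proof. by apply/funext => p; rewrite /zmul mulrBl. Qed.

(** Trigonometric polynomials tending to [q] lift to combinations of translates. The bound by [C]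
    makes their products with [Z] converge, and the isometry brings this back to a Cauchy sequence
    whose limit is [f]. *)
Lemma zak_mult_in_span phi Z (C : R) : L2 (leb2 n) phi -> is_weyl_zak phi Z ->
  (forall q, L2 (torus2 n) q -> (N2 (torus3 n) (zmul q Z) <= C%:E * N2 (torus2 n) q)%E) ->
  0 < C ->
  forall q, L2 (torus2 n) q -> exists f, closed_span (leb2 n) (translates phi) f /\
    weyl_zak f = zmul q Z %[ae torus3 n].
Proof.
move=> Lphi HZ CP C0 q Lq; have LT kl := L2_twisted kl Lphi.
have mZ := L2_cmeasurable (is_weyl_zak_L2 HZ); have mq := L2_cmeasurable Lq.
have [p_ [sp pq _]] := closed_span_ae_approx (@L2_chr2 R n) (torus2_dense Lq).
have Lp' k : L2 (torus2 n) (p_ k) by apply: (inspan_L2 (@L2_chr2 R n)).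
have mp k := L2_cmeasurable (Lp' k).
have /choice[f_ fP] : forall k, exists f, inspan (translates phi) f /\
    is_weyl_zak f (zmul (p_ k) Z).
  move=> k; have [F [c ->]] := sp k.
  exists (lincomb F (fun kl => c kl * ((twist_phase kl)^*)%R) (translates phi)).
  by split; [exists F; eexists|exact: trig_lift].
have Lf_ k : L2 (leb2 n) (f_ k) by apply: (inspan_L2 LT); case: (fP k).
have Hpq (eps : R) : 0 < eps -> exists N : nat, forall k, (N <= k)%N ->
    (N2 (torus3 n) (fun p => zmul (p_ k) Z p - zmul q Z p)%R <= eps%:E)%E.
  move=> eps0; have [N NP] := pq _ (divr_gt0 eps0 C0); exists N => k /NP h.
  rewrite zmul_subl; apply: (le_trans (CP _ _)); first exact: L2B.
  rewrite N2_sub; apply: (@le_trans _ _ (C%:E * (eps / C)%:E)%E).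
    by apply: lee_wpmul2l => //; rewrite lee_fin ltW.
  by rewrite -EFinM lee_fin mulrC divfK// gt_eqF.
have mzp k : cmeasurable (zmul (p_ k) Z) by exact: cmeasurable_zmul.
have mzq : cmeasurable (zmul q Z) by exact: cmeasurable_zmul.
have [|f [Lf ff _]] := L2_complete Lf_.
  move=> eps /(N2_cauchy mzp mzq Hpq)[N NP]; exists N => j k Nj Nk.
  by rewrite -(is_weyl_zak_sub (Lf_ j) (Lf_ k) (fP j).2 (fP k).2); exact: NP.
exists f; split.
  apply/closed_spanP; split=> // eps /ff[N NP]; exists (f_ N); split; first by case: (fP N).
  by rewrite N2_sub; exact: NP.
have Hf := weyl_zakP Lf; have mWf := L2_cmeasurable (is_weyl_zak_L2 Hf).
apply: ae_eq_N2_small => // eps eps0.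
have [N1 N1P] := Hpq _ (divr_gt0 eps0 (ltr0Sn R 3)).
have [N2' N2P] := ff _ (divr_gt0 eps0 (ltr0Sn R 3)).
apply: (N2_tri_eps mWf (mzp (maxn N1 N2')) mzq); last by apply: N1P; exact: leq_maxl.
rewrite (is_weyl_zak_sub Lf (Lf_ _) Hf (fP _).2) (N2_sub _ f).
by apply: N2P; exact: leq_maxr.
Qed.

(** The transform is injective up to null sets: an element of the closed span with the transform of
    [f] is [f] almost everywhere. *)
Lemma zak_mult_span phi Z (C : R) f q : L2 (leb2 n) phi -> is_weyl_zak phi Z ->
  (forall q, L2 (torus2 n) q -> (N2 (torus3 n) (zmul q Z) <= C%:E * N2 (torus2 n) q)%E) ->
  0 < C -> L2 (leb2 n) f -> L2 (torus2 n) q ->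
  weyl_zak f = zmul q Z %[ae torus3 n] -> closed_span (leb2 n) (translates phi) f.
Proof.
move=> Lphi HZ CP C0 Lf Lq fq.
have [g [Vg gq]] := zak_mult_in_span Lphi HZ CP C0 Lq.
have Lg := closed_span_L2 Vg.
have LT kl := L2_twisted kl Lphi.
apply: (closed_span_ae LT (L2_cmeasurable Lf) Vg).
apply/N2B_eq0; [exact: L2_cmeasurable Lf|exact: L2_cmeasurable Lg|].
rewrite -(is_weyl_zak_sub Lf Lg (weyl_zakP Lf) (weyl_zakP Lg)).
apply/N2B_eq0.
- exact: L2_cmeasurable (is_weyl_zak_L2 (weyl_zakP Lf)).
- exact: L2_cmeasurable (is_weyl_zak_L2 (weyl_zakP Lg)).
- by apply: filterS2 fq gq => p /(_ I) -> /(_ I) ->.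
Qed.

Section riesz_fiber.
Variables (phi : Rn R n * Rn R n -> R[i]) (Z : Rn R n * Rn R n * Rn R n -> R[i]) (C : R).
Hypotheses (Lphi : L2 (leb2 n) phi) (HZ : is_weyl_zak phi Z) (C0 : 0 <= C).
Hypothesis CP : forall (F : {fset Zn n * Zn n}) c,
  (N2 (leb2 n) (lincomb F c (translates phi)) <= C%:E * (\sum_(j <- F) sqn (c j))%:E)%E /\
  ((\sum_(j <- F) sqn (c j))%:E <= C%:E * N2 (leb2 n) (lincomb F c (translates phi)))%E.

Let mZ : cmeasurable Z. Proof. exact: L2_cmeasurable (is_weyl_zak_L2 HZ). Qed.

Let trig_bounds p : inspan (@chr2 R n) p ->
  (N2 (torus3 n) (zmul p Z) <= C%:E * N2 (torus2 n) p)%E /\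
  (N2 (torus2 n) p <= C%:E * N2 (torus3 n) (zmul p Z))%E.
Proof.
move=> [F [c ->]]; rewrite (N2_lincomb (@L2_chr2 R n) (@inner_chr2 R n)).
have := is_weyl_zak_isometry _ (trig_lift F c Lphi HZ).
move=> ->; last first.
  by apply: L2_lincomb => kl; exact: L2_twisted.
have := CP F (fun kl => c kl * ((twist_phase kl)^*)%R).
rewrite (_ : \sum_(j <- F) sqn (c j * _) = \sum_(j <- F) sqn (c j))//.
by apply: eq_bigr => kl _; rewrite sqnM sqn_conj sqn_twist_phase mulr1.
Qed.

Lemma zmul_upper q : L2 (torus2 n) q ->
  (N2 (torus3 n) (zmul q Z) <= (2 * C)%:E * N2 (torus2 n) q)%E.
Proof.
move=> Lq; have mq := L2_cmeasurable Lq.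
have [p_ [sp pq pae]] := closed_span_ae_approx (@L2_chr2 R n) (torus2_dense Lq).
have mp k : cmeasurable (p_ k) by apply: L2_cmeasurable (inspan_L2 (@L2_chr2 R n) (sp k)).
apply/lee_addgt0Pr => eps eps0.
(* The factor 2 of [N2D_le2] turns [C] into [2 * C], on the main term as on the error; the added 1
   avoids a division by 0 when [C = 0]. *)
have e1 : 0 < eps / (2 * C + 1) by rewrite divr_gt0// ltr_wpDl// mulr_ge0.
have [N NP] := pq _ e1.
apply: (@N2_fatou _ _ _ _ (fun k => zmul (p_ k) Z) _ _ N).
- by move=> k; exact: cmeasurable_zmul.
- exact: cmeasurable_zmul.
- have := ae_prodm_fst (leb n) pae; apply: filterS => p cp.
  by apply: ccvgM => //; exact: ccvg_cst.
- move=> k /NP h; apply: (le_trans (trig_bounds (sp k)).1).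
  have := N2D_le2 (torus2 n) mq (cmeasurableB (mp k) mq).
  rewrite (_ : (fun x => _) = p_ k); last by apply/funext => x; rewrite addrC subrK.
  rewrite (N2_sub _ (p_ k)) => h'.
  apply: (@le_trans _ _ (C%:E * (2%:E * N2 (torus2 n) q + 2%:E * (eps / (2 * C + 1))%:E))%E).
    apply: lee_wpmul2l; first by rewrite lee_fin.
    by apply: (le_trans h'); apply: leeD => //; exact: lee_wpmul2l.
  rewrite (N2rE Lq) -!EFinM -!EFinD lee_fin.
  have : 2 * C * (eps / (2 * C + 1)) <= eps.
    by have C0' : 0 <= C := C0; rewrite mulrA ler_pdivrMr ?ltr_wpDl ?mulr_ge0//; nra.
  by lra.
Qed.

Lemma zmul_lower q : L2 (torus2 n) q ->
  (N2 (torus2 n) q <= C%:E * N2 (torus3 n) (zmul q Z))%E.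
Proof.
move=> Lq; have mq := L2_cmeasurable Lq; have C0' : 0 <= C := C0.
have mzq : cmeasurable (zmul q Z) by exact: cmeasurable_zmul.
(* The constant is absorbed into the function, giving the plain comparison of norms that
   [N2_le_approx] expects. *)
pose c : R[i] := (Num.sqrt C)%:C.
have cC : sqn c = C by rewrite sqn_real sqr_sqrtr.
have mc (Y : Rn R n * Rn R n * Rn R n -> R[i]) : cmeasurable Y -> cmeasurable (fun p => c * Y p).
  by move=> mY; apply: cmeasurableM => //; exact: cmeasurable_cst.
rewrite -cC -N2Z//; apply: N2_le_approx => //; first exact: mc.
(* An error of [eps / D] must be at most [eps] on the torus, and also after multiplication by
   [2 * C], from the upper bound, and by [C], from [c]. This choice of [D] meets both demands. *)
move=> eps eps0; pose D : R := 1 + 2 * C * C; have D1 : 1 <= D by rewrite /D; nra.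
have [p_ [sp pq _]] := closed_span_ae_approx (@L2_chr2 R n) (torus2_dense Lq).
have [|N /(_ N (leqnn N)) h] := pq (eps / D); first by rewrite divr_gt0//; lra.
have Lp' : L2 (torus2 n) (p_ N) by exact: (inspan_L2 (@L2_chr2 R n) (sp N)).
have mzp : cmeasurable (zmul (p_ N) Z) by apply: cmeasurable_zmul => //; exact: L2_cmeasurable Lp'.
exists (p_ N), (fun p => c * zmul (p_ N) Z p); split.
- exact: L2_cmeasurable Lp'.
- exact: mc.
- by rewrite N2Z// cC; exact: (trig_bounds (sp N)).2.
- by apply: (le_trans h); rewrite lee_fin ler_pdivrMr ?(lt_le_trans ltr01)// ler_peMr// ltW.
rewrite (_ : (fun x => _) = fun x => c * zmul (fun x => q x - p_ N x) Z x); last first.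
  by apply/funext => x; rewrite -mulrBr -zmul_subl.
rewrite N2Z; last by apply: cmeasurable_zmul => //; apply: cmeasurableB => //; exact: L2_cmeasurable Lp'.
rewrite cC; apply: (@le_trans _ _ (C%:E * ((2 * C)%:E * (eps / D)%:E))%E).
  apply: lee_wpmul2l; first by rewrite lee_fin.
  apply: (le_trans (zmul_upper (L2B Lq Lp'))); apply: lee_wpmul2l => //.
  by rewrite lee_fin; lra.
by rewrite -!EFinM lee_fin !mulrA ler_pdivrMr; [rewrite /D; nra|lra].
Qed.

Lemma fiber_bounds : exists2 ab : R * R, 0 < ab.1 <= ab.2 &
  \forall x \ae torus2 n, (ab.1%:E <= fiber Z x <= ab.2%:E)%E.
Proof.
have mB := measurable_fiber mZ.
(* The multiplier bounds are tested on indicators of level sets: C A < 1 forces the set where the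
   fiber norm is below [A] to be null, and D > 2 C does the same for the set where it exceeds [D].
   Adding [A] to [D] makes A <= D immediate. *)
pose A : R := (C + 1)^-1; pose D := 2 * C + 1 + A.
have C0' : 0 <= C := C0.
have A0 : 0 < A by rewrite invr_gt0; lra.
have ind (E : set (Rn R n * Rn R n)) : measurable E ->
    [/\ L2 (torus2 n) (fun x => (\1_E x)%:C), N2 (torus2 n) (fun x => (\1_E x)%:C) = torus2 n E &
      N2 (torus3 n) (zmul (fun x => (\1_E x)%:C) Z) = (\int[torus2 n]_(x in E) fiber Z x)%E].
  move=> mE; have mI := cmeasurable_indic (R := R) mE; split.
  - by apply: (bounded_L2 (torus2_fin n) (C := 1)) => // x; exact: sqn_indic_le1.
  - rewrite /N2 -[in RHS](setIT E) -integral_indic//; apply: eq_integral => x _.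
    by rewrite sqn_real indicE; case: (_ \in _); rewrite ?expr1n ?expr0n.
  - rewrite N2_zmul// [RHS]integral_mkcond; apply: eq_integral => x _.
    rewrite patchE sqn_real indicE; case: (x \in E).
      by rewrite expr1n mul1e.
    by rewrite expr0n mul0e.
have null (E : set (Rn R n * Rn R n)) : measurable E -> forall a b : R, 0 <= a < b ->
    (b%:E * torus2 n E <= a%:E * torus2 n E)%E -> torus2 n E = 0%E.
  move=> mE a b /andP[a0 ab].
  have : torus2 n E \is a fin_num.
    rewrite ge0_fin_numE//; apply: le_lt_trans (torus2_fin n).
    by apply: le_measure; rewrite ?inE//; exact: measurableT.
  move=> /fineK <-; rewrite -!EFinM lee_fin => h; congr (_%:E).
  apply/eqP; rewrite eq_le; apply/andP; split; last by apply: fine_ge0.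
  have := @fine_ge0 _ _ (measure_ge0 (torus2 n) E); nra.
have mlt (a : R) : measurable [set x | (fiber Z x < a%:E)%E].
  by rewrite -[X in measurable X]setTI; exact: emeasurable_fun_infty_o.
have mgt (a : R) : measurable [set x | (a%:E < fiber Z x)%E].
  by rewrite -[X in measurable X]setTI; exact: emeasurable_fun_o_infty.
exists (A, D); first by rewrite A0 /= /D; lra.
have lo : \forall x \ae torus2 n, ~ (fiber Z x < A%:E)%E.
  exists [set x | (fiber Z x < A%:E)%E]; split => //; last by move=> x /= /contrapT.
  set E := [set x | _]; have [LE NE ZE] := ind _ (mlt A).
  apply: (null _ (mlt A) (C * A) 1).
    apply/andP; split; first exact: mulr_ge0 C0' (ltW A0).
    by rewrite /A ltr_pdivrMr ?mul1r; lra.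
  rewrite mul1e -NE; apply: (le_trans (zmul_lower LE)); rewrite ZE.
  rewrite [(C * A)%:E]EFinM -muleA; apply: lee_wpmul2l; first by rewrite lee_fin; lra.
  rewrite NE -integral_cst//; apply: ge0_le_integral => //.
  - by move=> x _; exact: N2_ge0.
  - exact: measurable_funTS.
  - by move=> x /= /ltW.
have hi : \forall x \ae torus2 n, ~ (D%:E < fiber Z x)%E.
  exists [set x | (D%:E < fiber Z x)%E]; split => //; last by move=> x /= /contrapT.
  set E := [set x | _]; have [LE NE ZE] := ind _ (mgt D).
  apply: (null _ (mgt D) (2 * C) D).
    by apply/andP; split; rewrite /D; lra.
  rewrite -[X in (_ <= _ * X)%E]NE; apply: le_trans (zmul_upper LE); rewrite ZE.
  rewrite -integral_cst//; apply: ge0_le_integral => //.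
  - by move=> x _; rewrite lee_fin /D; lra.
  - exact: measurable_funTS.
  - by move=> x /ltW.
apply: filterS2 lo hi => x /negP; rewrite -leNgt => h1 /negP; rewrite -leNgt => h2.
by rewrite h1.
Qed.

End riesz_fiber.

Lemma is_weyl_zakZ (a : R[i]) phi Z : L2 (leb2 n) phi -> is_weyl_zak phi Z ->
  is_weyl_zak (fun p => a * phi p) (fun p => a * Z p).
Proof.
move=> Lphi HZ; have := is_weyl_zak_linear (a - 1) Lphi Lphi HZ HZ.
by congr is_weyl_zak; apply/funext => p; rewrite mulrBl mul1r subrK.
Qed.

(** The hypothesis says that multiplying [Z] by functions of the torus variables is isometric. By
    polarization the inner products of translates are those of the characters times unimodular
    constants. *)
Lemma twisted_orthonormal phi Z : L2 (leb2 n) phi -> is_weyl_zak phi Z ->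
  (forall q, cmeasurable q -> N2 (torus3 n) (zmul q Z) = N2 (torus2 n) q) ->
  forall k l, inner (leb2 n) (twisted_translation k phi) (twisted_translation l phi) = (k == l)%:R.
Proof.
move=> Lphi HZ NZ k l.
pose e (kl : Zn n * Zn n) x : R[i] := twist_phase kl * chr2 kl x.
have me kl : cmeasurable (e kl).
  by apply: cmeasurableM; [exact: cmeasurable_cst|exact: cmeasurable_chr2].
have Le kl : L2 (torus2 n) (e kl) by apply: L2Z; exact: L2_chr2.
have LT kl := L2_twisted kl Lphi.
transitivity (inner (torus2 n) (e k) (e l)); last first.
  rewrite innerZl; [|exact: L2_chr2|exact: Le].
  rewrite inner_conj innerZl; [|exact: L2_chr2|exact: L2_chr2].
  rewrite inner_chr2 eq_sym; have [->|_] := eqVneq k l; last by rewrite mulr0 rmorph0 mulr0.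
  by rewrite mulr1 mulc_conj sqn_twist_phase.
apply: (inner_polar (LT k) (LT l) (Le k) (Le l)) => a b.
have Ha := is_weyl_zak_twisted k Lphi HZ.
have Hb := is_weyl_zakZ b (LT l) (is_weyl_zak_twisted l Lphi HZ).
have Lb : L2 (leb2 n) (fun p => b * twisted_translation l phi p) by exact: L2Z.
rewrite -(is_weyl_zak_isometry _ (is_weyl_zak_linear a (LT k) Lb Ha Hb)); last first.
  by apply: L2D => //; exact: L2Z.
rewrite -NZ; last by apply: cmeasurableD; apply: cmeasurableM => //; exact: cmeasurable_cst.
by apply: eq_N2 => p; congr sqn; rewrite /zmul /e mulrDl !mulrA.
Qed.

End multipliers.

(** * The orthonormal generator *)

Lemma sqrtC_real (R : realType) (b : R) : 0 <= b -> sqrtC (b%:C : R[i]) = (Num.sqrt b)%:C.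
Proof.
move=> b0; rewrite -{1}(sqr_sqrtr b0) rmorphXn /= sqrCK//.
by rewrite lecR sqrtr_ge0.
Qed.

Theorem theorem5p3 (R : realType) (n : nat) (hn : (0 < n)%N)
    (phi : Rn R n * Rn R n -> R[i])
    (phi_L2 : L2 (leb2 n) phi)
    (phi_riesz : riesz_sequence (leb2 n)
      (fun kl : Zn n * Zn n => twisted_translation kl phi)) :
  exists phit : Rn R n * Rn R n -> R[i],
    [/\ twisted_space phi phit,
        orthonormal_in (leb2 n) (twisted_space phi)
          (fun kl : Zn n * Zn n => twisted_translation kl phit),
        twisted_space phi = twisted_space phit
      & weyl_zak phit = (fun p => (sqrtC (bracket phi phi p.1))^-1 * weyl_zak phi p)
          %[ae torus3 n]].
Proof.
have HZ := weyl_zakP phi_L2; set Z := weyl_zak phi in HZ *.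
have LZ := is_weyl_zak_L2 HZ; have mZ := L2_cmeasurable LZ.
have [C C0 CP] := riesz_bounds (fun kl => L2_twisted kl phi_L2) phi_riesz.
(* The bound [2 * C] is raised by 1 because a positive constant is required and [C] may be 0. *)
have up q : L2 (torus2 n) q -> (N2 (torus3 n) (zmul q Z) <= (2 * C + 1)%:E * N2 (torus2 n) q)%E.
  move=> Lq; apply: (le_trans (zmul_upper phi_L2 HZ C0 CP Lq)).
  by apply: lee_wpmul2r; [exact: N2_ge0|rewrite lee_fin; lra].
have C1 : 0 < 2 * C + 1 by lra.
have [[a b] /= /andP[a0 ab] fib] := fiber_bounds phi_L2 HZ C0 CP.
(* Truncated so as to be bounded and bounded away from 0 everywhere. *)
pose B x : R := Num.max a (Num.min b (fine (fiber Z x))).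
have fibE : \forall x \ae torus2 n, fiber Z x = (B x)%:E.
  apply: filterS fib => x /andP[h1 h2].
  have fx : fiber Z x \is a fin_num.
    by rewrite ge0_fin_numE ?N2_ge0//; apply: (le_lt_trans h2); exact: ltry.
  move: h1 h2; rewrite /B -{1 2}(fineK fx) !lee_fin => h1 h2.
  by rewrite (min_idPr h2) (max_idPr h1) fineK.
have aB x : a <= B x by rewrite le_max lexx.
have Bb x : B x <= b by rewrite ge_max ab ge_min lexx.
have B0 x : 0 < B x by exact: lt_le_trans (aB x).
have mB : measurable_fun setT B.
  apply: measurable_maxr; first exact: measurable_cst.
  apply: measurable_minr; first exact: measurable_cst.
  by apply: (measurableT_comp (f := fine)) (measurable_fiber mZ); exact: fine_measurable.
(* Thanks to the truncation, both powers of [B] are bounded, hence in L^2 of the torus and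
   admissible as multipliers. *)
pose h x : R[i] := (powR (B x) (- 2^-1))%:C.
pose g x : R[i] := (powR (B x) 2^-1)%:C.
have mh : cmeasurable h.
  by apply: cmeasurable_real; apply: (measurableT_comp (measurable_powR _)).
have mg : cmeasurable g.
  by apply: cmeasurable_real; apply: (measurableT_comp (measurable_powR _)).
have sg x : sqn (g x) = B x.
  by rewrite sqn_real powR12_sqrt ?ltW// sqr_sqrtr// ltW.
have sh x : sqn (h x) = (B x)^-1.
  by rewrite sqn_real powRN powR12_sqrt ?ltW// exprVn sqr_sqrtr// ltW.
have gh x : g x * h x = 1.
  rewrite -rmorphM /= powRN divff// powR12_sqrt ?ltW//; by rewrite gt_eqF// sqrtr_gt0.
have Lh : L2 (torus2 n) h.
  apply: (bounded_L2 (torus2_fin n) (C := a^-1)) => // x.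
  by rewrite sh lef_pV2// posrE.
have Lg : L2 (torus2 n) g.
  by apply: (bounded_L2 (torus2_fin n) (C := b)) => // x; rewrite sg.
have [phit [Vphit Zt]] := zak_mult_in_span phi_L2 HZ up C1 Lh.
have Lphit := closed_span_L2 Vphit.
have HZt := weyl_zakP Lphit; set Y := weyl_zak phit in HZt Zt *.
have mY := L2_cmeasurable (is_weyl_zak_L2 HZt).
(* Almost everywhere |q h|^2 w = |q|^2, which expresses that the bracket of [phit] with itself is
   1. *)
have NY q : cmeasurable q -> N2 (torus3 n) (zmul q Y) = N2 (torus2 n) q.
  move=> mq; have mqh : cmeasurable (fun x => q x * h x) by exact: cmeasurableM.
  rewrite (ae_N2 (g := zmul (fun x => q x * h x) Z)); last 3 first.
  - exact: cmeasurable_zmul.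
  - exact: cmeasurable_zmul.
  - by apply: filterS Zt => p /(_ I) E _; rewrite /zmul E /zmul mulrA.
  rewrite N2_zmul//; apply: ae_eq_integral => //.
  - by apply: emeasurable_funM; [exact: emeasurable_sqn|exact: measurable_fiber].
  - exact: emeasurable_sqn.
  - apply: filterS fibE => x E _; rewrite E sqnM sh -EFinM -mulrA mulVf ?mulr1//.
    by rewrite gt_eqF.
have LT kl := L2_twisted kl Lphit.
have phaseL (q : Rn R n * Rn R n -> R[i]) kl : L2 (torus2 n) q -> 
    L2 (torus2 n) (fun x => twist_phase kl * chr2 kl x * q x).
  move=> Lq; apply: (L2_le _ Lq); last by move=> x; rewrite sqnM sqnM sqn_twist_phase sqn_chr2 !mul1r.
  apply: cmeasurableM; last exact: L2_cmeasurable Lq.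
  by apply: cmeasurableM; [exact: cmeasurable_cst|exact: cmeasurable_chr2].
(* The multiplier of the translate is [h] times a phase and a character. *)
have VT kl : twisted_space phi (twisted_translation kl phit).
  apply: (zak_mult_span phi_L2 HZ up C1 (LT kl) (phaseL _ kl Lh)).
  have := is_weyl_zak_unique (LT kl) (weyl_zakP (LT kl)) (is_weyl_zak_twisted kl Lphit HZt).
  apply: filterS2 Zt => p /(_ I) E1 /(_ I) E2 _; apply: etrans E2 _.
  by rewrite /zmul -[RHS]mulrA; congr (_ * _); exact: E1.
(* The roles are exchanged: [phit] generates, with the bound 1 provided by [NY], and [g] recovers
   the transform of [phi] because g h = 1. *)
have VT' kl : twisted_space phit (twisted_translation kl phi).
  have up' q : L2 (torus2 n) q -> (N2 (torus3 n) (zmul q Y) <= 1%:E * N2 (torus2 n) q)%E.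
    by move=> Lq; rewrite mul1e NY//; exact: L2_cmeasurable Lq.
  have LT' := L2_twisted kl phi_L2.
  apply: (zak_mult_span Lphit HZt up' ltr01 LT' (phaseL _ kl Lg)).
  have := is_weyl_zak_unique LT' (weyl_zakP LT') (is_weyl_zak_twisted kl phi_L2 HZ).
  apply: filterS2 Zt => p /(_ I) E1 /(_ I) E2 _; rewrite E2 /zmul E1 /zmul.
  by rewrite -!mulrA (mulrA (g p.1)) gh mul1r.
exists phit; split.
- exact: Vphit.
- by split=> //; exact: (twisted_orthonormal Lphit HZt NY).
- apply/seteqP; split; apply: closed_span_sub => //.
  by move=> kl; exact: L2_twisted.
- have := ae_prodm_fst (leb n) fibE; apply: filterS2 Zt => p /(_ I) E1 E2 _.
  rewrite [LHS]E1 /zmul; congr (_ * _).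
  rewrite (_ : bracket phi phi p.1 = (B p.1)%:C); last first.
    rewrite /bracket -[LHS]/(inner (leb n) (fun eta => Z (p.1, eta)) (fun eta => Z (p.1, eta))).
    by rewrite innerff /N2r -[N2 _ _]/(fiber Z p.1) E2.
  rewrite sqrtC_real ?(ltW (B0 _))// -fmorphV /h powRN powR12_sqrt// ltW//.
Qed.
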